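(* Assume $\mathcal I\neq\emptyset$ and that the graph $\mathcal G$ has no tadpoles. If the maximal isotropic subspace $\mathcal M\subset{}^d\mathcal K$ is locally strictly positive, then the Green function satisfies $r_{\mathcal M}(x,y;i\varkappa,\underline a)\succ0$ (all entries positive) for all sufficiently large $\varkappa\geq0$.
   Context: Let $\mathcal G=(V,\mathcal I,\mathcal E,\partial)$ be a finite connected graph: $V$ vertices, $\mathcal I$ internal edges, $\mathcal E$ external edges; $\partial$ assigns to $i\in\mathcal I$ an ordered pair $(\partial^-(i),\partial^+(i))$ of vertices and to $e\in\mathcal E$ a vertex $\partial(e)$; $i$ is a tadpole if $\partial^-(i)=\partial^+(i)$. Fix lengths $a_i>0$; $I_i=[0,a_i]$, $I_e=[0,\infty)$; $\mathcal H=\bigoplus_jL^2(I_j)$; $\mathcal D$ = $\psi\in\mathcal H$ with $\psi_j,\psi_j'$ absolutely continuous, $\psi_j''\in L^2$. $\mathcal K=\mathcal K_{\mathcal E}\oplus\mathcal K^{(-)}_{\mathcal I}\oplus\mathcal K^{(+)}_{\mathcal I}\cong\mathbb C^{|\mathcal E|}\oplus\mathbb C^{|\mathcal I|}\oplus\mathbb C^{|\mathcal I|}$ with elements $\chi=(\{\chi_e\},\{\chi^{(-)}_i\},\{\chi^{(+)}_i\})$; ${}^d\mathcal K=\mathcal K\oplus\mathcal K$ with symplectic form $\omega(\chi,\chi')=\langle\chi,J\chi'\rangle$, $J=\begin{pmatrix}0&\mathbb I\\-\mathbb I&0\end{pmatrix}$. For $\psi\in\mathcal D$: $\underline\psi=(\{\psi_e(0)\},\{\psi_i(0)\},\{\psi_i(a_i)\})$,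 $\underline\psi'=(\{\psi_e'(0)\},\{\psi_i'(0)\},\{-\psi_i'(a_i)\})$. Maximal isotropic subspaces are $\mathcal M(A,B)=\{\chi_1\oplus\chi_2:A\chi_1+B\chi_2=0\}$ with $(A,B)$ of rank $|\mathcal E|+2|\mathcal I|$ and $AB^\dagger$ self-adjoint. $\Delta(\mathcal M,\underline a)$ acts by $\psi_j''$ on $\{\psi\in\mathcal D:A\underline\psi+B\underline\psi'=0\}$ and is self-adjoint. For $\mathsf k$ with $\det(A+i\mathsf kB)\ne0$, $\mathfrak S(\mathsf k;\mathcal M)=-(A+i\mathsf kB)^{-1}(A-i\mathsf kB)$. For $v\in V$ let $\mathcal L_v\subset\mathcal K$ be the subspace of $\chi$ with $\chi_e=0$ unless $\partial(e)=v$, $\chi_i^{(-)}=0$ unless $\partial^-(i)=v$, $\chi_i^{(+)}=0$ unless $\partial^+(i)=v$; so $\mathcal K=\bigoplus_v\mathcal L_v$, and ${}^d\mathcal L_v=\mathcal L_v\oplus\mathcal L_v$ inherits the symplectic form. The boundary conditions are local if $\mathcal M=\bigoplus_{v}\mathcal M(v)$ with each $\mathcal M(v)$ a maximal isotropic subspace of ${}^d\mathcal L_v$; then $\mathfrak S(\mathsf k;\mathcal M(v))$ is the corresponding operator on $\mathcal L_v$ (matrix in the natural coordinate basis of $\mathcal L_v$). $\mathcal M$ is locally strictly positive if it is local and there is $\varkappa_0\geq0$ such that $\mathbb I+\mathfrak S(i\varkappa;\mathcal M(v))$ has all entries positive for all $\varkappa\ge\varkappa_0$ and all $v\in V$. The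 Green function $r_{\mathcal M}(x,y;i\varkappa,\underline a)$ is the $(|\mathcal E|+|\mathcal I|)\times(|\mathcal E|+|\mathcal I|)$ matrix integral kernel of $(-\Delta(\mathcal M,\underline a)+\varkappa^2)^{-1}$: $((-\Delta+\varkappa^2)^{-1}\varphi)_j(x_j)=\sum_{j'}\int_{I_{j'}}[r_{\mathcal M}]_{j,j'}\varphi_{j'}(y_{j'})dy_{j'}$. $C\succ0$ means all entries of $C$ are positive. *)

(* Defs.v *)
From HB Require Import structures.
From mathcomp Require Import all_boot all_order all_algebra.
From mathcomp Require Import all_classical all_reals all_analysis.
From mathcomp Require Import complex.

Set Implicit Arguments.
Unset Strict Implicit.
Unset Printing Implicit Defensive.

Import Order.TTheory GRing.Theory Num.Theory.
Import numFieldNormedType.Exports.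
Local Open Scope classical_set_scope.
Local Open Scope ring_scope.

Definition adjmx (R : rcfType) (m n : nat) (M : 'M[R[i]]_(m, n)) : 'M[R[i]]_(n, m) :=
  (map_mx (@conjc R) M)^T.

(* (A,B) defines a maximal isotropic subspace M(A,B) of C^n (+) C^n:
   rank (A,B) = n and A B^dagger self-adjoint *)
Definition max_isotropic (R : rcfType) (n : nat) (A B : 'M[R[i]]_n) : Prop :=
  \rank (row_mx A B) = n /\ adjmx (A *m adjmx B) = A *m adjmx B.

Definition in_M (R : rcfType) (n : nat) (A B : 'M[R[i]]_n) (chi1 chi2 : 'cV[R[i]]_n) : Prop :=
  A *m chi1 + B *m chi2 = 0.

(* S(k; M(A,B)) at k = i*kappa:  -(A + i k B)^{-1} (A - i k B)
   = -(A - kappa B)^{-1} (A + kappa B). *)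
Definition Smx_ikappa (R : rcfType) (n : nat) (A B : 'M[R[i]]_n) (kappa : R) : 'M[R[i]]_n :=
  - (invmx (A - (kappa%:C)%C *: B) *m (A + (kappa%:C)%C *: B)).

Section Graph.
Variables (V : finType) (nE nI : nat)
  (dE : 'I_nE -> V) (dm dp : 'I_nI -> V).

Definition gadj : rel V := fun v w =>
  [exists i : 'I_nI, ((dm i == v) && (dp i == w)) || ((dm i == w) && (dp i == v))].
Definition connected_graph : Prop := forall v w : V, connect gadj v w.

Definition no_tadpoles : Prop := forall i : 'I_nI, dm i != dp i.

(* K = K_E (+) K_I^- (+) K_I^+ ,  dimension |E| + |I| + |I| *)
Definition Kdim := (nE + nI + nI)%N.

Definition kvert (k : 'I_Kdim) : V :=
  match @fintype.split (nE + nI)%N nI k with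
  | inl k1 => match @fintype.split nE nI k1 with inl e => dE e | inr i => dm i end
  | inr i => dp i
  end.

Definition Lpred (v : V) : pred 'I_Kdim := [pred k | kvert k == v].
Definition Ldim (v : V) : nat := #|Lpred v|.
Definition Lidx (v : V) (l : 'I_(Ldim v)) : 'I_Kdim := enum_val l.

Variable R : realType.

Definition restrL (v : V) (chi : 'cV[R[i]]_Kdim) : 'cV[R[i]]_(Ldim v) :=
  \col_(l < Ldim v) chi (Lidx l) ord0.

(* M(A,B) = (+)_v M(Av v, Bv v), each M(Av v, Bv v) maximal isotropic in dL_v *)
Definition local_decomposition (A B : 'M[R[i]]_Kdim)
    (Av Bv : forall v : V, 'M[R[i]]_(Ldim v)) : Prop :=
  (forall v, max_isotropic (Av v) (Bv v)) /\
  (forall chi1 chi2 : 'cV[R[i]]_Kdim,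
      in_M A B chi1 chi2 <-> forall v, in_M (Av v) (Bv v) (restrL v chi1) (restrL v chi2)).

Definition local_bc (A B : 'M[R[i]]_Kdim) : Prop :=
  exists Av Bv, local_decomposition A B Av Bv.

(* locally strictly positive: local and I + S(i kappa; M(v)) has all entries
   positive (S defined, i.e. A_v - kappa B_v invertible) for kappa >= kappa0 *)
Definition locally_strictly_positive (A B : 'M[R[i]]_Kdim) : Prop :=
  exists Av Bv, local_decomposition A B Av Bv /\
  exists kappa0 : R, 0 <= kappa0 /\
    forall kappa : R, kappa0 <= kappa -> forall v : V,
      (Av v - (kappa%:C)%C *: Bv v) \in unitmx /\
      forall l l' : 'I_(Ldim v), 0 < (1%:M + Smx_ikappa (Av v) (Bv v) kappa) l l'.

Definition edge := ('I_nE + 'I_nI)%type.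

Variable a : 'I_nI -> R.

Definition Iset (j : edge) : set R :=
  match j with
  | inl _ => [set x | 0 <= x]
  | inr i => [set x | 0 <= x /\ x <= a i]
  end.

Definition Iint (j : edge) : set R :=
  match j with
  | inl _ => [set x | 0 < x]
  | inr i => [set x | 0 < x /\ x < a i]
  end.

Definition mu := @lebesgue_measure R.

Definition L2_on (D : set R) (f : R -> R[i]) : Prop :=
  measurable_fun D (fun x => complex.Re (f x)) /\ measurable_fun D (fun x => complex.Im (f x)) /\
  (\int[mu]_(x in D) ((complex.Re (f x)) ^+ 2 + (complex.Im (f x)) ^+ 2)%:E < +oo)%E.

Definition in_H (phi : edge -> R -> R[i]) : Prop := forall j, L2_on (Iset j) (phi j).

Definition abs_cont_on (s0 t0 : R) (f : R -> R) : Prop :=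
  forall eps : R, 0 < eps -> exists2 delta : R, 0 < delta &
    forall (n : nat) (s t : nat -> R),
      (forall k, (k < n)%N -> s0 <= s k /\ s k <= t k /\ t k <= t0) ->
      (forall k, (k.+1 < n)%N -> t k <= s k.+1) ->
      \sum_(k < n) (t k - s k) < delta ->
      \sum_(k < n) `|f (t k) - f (s k)| < eps.

Definition abs_cont_edge (j : edge) (f : R -> R[i]) : Prop :=
  let P := fun s0 t0 => abs_cont_on s0 t0 (fun x => complex.Re (f x)) /\
                         abs_cont_on s0 t0 (fun x => complex.Im (f x)) in
  match j with
  | inl _ => forall b : R, 0 <= b -> P 0 b
  | inr i => P 0 (a i)
  end.

Definition cderiv_at (f : R -> R[i]) (x : R) (g : R[i]) : Prop :=
  is_derive x (1 : R) (fun y => complex.Re (f y)) (complex.Re g) /\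
  is_derive x (1 : R) (fun y => complex.Im (f y)) (complex.Im g).

Definition in_D (psi psi1 psi2 : edge -> R -> R[i]) : Prop :=
  in_H psi /\
  forall j : edge,
    abs_cont_edge j (psi j) /\ abs_cont_edge j (psi1 j) /\
    (forall x, Iint j x -> cderiv_at (psi j) x (psi1 j x)) /\
    {ae mu, forall x, Iint j x -> cderiv_at (psi1 j) x (psi2 j x)} /\
    L2_on (Iset j) (psi2 j).

Definition bval (psi : edge -> R -> R[i]) : 'cV[R[i]]_Kdim :=
  \col_(k < Kdim)
    match @fintype.split (nE + nI)%N nI k with
    | inl k1 => match @fintype.split nE nI k1 with
                | inl e => psi (inl e) 0
                | inr i => psi (inr i) 0
                end
    | inr i => psi (inr i) (a i)
    end.

Definition bder (psi1 : edge -> R -> R[i]) : 'cV[R[i]]_Kdim :=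
  \col_(k < Kdim)
    match @fintype.split (nE + nI)%N nI k with
    | inl k1 => match @fintype.split nE nI k1 with
                | inl e => psi1 (inl e) 0
                | inr i => psi1 (inr i) 0
                end
    | inr i => - psi1 (inr i) (a i)
    end.

Definition cintegrable (D : set R) (f : R -> R[i]) : Prop :=
  mu.-integrable D (fun y => (complex.Re (f y))%:E) /\ mu.-integrable D (fun y => (complex.Im (f y))%:E).
Definition cintegral (D : set R) (f : R -> R[i]) : R[i] :=
  Complex (Rintegral mu D (fun y => complex.Re (f y))) (Rintegral mu D (fun y => complex.Im (f y))).

Definition kernel := edge -> edge -> R -> R -> R[i].

Definition kernel_apply (r : kernel) (phi : edge -> R -> R[i]) : edge -> R -> R[i] :=
  fun j x => \sum_(j' : edge) cintegral (Iset j') (fun y => r j j' x y * phi j' y).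

(* r is (the continuous version of) the Green function r_M(x,y; i kappa, a),
   i.e. the integral kernel of (-Delta(M,a) + kappa^2)^{-1}:
   for every phi in H, psi := r phi lies in the domain of Delta(M,a)
   (psi in D and A psi + B psi' = 0) and (-Delta + kappa^2) psi = phi. *)
Definition green_kernel (A B : 'M[R[i]]_Kdim) (kappa : R) (r : kernel) : Prop :=
  (forall j j', {within [set p : R * R | Iset j p.1 /\ Iset j' p.2],
                  continuous ((fun p => complex.Re (r j j' p.1 p.2)) : R * R -> R)} /\
                {within [set p : R * R | Iset j p.1 /\ Iset j' p.2],
                  continuous ((fun p => complex.Im (r j j' p.1 p.2)) : R * R -> R)}) /\
  forall phi, in_H phi ->
    (forall j j' x, Iset j x -> cintegrable (Iset j') (fun y => r j j' x y * phi j' y)) /\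
    let psi := kernel_apply r phi in
    exists psi1 psi2 : edge -> R -> R[i],
      in_D psi psi1 psi2 /\
      A *m bval psi + B *m bder psi1 = 0 /\
      forall j : edge, {ae mu, forall x, Iset j x ->
        - psi2 j x + (kappa ^+ 2)%:C%C * psi j x = phi j x}.

End Graph.

(* Main.v *)
(* On every edge the resolvent is a Dirichlet Green function plus a combination
   of the harmonic functions of [- d^2/dx^2 + kappa^2] which are 1 at one
   endpoint and 0 at the other.  The Dirichlet part is nonnegative, so positivity
   reduces to that of the boundary values [b] of [r(., z)].  The matching
   conditions read [b = P (s + N b - e b)], where [P = I + S(i kappa; M)],
   [s >= 0] collects the harmonic functions of the edge of [z], and [N], [e] are
   edge transmission factors of order [exp (- kappa a)].  Being a rational
   function of [kappa] that is eventually positive on each vertex block, [P]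
   decays slower than any exponential, so for large [kappa] the correction
   [(1 + P e)^-1 P] is still positive on vertex blocks; a discrete minimum
   principle together with the connectedness of the graph gives [b > 0].
   The kernel so constructed is the only one, because the homogeneous boundary
   value problem has no solution: [psi' + kappa psi] and [psi' - kappa psi] are
   exponentials, those growing at infinity are not square integrable, and
   [T S] is a contraction, [T] being the transmission matrix. *)
Require Import Defs.
From HB Require Import structures.
From mathcomp Require Import all_boot all_order all_algebra.
From mathcomp Require Import all_classical all_reals all_analysis.
From mathcomp Require Import measurable_realfun complex ring lra.
Set Implicit Arguments.
Unset Strict Implicit.
Unset Printing Implicit Defensive.
Import Order.TTheory GRing.Theory Num.Theory.
Import numFieldNormedType.Exports.
Local Open Scope classical_set_scope.
Local Open Scope ring_scope.

(** * A discrete minimum principle *)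

(** Only [I + S] is assumed positive; diagonal entries of [S] may be negative. An expansion of the
    kernel over paths with reflections at the vertices therefore has terms of both signs, and close
    to a vertex the direct and the reflected term may nearly cancel. Subtracting the Dirichlet part
    carries out this cancellation exactly. What remains concerns finitely many numbers [b], so that
    one threshold serves all pairs of points. Between distant points these numbers are exponentially
    small, hence an additive error bound on [b] could not decide their sign. The perturbation is
    therefore done on the matrix [P], block by block, where an exponentially small term competes
    with a subexponential one; signs are carried across the edges only afterwards. The kernel has
    two expressions for this reason: one with decaying exponentials, suited to the differential
    equation and to square integrability, and one with the harmonic functions, suited to signs. *)

Section MatrixPositivity.
Variable R : realFieldType.

Lemma unitmx_inj (n : nat) (M : 'M[R]_n) :
  (forall v : 'cV_n, M *m v = 0 -> v = 0) -> M \in unitmx.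
Proof.
move=> h; rewrite -unitmx_tr -row_free_unit; apply: inj_row_free => v vM.
by apply: trmx_inj; rewrite trmx0; apply: h; rewrite -[M]trmxK -trmx_mul vM trmx0.
Qed.

(** Read off at an index where [|f|] is largest. With [b = 0] it says that a fixed vector of [X]
    vanishes. *)
Lemma contraction_bound (n : nat) (X : 'M[R]_n) (f g : 'I_n -> R) (b : R) :
  (forall k, \sum_l `|X k l| <= 1 / 2) ->
  (forall k, f k = g k + \sum_l X k l * f l) -> (forall k, `|g k| <= b) ->
  forall k, `|f k| <= 2 * b.
Proof.
move=> hX hf hg k.
have [k0 _ hk0] := @arg_maxP _ _ 'I_n k xpredT (fun k => `|f k|) isT.
suff : `|f k0| <= 2 * b by apply: le_trans; exact: hk0.
have h1 : `|\sum_l X k0 l * f l| <= 1 / 2 * `|f k0|.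
  apply: le_trans (ler_norm_sum _ _ _) _.
  apply: le_trans (_ : \sum_l `|X k0 l| * `|f k0| <= _).
    by apply: ler_sum => l _; rewrite normrM ler_wpM2l//; exact: hk0.
  by rewrite -mulr_suml ler_wpM2r.
have := ler_normD (g k0) (\sum_l X k0 l * f l); rewrite -hf.
have := hg k0; lra.
Qed.

Lemma unitmx_contraction (n : nat) (X : 'M[R]_n) :
  (forall k, \sum_l `|X k l| <= 1 / 2) -> 1%:M - X \in unitmx.
Proof.
move=> hX; apply: unitmx_inj => v hv.
apply/matrixP => k j; rewrite ord1 mxE; apply/eqP; rewrite -normr_eq0 eq_le normr_ge0 andbT.
have -> : 0 = 2 * 0 :> R by rewrite mulr0.
apply: (contraction_bound hX (f := v ^~ 0) (g := fun=> 0)) => [l|_]; last by rewrite normr0.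
rewrite add0r; move/matrixP: hv => /(_ l 0); rewrite mulmxBl mul1mx !mxE.
by move/eqP; rewrite subr_eq0 => /eqP.
Qed.

Lemma ler_rowsum (n : nat) (F : 'I_n -> R) (c : R) :
  (forall l, F l <= c) -> \sum_l F l <= n%:R * c.
Proof.
move=> h; apply: le_trans (_ : \sum_(l < n) c <= _); first exact: ler_sum.
by rewrite sumr_const card_ord mulr_natl.
Qed.

Variables (V : finType) (n : nat) (kv : 'I_n -> V) (P N : 'M[R]_n) (e : 'I_n -> R).
Variables (pm pM tau : R).
Hypothesis P_off : forall k l, kv k != kv l -> P k l = 0.
Hypothesis P_on : forall k l, kv k = kv l -> pm <= P k l /\ P k l <= pM.
Hypothesis pm_gt0 : 0 < pm.
Hypothesis pM_ge0 : 0 <= pM.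
Hypothesis e_bnd : forall k, 0 <= e k /\ e k <= tau.
Hypothesis N_bnd : forall k l, 0 <= N k l /\ N k l <= tau.
(** In order: invertibility of [1 + P e], positivity of the corrected blocks, and contraction in the
    minimum principle. *)
Hypothesis small1 : n%:R * (pM * tau) <= 1 / 2.
Hypothesis small2 : n%:R * (pM * tau * (2 * pM)) < pm.
Hypothesis small3 : n%:R * (n%:R * (2 * pM * tau)) <= 1 / 2.

Let X : 'M[R]_n := \matrix_(k, l) (- (P k l * e l)).
(** Moving the term [- e b] of the matching conditions to the left turns [P] into [P'] and leaves
    only nonnegative couplings on the right. *)
Let P' := invmx (1%:M - X) *m P.

Let P_ge0 k l : 0 <= P k l.
Proof.
have [kl|kl] := eqVneq (kv k) (kv l); last by rewrite P_off.
by have [h _] := P_on kl; apply: le_trans h; exact: ltW.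
Qed.

Let P_le k l : P k l <= pM.
Proof.
have [kl|kl] := eqVneq (kv k) (kv l); last by rewrite P_off.
by have [_ h] := P_on kl.
Qed.

Let Pe_bnd k l : `|P k l * e l| <= pM * tau.
Proof.
have [e0 e1] := e_bnd l.
by rewrite ger0_norm ?mulr_ge0// ler_pM.
Qed.

Let X_sum k : \sum_l `|X k l| <= 1 / 2.
Proof.
apply: le_trans small1; apply: ler_rowsum => l.
by rewrite mxE normrN.
Qed.

Let X_unit : 1%:M - X \in unitmx.
Proof. exact: unitmx_contraction. Qed.

Let P'_eq k l : P' k l = P k l + \sum_m X k m * P' m l.
Proof.
have : (1%:M - X) *m P' = P by rewrite /P' mulmxA mulmxV// mul1mx.
move/matrixP => /(_ k l); rewrite mulmxBl mul1mx !mxE => <-.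
by rewrite subrK.
Qed.

Let P'_bnd k l : `|P' k l| <= 2 * pM.
Proof.
apply: (contraction_bound X_sum (f := P' ^~ l) (g := P ^~ l)) => k'; first exact: P'_eq.
by rewrite ger0_norm.
Qed.

(** [X] is block diagonal along with [P], so the part of a column of [P'] outside its own block is a
    fixed vector of [X]. *)
Let P'_off k l : kv k != kv l -> P' k l = 0.
Proof.
move=> kl; apply/eqP; rewrite -normr_eq0 eq_le normr_ge0 andbT.
pose f k := if kv k == kv l then 0 else P' k l.
have -> : P' k l = f k by rewrite /f (negPf kl).
have -> : 0 = 2 * 0 :> R by rewrite mulr0.
apply: (contraction_bound X_sum (f := f) (g := fun=> 0)) => [k'|_]; last by rewrite normr0.
rewrite add0r /f; have [k'l|k'l] := eqVneq (kv k') (kv l).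
  rewrite big1// => m _; have [|ml] := eqVneq (kv m) (kv l); first by rewrite mulr0.
  by rewrite mxE P_off ?mul0r ?oppr0 ?mul0r// k'l eq_sym.
rewrite P'_eq P_off// add0r; apply: eq_bigr => m _.
have [ml|//] := eqVneq (kv m) (kv l).
by rewrite mxE P_off ?mul0r ?oppr0 ?mul0r// ml.
Qed.

Let P'_gt0 k l : kv k = kv l -> 0 < P' k l.
Proof.
move=> kl; rewrite P'_eq.
have h : `|\sum_m X k m * P' m l| <= n%:R * (pM * tau * (2 * pM)).
  apply: le_trans (ler_norm_sum _ _ _) _; apply: ler_rowsum => m.
  by rewrite normrM ler_pM// mxE normrN.
have [h1 _] := P_on kl; move: h small2 h1; rewrite ler_norml => /andP[+ _].
set S := \sum_m _; set q := n%:R * _; lra.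
Qed.

Let P'_ge0 k l : 0 <= P' k l.
Proof.
have [/P'_gt0/ltW//|kl] := eqVneq (kv k) (kv l); by rewrite P'_off.
Qed.

Variables (s b : 'I_n -> R) (k0 : 'I_n) (adj : rel V).
Hypothesis s_ge0 : forall k, 0 <= s k.
Hypothesis s_gt0 : 0 < s k0.
Hypothesis b_eq : forall k,
  b k = \sum_l P k l * (s l + \sum_m N l m * b m - e l * b l).
Hypothesis N_adj : forall v w, adj v w ->
  exists l m, [/\ kv l = v, kv m = w & 0 < N m l].
Hypothesis k0_connect : forall k, connect adj (kv k0) (kv k).

Let b_eq' k : b k = \sum_l P' k l * (s l + \sum_m N l m * b m).
Proof.
pose bv : 'cV[R]_n := \col_k b k.
pose sv : 'cV[R]_n := \col_k s k.
suff : bv = P' *m (sv + N *m bv).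
  move/matrixP => /(_ k 0); rewrite !mxE => ->; apply: eq_bigr => l _.
  by rewrite !mxE; congr (_ * (_ + _)); apply: eq_bigr => m _; rewrite !mxE.
rewrite /P' -mulmxA; apply: (canRL (mulKmx X_unit)).
apply/matrixP => i j; rewrite ord1 mulmxBl mul1mx !mxE b_eq -sumrB.
apply: eq_bigr => l _; rewrite !mxE.
rewrite (_ : \sum_j0 N l j0 * bv j0 0 = \sum_m N l m * b m); first by ring.
by apply: eq_bigr => m _; rewrite mxE.
Qed.

Let Nb_ge0 : (forall k, 0 <= b k) -> forall l, 0 <= \sum_m N l m * b m.
Proof.
by move=> b0 l; apply: sumr_ge0 => m _; rewrite mulr_ge0//; have [] := N_bnd l m.
Qed.

(* Discrete minimum principle: [b >= P' N b] where the nonnegative matrix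
   [P' N] has row sums at most 1/2. *)
Let b_ge0 k : 0 <= b k.
Proof.
have [k1 _ hk1] := @arg_minP _ _ 'I_n k xpredT b isT.
suff : 0 <= b k1 by move=> /le_trans; apply; exact: hk1.
rewrite leNgt; apply/negP => bk1.
pose q := \sum_l P' k1 l * \sum_m N l m.
have q0 : 0 <= q.
  apply: sumr_ge0 => l _; rewrite mulr_ge0//.
  by apply: sumr_ge0 => m _; have [] := N_bnd l m.
have q1 : q <= 1 / 2.
  apply: le_trans small3; apply: ler_rowsum => l.
  rewrite (_ : n%:R * _ = 2 * pM * (n%:R * tau)); last by ring.
  apply: ler_pM => //.
  - by apply: sumr_ge0 => m _; have [] := N_bnd l m.
  - by rewrite -[P' _ _]ger0_norm.
  - by apply: ler_rowsum => m; have [] := N_bnd l m.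
have : q * b k1 <= b k1.
  rewrite {2}b_eq' /q mulr_suml; apply: ler_sum => l _.
  rewrite -mulrA ler_wpM2l// mulr_suml -[leLHS]add0r lerD//.
  by apply: ler_sum => m _; rewrite ler_wpM2l//; [have [] := N_bnd l m|exact: hk1].
nra.
Qed.

(** The source makes [b] positive at the vertex of [k0]. Inside a vertex all entries of [P'] are
    positive, and across an edge some [N m l] is, so positivity spreads along a path of the
    graph. *)
Lemma potential_gt0 k : 0 < b k.
Proof.
suff H v : connect adj (kv k0) v -> forall k, kv k = v -> 0 < b k by exact: (H (kv k)).
have step k1 l : kv k1 = kv l -> 0 < s l + \sum_m N l m * b m -> 0 < b k1.
  move=> kl hl; rewrite b_eq' (bigD1 l)//= ltr_pwDl ?mulr_gt0 ?P'_gt0//.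
  apply: sumr_ge0 => m _; rewrite mulr_ge0// addr_ge0//; exact: Nb_ge0.
have base k1 : kv k1 = kv k0 -> 0 < b k1.
  by move=> h; apply: (step _ k0) => //; rewrite ltr_pwDl//; exact: Nb_ge0.
case/connectP => p; elim/last_ind: p v => [v _ -> //|p w IH v].
rewrite rcons_path last_rcons => /andP[pp pw] ->{v} k1 k1w.
have [l [m [lv mw Nml]]] := N_adj pw.
apply: (step _ m); first by rewrite k1w.
rewrite ltr_wpDl// (bigD1 l)//= ltr_pwDl//.
  by rewrite mulr_gt0//; apply: (IH (last (kv k0) p)).
by apply: sumr_ge0 => i _; rewrite mulr_ge0//; have [] := N_bnd m i.
Qed.

End MatrixPositivity.

(** * Absolutely continuous functions *)

Section AbsolutelyContinuous.
Variable R : realType.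
Implicit Types (f g : R -> R) (a b : R).

Lemma le_lebesgue_measure (A B : set R) : measurable A -> measurable B -> A `<=` B ->
  (lebesgue_measure A <= lebesgue_measure B)%E.
Proof. by move=> mA mB AB; apply: le_measure; rewrite ?inE. Qed.

Lemma is_derive_growth f (x d e : R) : is_derive x 1 f d -> 0 < e ->
  exists2 h : R, 0 < h & forall y, `|y - x| < h -> `|f y - f x| <= (`|d| + e) * `|y - x|.
Proof.
move=> [dfx dE] e0.
have : h^-1 *: (f (h *: 1 + x) - f x) @[h --> 0^'] --> d.
  by rewrite -dE; exact: dfx.
move=> /cvgrPdist_le/(_ _ e0)[/= h h0 H]; exists h => // y yx.
have [->|yx0] := eqVneq y x; first by rewrite !subrr normr0 mulr0.
have yx0' : y - x != 0 by rewrite subr_eq0.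
have := H (y - x); rewrite /= sub0r normrN => /(_ yx yx0').
rewrite [_%:A]mulr1 subrK => {}H.
rewrite -ler_pdivrMr ?normr_gt0// -normfV -normrM mulrC.
rewrite -lerBlDl; apply: le_trans H; rewrite distrC.
by apply: le_trans (lerB_dist _ _).
Qed.

(* The exceptional null set is covered by an open [U] of small measure; the
   supremum of the [t] such that the increment of [f] on [[a, t]] is at most
   [(L + e) (t - a)] plus its variation on finitely many intervals of total
   length at most [|U|] is then [b]. *)
Lemma abs_cont_derive_bound f a b (L : R) : a < b -> 0 <= L -> abs_cont_on a b f ->
  {ae @lebesgue_measure R, forall x, a < x < b -> exists2 d, is_derive x 1 f d & `|d| <= L} ->
  `|f b - f a| <= L * (b - a).
Proof.
move=> ab L0 acf [N [mN N0 fN]].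
apply/ler_addgt0Pr => e0 e0_gt0.
pose e := e0 / (b - a + 1).
have ba1 : 0 < b - a + 1 by lra.
have e_gt0 : 0 < e by rewrite divr_gt0.
have -> : e0 = e * (b - a) + e by rewrite -[X in _ = _ + X]mulr1 -mulrDr divfK// gt_eqF.
have [d d_gt0 Hd] := acf _ e_gt0.
(* The endpoints join the null set, so that a point outside [U] is interior and [f] is
   differentiable there. *)
pose B := N `|` [set a; b].
have mB : measurable B by apply: measurableU => //; exact: measurableU.
have B0 : lebesgue_measure B = 0%E.
  apply/eqP; rewrite eq_le measure_ge0 andbT.
  apply: le_trans (measureU2 _ _ _) _ => //; first exact: measurableU.
  rewrite [X in (X + _)%E]N0 add0e.
  apply: le_trans (measureU2 _ _ _) _ => //.
  by rewrite [X in (X + _)%E](@lebesgue_measure_set1 R a) [X in (_ + X)%E](@lebesgue_measure_set1 R b) adde0.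
have [|U [oU BU muU]] := @lebesgue_regularity_outer R B d mB _ d_gt0.
  by rewrite [X in (X < _)%E]B0.
have mU : measurable U by exact: measurable_realfun.open_measurable.
have muU' : (lebesgue_measure U < d%:E)%E.
  rewrite -(setDKU BU) setUC.
  apply: le_lt_trans (measureU2 _ _ _) _ => //; first exact: measurableD.
  by rewrite [X in (X + _ < _)%E]B0 add0e.
have Ufin : lebesgue_measure U \is a fin_num.
  by rewrite ge0_fin_numE ?measure_ge0// (lt_trans muU') ?ltry.
pose V t := U `&` `]a, t]%classic.
have mV t : measurable (V t) by apply: measurableI => //; exact: measurable_itv.
have Vfin t : lebesgue_measure (V t) \is a fin_num.
  rewrite ge0_fin_numE ?measure_ge0//; apply: le_lt_trans (_ : _ <= lebesgue_measure U)%E _.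
    by apply: le_lebesgue_measure => //; exact: subIsetl.
  by rewrite ltey_eq Ufin.
pose m t := fine (lebesgue_measure (V t)).
have m_ge0 t : 0 <= m t by rewrite fine_ge0 ?measure_ge0.
have m_le t : m t <= fine (lebesgue_measure U).
  by rewrite fine_le//; apply: le_lebesgue_measure => //; exact: subIsetl.
have m_homo y z : y <= z -> m y <= m z.
  move=> yz; rewrite fine_le//; apply: le_lebesgue_measure => //.
  by apply: setIS => x /=; rewrite !in_itv/= => /andP[-> /le_trans]; apply.
have m_U y z : a <= y -> y <= z -> `]y, z]%classic `<=` U -> m y + (z - y) <= m z.
  move=> ay yz yzU.
  have -> : z - y = fine (lebesgue_measure `]y, z]%classic).
    rewrite lebesgue_measure_itv/= lte_fin; case: ltP => // zy.
    by rewrite /=; apply/eqP; rewrite subr_eq0 eq_le yz zy.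
  rewrite -fineD//; last first.
    by rewrite lebesgue_measure_itv/=; case: ifP.
  rewrite -measureU; [|exact: mV|exact: measurable_itv|]; last first.
  - apply/seteqP; split => x//= [[_]]; rewrite !in_itv/= => /andP[_ xy] /andP[yx _].
    by move: (lt_le_trans yx xy); rewrite ltxx.
  - have sub : V y `|` `]y, z] `<=` V z.
      move=> x [[Ux]|yzx]; rewrite /V/= in_itv/=.
        by move=> /andP[ax xy]; split => //; rewrite in_itv/= ax (le_trans xy).
      split; first exact: yzU.
      by move: yzx; rewrite /= !in_itv/= => /andP[yx ->]; rewrite (le_lt_trans ay).
    have mW : measurable (V y `|` `]y, z]) by apply: measurableU; [exact: mV|exact: measurable_itv].
    have le := le_lebesgue_measure mW (mV z) sub.
    apply: fine_le => //.
    rewrite ge0_fin_numE; last exact: measure_ge0.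
    by apply: le_lt_trans le _; rewrite ltey_eq Vfin.
pose G t := a <= t <= b /\ exists n (s s' : nat -> R),
  [/\ forall k, (k < n)%N -> a <= s k /\ s k <= s' k /\ s' k <= t,
      forall k, (k.+1 < n)%N -> s' k <= s k.+1,
      \sum_(k < n) (s' k - s k) <= m t &
      `|f t - f a| <= (L + e) * (t - a) + \sum_(k < n) `|f (s' k) - f (s k)| ].
have Ga : G a.
  split; first by rewrite lexx ltW.
  exists 0%N, (fun=> 0), (fun=> 0); split => //.
    by rewrite big_ord0.
  by rewrite big_ord0 !subrr normr0 mulr0 addr0.
(* Near every [x] the property [G] passes from the left of [x] to its right: if [x] lies in [U], the
   interval [[y, z]] is appended to the list; otherwise the slope bound at [x] is used on both
   halves of [[y, z]]. *)
have local x : a <= x <= b -> exists2 h, 0 < h & forall y z,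
    x - h < y -> y <= x -> x <= z -> z < x + h -> z <= b -> G y -> G z.
  move=> /andP[ax xb]; have [Ux|Ux] := pselect (U x).
    have [h /= h0 hU] : nbhs x U by exact: open_nbhs_nbhs.
    exists h => // y z hy yx xz hz zb [/andP[ay yb] [n [s [s' [H1 H2 H3 H4]]]]].
    have yz : y <= z by exact: le_trans xz.
    split; first by rewrite zb (le_trans ay).
    pose t k := if (k < n)%N then s k else y; pose t' k := if (k < n)%N then s' k else z.
    exists n.+1, t, t'; rewrite !big_ord_recr/= /t /t' ltnn; split.
    - move=> k _; case: ifP => [/H1[? [? ?]]|//]; split => //; split => //; exact: le_trans yz.
    - move=> k; rewrite ltnS => kn; rewrite kn; case: ifP => [/H2//|_].
      by have [_ []] := H1 _ kn.
    - rewrite (eq_bigr (fun k : 'I_n => s' k - s k)) => [|k _]; last by rewrite ltn_ord.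
      apply: le_trans (m_U _ _ ay yz _); first by rewrite lerD2r.
      move=> w /=; rewrite in_itv/= => /andP[yw wz]; apply: hU.
      by rewrite /ball_/= ltr_distlC (lt_trans hy)//= (le_lt_trans wz).
    - rewrite (eq_bigr (fun k : 'I_n => `|f (s' k) - f (s k)|)) => [|k _]; last by rewrite ltn_ord.
      have := ler_normD (f z - f y) (f y - f a); rewrite subrKA.
      have : (L + e) * (y - a) <= (L + e) * (z - a) by rewrite ler_wpM2l ?lerD2r//; lra.
      by move: H4; set S := \sum_(k < n) _; lra.
  have xB : ~ B x by move=> /BU.
  have axb : a < x < b.
    rewrite !lt_neqAle ax xb !andbT; apply/andP; split; apply/eqP => xe; apply: xB; right.
      by left.
    by right.
  have [dd fd dL] : exists2 d, is_derive x 1 f d & `|d| <= L.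
    move: axb; apply: contrapT => h; apply: xB; left; apply: fN => /=.
    by move=> h'; apply: h => /h'.
  have [h h0 H] := is_derive_growth fd e_gt0.
  exists h => // y z hy yx xz hz zb [/andP[ay yb] [n [s [s' [H1 H2 H3 H4]]]]].
  have yz : y <= z by exact: le_trans xz.
  split; first by rewrite zb (le_trans ay).
  exists n, s, s'; split => //.
  - by move=> k /H1[? [? ?]]; split => //; split => //; exact: le_trans yz.
  - by apply: le_trans H3 _; exact: m_homo.
  - have Hy : `|f y - f x| <= (L + e) * (x - y).
      have := H y; rewrite distrC ltr_distlC hy/= (le_lt_trans yx) ?ltrDl//.
      move=> /(_ isT) /le_trans; apply; rewrite (ger0_norm (_ : 0 <= x - y)) ?subr_ge0//.
      by rewrite ler_wpM2r ?subr_ge0// lerD2r.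
    have Hz : `|f z - f x| <= (L + e) * (z - x).
      have := H z; rewrite ltr_distl hz andbT (lt_le_trans _ xz) ?gtrBl//.
      move=> /(_ isT) /le_trans; apply; rewrite (ger0_norm (_ : 0 <= z - x)) ?subr_ge0//.
      by rewrite ler_wpM2r ?subr_ge0// lerD2r.
    have := ler_normD (f z - f x) (f x - f y); have := ler_normD (f z - f y) (f y - f a).
    rewrite (_ : f z - f y + (f y - f a) = f z - f a); last by ring.
    rewrite (_ : f z - f x + (f x - f y) = f z - f y); last by ring.
    rewrite (distrC (f x)).
    move: H4 Hy Hz; set S := \sum_(k < n) _.
    by rewrite !mulrBr; lra.
pose T := sup [set t | G t].
have hsG : has_sup [set t | G t].
  by split; [exists a | exists b => t [/andP[]]].
have aT : a <= T by apply: ub_le_sup Ga; case: hsG.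
have Tb : T <= b by apply: ge_sup; [exists a | move=> t [/andP[]]].
have [|h h0 Hh] := local T; first by rewrite aT.
have [y Gy yT] := sup_adherent h0 hsG.
have yT' : y <= T by apply: ub_le_sup Gy; case: hsG.
have GT z : T <= z -> z < T + h -> z <= b -> G z by move=> ? ? ?; apply: (Hh y z).
have Gb : G b.
  have [bT|Tb'] := leP b T; first by apply: GT => //; lra.
  have : G (Order.min b (T + h / 2)).
    apply: GT.
    - by rewrite le_min Tb/=; lra.
    - by rewrite gt_min; apply/orP; right; lra.
    - by rewrite ge_min lexx.
  have [//|bTh] := leP b (T + h / 2) => /(ub_le_sup hsG.2) => h2.
  have : T + h / 2 <= T by exact: h2.
  by lra.
have [_ [n [s [s' [H1 H2 H3 H4]]]]] := Gb.
have : \sum_(k < n) `|f (s' k) - f (s k)| < e.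
  apply: Hd => //; apply: le_lt_trans H3 _; apply: le_lt_trans (m_le _) _.
  by rewrite -lte_fin fineK.
move: H4; set S := \sum_(k < n) _; rewrite mulrDl; lra.
Qed.

End AbsolutelyContinuous.

(** * Closure properties of absolute continuity, and the equation [f' = c f] *)

Section AbsContClosure.
Variable R : realType.
Implicit Types (f g : R -> R) (a b : R).

Lemma ae_mono (P Q : R -> Prop) : (forall x, P x -> Q x) ->
  {ae @lebesgue_measure R, forall x, P x} -> {ae @lebesgue_measure R, forall x, Q x}.
Proof.
by move=> PQ; apply: filterS => //; exact: (ae_filter_ringOfSetsType (@lebesgue_measure R)).
Qed.

Lemma ae_mono2 (P Q T : R -> Prop) : (forall x, P x -> Q x -> T x) ->
  {ae @lebesgue_measure R, forall x, P x} -> {ae @lebesgue_measure R, forall x, Q x} ->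
  {ae @lebesgue_measure R, forall x, T x}.
Proof.
by move=> PQ; apply: filterS2 => //; exact: (ae_filter_ringOfSetsType (@lebesgue_measure R)).
Qed.

Lemma abs_cont_sub f a b a' b' : a <= a' -> b' <= b -> abs_cont_on a b f -> abs_cont_on a' b' f.
Proof.
move=> aa bb acf e e0; have [d d0 H] := acf e e0; exists d => // n s t H1 H2.
apply: H => // k /H1[? [? ?]]; split; first exact: le_trans aa _.
by split=> //; exact: le_trans bb.
Qed.

(** Common source of the closure under sums, differences and products. *)
Lemma abs_cont_split (F : R -> R) a b (c : R) f g :
  0 < c -> abs_cont_on a b f -> abs_cont_on a b g ->
  (forall s t, a <= s -> s <= t -> t <= b -> `|F t - F s| <= c * (`|f t - f s| + `|g t - g s|)) ->
  abs_cont_on a b F.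
Proof.
move=> c0 acf acg H e e0.
have e' : 0 < e / c / 2 by rewrite !divr_gt0.
have [d d0 Hf] := acf _ e'; have [d' d'0 Hg] := acg _ e'.
exists (Order.min d d'); first by rewrite lt_min d0.
move=> n s t H1 H2; rewrite lt_min => /andP[H3 H4].
apply: le_lt_trans (_ : _ <= c * (\sum_(k < n) `|f (t k) - f (s k)| + \sum_(k < n) `|g (t k) - g (s k)|)) _.
  rewrite -big_split mulr_sumr; apply: ler_sum => k _.
  by have [? [? ?]] := H1 k (ltn_ord k); exact: H.
rewrite -ltr_pdivlMl// mulrC [ltRHS]splitr; apply: ltrD; [exact: Hf|exact: Hg].
Qed.

Lemma abs_contD f g a b : abs_cont_on a b f -> abs_cont_on a b g -> abs_cont_on a b (fun x => f x + g x).
Proof.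
move=> acf acg; apply: (abs_cont_split ltr01 acf acg) => s t _ _ _; rewrite mul1r.
rewrite (_ : _ - _ = (f t - f s) + (g t - g s)); last by ring.
exact: ler_normD.
Qed.

Lemma abs_contB f g a b : abs_cont_on a b f -> abs_cont_on a b g -> abs_cont_on a b (fun x => f x - g x).
Proof.
move=> acf acg; apply: (abs_cont_split ltr01 acf acg) => s t _ _ _; rewrite mul1r.
rewrite (_ : f t - g t - _ = (f t - f s) - (g t - g s)); last by ring.
exact: ler_normB.
Qed.

(* Meant for [F] a primitive of a function bounded by [|f|], with [Gm] a primitive
   of [f^2]: the second hypothesis is then AM-GM. *)
Lemma abs_cont_monotone_crit (F Gm : R -> R) a b :
  (forall s t, a <= s -> s <= t -> t <= b -> Gm s <= Gm t) ->
  (forall e, 0 < e -> exists2 C, 0 < C & forall s t, a <= s -> s <= t -> t <= b ->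
     `|F t - F s| <= e * (Gm t - Gm s) + C * (t - s)) ->
  abs_cont_on a b F.
Proof.
move=> mG H e e0.
pose q := `|Gm b - Gm a| + 1.
have q0 : 0 < q by rewrite /q ltr_wpDl.
have [|C C0 HC] := H (e / 2 / q); first by rewrite !divr_gt0.
exists (e / 2 / C); first by rewrite !divr_gt0.
move=> [|n] s t H1 H2 H3; first by rewrite big_ord0.
(* The intervals are ordered and [Gm] is monotone, so the gaps between them can only help the
   telescoping. *)
have tel m : (m <= n)%N -> \sum_(k < m.+1) (Gm (t k) - Gm (s k)) <= Gm (t m) - Gm a.
  elim: m => [_|m IH mn].
    have [s1 [s2 s3]] := H1 0%N isT.
    by rewrite big_ord1 lerB// mG// (le_trans s2).
  have [u1 [u2 u3]] := H1 m (leqW mn); have [s1 [s2 s3]] := H1 m.+1 mn.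
  rewrite big_ord_recr/=; have := IH (ltnW mn).
  have : Gm (t m) <= Gm (s m.+1).
    by apply: mG; [exact: le_trans u2|exact: H2|exact: le_trans s3].
  by set S := \sum_(_ < _) _; lra.
have HG : \sum_(k < n.+1) (Gm (t k) - Gm (s k)) < q.
  apply: le_lt_trans (tel n (leqnn _)) _.
  have [u1 [u2 u3]] := H1 n (leqnn _).
  have := mG _ _ (le_trans u1 u2) u3 (lexx b).
  by have := ler_norm (Gm b - Gm a); rewrite /q; lra.
apply: le_lt_trans (_ : _ <= e / 2 / q * \sum_(k < n.+1) (Gm (t k) - Gm (s k)) + C * \sum_(k < n.+1) (t k - s k)) _.
  rewrite !mulr_sumr -big_split; apply: ler_sum => k _.
  by have [? [? ?]] := H1 k (ltn_ord k); exact: HC.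
rewrite [ltRHS]splitr; apply: ltrD.
  by rewrite -mulrA -[ltRHS]mulr1 ltr_pM2l ?divr_gt0// mulrC ltr_pdivrMr// mul1r.
by rewrite mulrC -ltr_pdivlMr.
Qed.

Lemma abs_cont_lipschitz (F : R -> R) a b C :
  (forall s t, a <= s -> s <= t -> t <= b -> `|F t - F s| <= C * (t - s)) -> abs_cont_on a b F.
Proof.
move=> H; apply: (@abs_cont_monotone_crit _ (fun=> 0)) => // e e0.
exists (`|C| + 1) => [|s t ? ? ?]; first by rewrite ltr_wpDl.
rewrite subrr mulr0 add0r; apply: le_trans (H _ _ _ _ _) _ => //.
rewrite ler_wpM2r ?subr_ge0//; apply: le_trans (ler_norm C) _; by rewrite lerDl.
Qed.

Lemma abs_cont_continuous f a b : abs_cont_on a b f -> {within `[a, b], continuous f}.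
Proof.
move=> acf; apply/subspace_continuousP => x; rewrite /= in_itv/= => /andP[ax xb].
apply/cvgrPdist_lt => e e0; have [d d0 H] := acf e e0.
near=> y.
have yab : `[a, b]%classic y by near: y; exact: withinT.
move: yab; rewrite /= in_itv/= => /andP[ay yb].
have yx : `|x - y| < d by near: y; apply: cvg_within; exact: nbhsx_ballx.
have [xy|/ltW xy] := leP x y.
  have := H 1%N (fun=> x) (fun=> y); rewrite !big_ord1 => Hd; rewrite distrC; apply: Hd => //.
  by apply: le_lt_trans yx; rewrite distrC ler_norm.
have := H 1%N (fun=> y) (fun=> x); rewrite !big_ord1; apply => //.
by apply: le_lt_trans yx; rewrite ler_norm.
Unshelve. all: by end_near. Qed.

Lemma abs_cont_bounded f a b : a <= b -> abs_cont_on a b f ->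
  exists2 M, 0 < M & forall x, a <= x -> x <= b -> `|f x| <= M.
Proof.
move=> ab /abs_cont_continuous cf.
have [c _ hc] := EVT_max ab cf; have [d _ hd] := EVT_min ab cf.
exists (`|f c| + `|f d| + 1) => [|x ax xb]; first by rewrite ltr_wpDl// addr_ge0.
have xab : x \in `[a, b] by rewrite in_itv/= ax.
rewrite ler_norml; have := hc x xab; have := hd x xab.
have := ler_norm (f c); have := ler_norm (- f d); rewrite normrN.
have := normr_ge0 (f c); have := normr_ge0 (f d).
set u := `|f c|; set v := `|f d|; move: (f c) (f d) (f x) => F G H; lra.
Qed.

Lemma abs_contM f g a b : a <= b -> abs_cont_on a b f -> abs_cont_on a b g ->
  abs_cont_on a b (fun x => f x * g x).
Proof.
move=> ab acf acg.
have [M M0 HM] := abs_cont_bounded ab acf; have [N N0 HN] := abs_cont_bounded ab acg.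
apply: (@abs_cont_split _ _ _ (M + N) f g) => //; first by rewrite addr_gt0.
move=> s t as_ st tb; have sb := le_trans st tb; have a_t := le_trans as_ st.
rewrite (_ : _ - _ = (f t - f s) * g t + f s * (g t - g s)); last by ring.
apply: le_trans (ler_normD _ _) _; rewrite !normrM mulrDr; apply: lerD.
  rewrite mulrC ler_wpM2r//; apply: le_trans (HN _ _ _) _ => //; rewrite lerDr; exact: ltW.
rewrite ler_wpM2r//; apply: le_trans (HM _ _ _) _ => //; rewrite lerDl; exact: ltW.
Qed.

Lemma abs_contZ f a b c : a <= b -> abs_cont_on a b f -> abs_cont_on a b (fun x => c * f x).
Proof.
move=> ab acf; apply: abs_contM => //; apply: (@abs_cont_lipschitz _ _ _ 0) => s t _ _ _.
by rewrite subrr normr0 mul0r.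
Qed.

Lemma expR_lipschitz (x y M : R) : x <= M -> y <= M -> `|expR x - expR y| <= expR M * `|x - y|.
Proof.
wlog xy : x y / y <= x.
  by move=> H xM yM; have [/H|/ltW/H] := leP y x; [exact|rewrite distrC (distrC y); exact].
move=> xM yM; rewrite !ger0_norm ?subr_ge0 ?ler_expR//.
apply: le_trans (_ : expR x * (x - y) <= _); last by rewrite ler_wpM2r ?subr_ge0 ?ler_expR.
have := expR_ge1Dx (y - x); rewrite expRD expRN.
have := expR_gt0 x; set X := expR x; set Y := expR y => X0 H.
have : X * (1 + (y - x)) <= Y by rewrite -ler_pdivlMl// mulrC.
by lra.
Qed.

Lemma abs_cont_expR c a b : abs_cont_on a b (fun x => expR (c * x)).
Proof.
pose M := `|c| * (`|a| + `|b|).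
have HM x : a <= x -> x <= b -> c * x <= M.
  move=> ax xb; apply: le_trans (ler_norm _) _; rewrite normrM ler_wpM2l//.
  rewrite ler_norml; have := ler_norm b; have := ler_norm (- a); rewrite normrN.
  have := normr_ge0 a; have := normr_ge0 b; set u := `|a|; set v := `|b|; lra.
apply: (@abs_cont_lipschitz _ _ _ (expR M * `|c|)) => s t as_ st tb.
apply: le_trans (expR_lipschitz (HM t _ _) (HM s _ _)) _ => //.
- exact: le_trans st.
- exact: le_trans tb.
- by rewrite -mulrBr normrM mulrA (ger0_norm (_ : 0 <= t - s)) ?subr_ge0.
Qed.

Lemma is_derive_expRM c (x : R) : is_derive x 1 (fun y => expR (c * y)) (c * expR (c * x)).
Proof.
have h : is_derive x (1 : R) (fun y : R => c * y) c.
  by apply: is_derive_eq; rewrite ?mulr0 ?scaler0 ?addr0 ?mulr1 //; rewrite [_ *: _]mulr1 // scale0r addr0.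
have := @is_derive1_comp R expR (fun y : R => c * y) x (expR (c * x)) c _ h.
by rewrite [c * expR _]mulrC => H; exact: (H (is_derive_expR _)).
Qed.

(** With the integrating factor [expR (- c * y)] the derivative vanishes almost everywhere, which
    for an absolutely continuous function implies constancy. *)
Lemma abs_cont_exp_ode f a b c : abs_cont_on a b f ->
  {ae @lebesgue_measure R, forall x, a < x < b -> is_derive x 1 f (c * f x)} ->
  forall x, a <= x -> x <= b -> f x = f a * expR (c * (x - a)).
Proof.
move=> acf aef x; rewrite le_eqVlt => /orP[/eqP<- _|ax xb].
  by rewrite subrr mulr0 expR0 mulr1.
pose h y := f y * expR (- c * y).
have ach : abs_cont_on a x h.
  apply: abs_contM; [exact: ltW|exact: abs_cont_sub acf|exact: abs_cont_expR].
have := abs_cont_derive_bound ax (lexx 0) ach.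
rewrite mul0r normr_le0 subr_eq0 => hh.
have {hh}/eqP : h x == h a.
  apply: hh; apply: ae_mono aef => y Hy /andP[ay yx]; exists 0; last by rewrite normr0.
  have dy := Hy ltac:(by rewrite ay (lt_le_trans yx)).
  have := is_deriveM dy (is_derive_expRM (- c) y).
  by congr is_derive; rewrite /GRing.scale/=; ring.
rewrite /h mulrBr expRB !mulNr !expRN => /(canRL (mulfVK (lt0r_neq0 (expR_gt0 _)))).
by rewrite mulrA => ->; rewrite mulrAC.
Qed.
End AbsContClosure.

(** * The resolvent on the line *)

Section ExpKernel.
Variable R : realType.
Notation mu := (@lebesgue_measure R).

Lemma integral_exp_half (c a : R) : 0 < c ->
  (\int[mu]_(y in `[a, +oo[) (expR (- c * (y - a)))%:E = (c^-1)%:E)%E.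
Proof.
move=> c0.
pose F (y : R) : R := - c^-1 * expR (c * a) * expR (- c * y).
have cE x : {for x, continuous (fun y : R => expR (- c * (y - a)))}.
  apply: continuous_comp; last exact: continuous_expR.
  by apply: cvgM; [exact: cvg_cst|apply: cvgB; [exact: cvg_id|exact: cvg_cst]].
have dF x : is_derive x (1 : R) F (expR (- c * (x - a))).
  have := is_deriveZ (- c^-1 * expR (c * a)) (is_derive_expRM (- c) x).
  rewrite /F; congr is_derive; rewrite /GRing.scale/= mulrACA mulrNN mulVf ?gt_eqF// mul1r.
  by rewrite -expRD; congr expR; ring.
rewrite (@ge0_continuous_FTC2y _ _ F a 0).
- rewrite sub0e /F -EFinN -!mulNr opprK -mulrA -expRD mulNr addrN expR0 mulr1//.
- by move=> x _; exact: expR_ge0.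
- by apply: continuous_subspaceT => x; exact: cE.
- rewrite -[X in _ --> X](mulr0 (- c^-1 * expR (c * a))); apply: cvgM; first exact: cvg_cst.
  have h : (fun y : R => c * y) y @[y --> +oo] --> +oo by exact: gt0_cvgMry.
  have := cvg_comp _ _ h (@cvgr_expR R).
  by apply: cvg_trans; apply: near_eq_cvg; near=> y => /=; rewrite mulNr.
- by move=> x _; exact: ex_derive.
- apply: cvg_at_right_filter; apply: differentiable_continuous; apply/derivable1_diffP; exact: ex_derive.
- by move=> x _; rewrite derive1E; exact: derive_val.
Unshelve. all: by end_near. Qed.

Lemma continuous_exp_abs (c x : R) : continuous (fun y : R => expR (- c * `|x - y|)).
Proof.
move=> y; apply: continuous_comp; last exact: continuous_expR.
apply: cvgM; first exact: cvg_cst.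
by apply: cvg_norm; apply: cvgB; [exact: cvg_cst|exact: cvg_id].
Qed.

Lemma integral_exp_abs (c x : R) : 0 < c ->
  (\int[mu]_y (expR (- c * `|x - y|))%:E <= (2 / c)%:E)%E.
Proof.
move=> c0.
have mE A : measurable_fun A (fun y : R => (expR (- c * `|x - y|))%:E).
  apply/measurable_EFinP/measurable_funTS.
  apply: measurable_realfun.continuous_measurable_fun; exact: continuous_exp_abs.
have e0 (y : R) : (0 <= (expR (- c * `|x - y|))%:E)%E by rewrite lee_fin expR_ge0.
apply: le_trans (_ : _ <= \int[mu]_(y in `]-oo, x] `|` `[x, +oo[) (expR (- c * `|x - y|))%:E)%E _.
  apply: ge0_subset_integral => //; [exact: measurableU|exact: mE|].
  move=> y _ /=; rewrite !in_itv/= andbT; have [yx|/ltW xy] := leP y x; [by left|by right].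
have -> : (2 / c)%:E = ((c^-1)%:E + (c^-1)%:E)%E by rewrite -EFinD mulr2n mulrDl mul1r.
apply: le_trans (_ : _ <= \int[mu]_(y in `]-oo, x]) (expR (- c * `|x - y|))%:E + \int[mu]_(y in `[x, +oo[) (expR (- c * `|x - y|))%:E)%E _.
  have -> : `]-oo, x] `|` `[x, +oo[ = `]-oo, x]%classic `|` `]x, +oo[%classic.
    apply/seteqP; split => y /=; rewrite !in_itv/= ?andbT.
      by case=> h; [left|case: (leP y x) => h'; [left|right]].
    by case=> h; [left|right; exact: ltW].
  rewrite ge0_integral_setU//=; try exact: mE; last first.
    by apply/disj_setPRL => y /=; rewrite !in_itv/= andbT leNgt => ->.
  rewrite leeD2l//; apply: ge0_subset_integral => //; first exact: mE.
  by move=> y /=; rewrite !in_itv/= !andbT => /ltW.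
rewrite leeD//.
  rewrite -{1}(opprK x) ge0_integration_by_substitutionNy//.
  - rewrite -(integral_exp_half (- x) c0) le_eqVlt; apply/orP; left; apply/eqP.
    apply: eq_integral => y; rewrite inE/= in_itv/= andbT => xy.
    by rewrite !opprK (addrC y) ger0_norm//; lra.
  - apply: continuous_subspaceT; exact: continuous_exp_abs.
rewrite -(integral_exp_half x c0) le_eqVlt; apply/orP; left; apply/eqP.
apply: eq_integral => y; rewrite inE/= in_itv/= andbT => xy.
by rewrite distrC ger0_norm// subr_ge0.
Qed.

Variables (k : R) (f : R -> R).
Hypothesis k0 : 0 < k.
Hypothesis mf : measurable_fun setT f.
Hypothesis f2 : (\int[mu]_y ((f y) ^+ 2)%:E < +oo)%E.

Lemma measurable_exp_abs A (c x : R) : measurable_fun A (fun y : R => expR (- c * `|x - y|)).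
Proof.
apply: measurable_funTS; apply: measurable_realfun.continuous_measurable_fun; exact: continuous_exp_abs.
Qed.

Lemma integrable_exp_abs (c x : R) : 0 < c ->
  mu.-integrable setT (EFin \o (fun y : R => expR (- c * `|x - y|))).
Proof.
move=> c0; apply/integrableP; split; first by apply/measurable_EFinP; exact: measurable_exp_abs.
apply: le_lt_trans (ltry (2 / c)); apply: le_trans (integral_exp_abs x c0).
rewrite le_eqVlt; apply/orP; left; apply/eqP; apply: eq_integral => y _.
by rewrite /= ger0_norm// expR_ge0.
Qed.

Lemma integrable_sqr : mu.-integrable setT (EFin \o (fun y => f y ^+ 2)).
Proof.
apply/integrableP; split; first by apply/measurable_EFinP; exact: measurable_funX.
apply: le_lt_trans f2; rewrite le_eqVlt; apply/orP; left; apply/eqP; apply: eq_integral => y _.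
by rewrite /= ger0_norm// sqr_ge0.
Qed.

Lemma integrable_exp_sqr x : mu.-integrable setT (EFin \o (fun y => expR (- k * `|x - y|) * f y ^+ 2)).
Proof.
apply: le_integrable integrable_sqr => //=.
  by apply/measurable_EFinP/measurable_funM; [exact: measurable_exp_abs|exact: measurable_funX].
move=> y _; rewrite lee_fin normrM ler_piMl// ger0_norm ?expR_ge0// expR_le1.
by rewrite mulNr oppr_le0 mulr_ge0// ltW.
Qed.

(** Square integrability suffices because [|f| <= 1 + f ^+ 2] and the weight is itself
    integrable. *)
Lemma integrable_expM x : mu.-integrable setT (EFin \o (fun y => expR (- k * `|x - y|) * f y)).
Proof.
have h := integrableD measurableT (integrable_exp_abs x k0) (integrable_exp_sqr x).
apply: le_integrable h => //=.
  by apply/measurable_EFinP/measurable_funM; [exact: measurable_exp_abs|].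
move=> y _; rewrite lee_fin.
have e0 := expR_ge0 (- k * `|x - y|); set e := expR _ in e0 *.
rewrite -[X in _ <= `|X + _|]mulr1 -mulrDr !normrM ler_wpM2l//.
rewrite [leRHS]ger0_norm ?addr_ge0 ?sqr_ge0// -real_normK ?num_real//.
by have := normr_ge0 (f y); set v := `|f y|; nra.
Qed.


Definition exp_conv (x : R) : R := \int[mu]_y (expR (- k * `|x - y|) * f y).

(** Cauchy-Schwarz for the exponential weight, whose mass is at most [2 / k]. It is derived from a
    family of quadratic inequalities in a parameter [l]. *)
Lemma exp_conv_sqr_le x :
  exp_conv x ^+ 2 <= 2 / k * \int[mu]_y (expR (- k * `|x - y|) * f y ^+ 2).
Proof.
pose J := \int[mu]_y `|expR (- k * `|x - y|) * f y|.
pose Q := \int[mu]_y (expR (- k * `|x - y|) * f y ^+ 2).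
pose E := \int[mu]_y expR (- k * `|x - y|).
have hJ : `|exp_conv x| <= J by apply: le_normr_Rintegral => //; exact: integrable_expM.
have J0 : 0 <= J by exact: le_trans hJ.
have hE : E <= 2 / k.
  rewrite -lee_fin fineK; first exact: integral_exp_abs.
  by apply: integrable_fin_num => //; exact: integrable_exp_abs.
have main (l : R) : 2 * l * J <= l ^+ 2 * E + Q.
  have i1 := integrable_exp_abs x k0; have i2 := integrable_exp_sqr x.
  have i3 := integrable_norm (integrable_expM x).
  rewrite -RintegralZl// -RintegralZl// -RintegralD//; last exact: (integrableZl measurableT (l ^+ 2) i1).
  apply: le_Rintegral => //.
  - exact: (integrableZl measurableT (2 * l) i3).
  - exact: (integrableD measurableT (integrableZl measurableT (l ^+ 2) i1) i2).
  - move=> y _; rewrite normrM ger0_norm ?expR_ge0//.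
    have := expR_ge0 (- k * `|x - y|); set e := expR _ => e0.
    rewrite -(real_normK (num_real (f y))); set v := `|f y|.
    have := sqr_ge0 (l - v); rewrite sqrrB => h.
    have := mulr_ge0 e0 h; rewrite !mulrDr mulrN mulrnAr !mulr2n; lra.
rewrite -(real_normK (num_real _)).
apply: le_trans (_ : J ^+ 2 <= _); first by rewrite ler_sqr ?nnegrE.
(* This [l] is the optimal one once [E] is replaced by its bound [2 / k]. *)
rewrite -/Q; have := main (k / 2 * J).
have : (k / 2 * J) ^+ 2 * E <= (k / 2 * J) ^+ 2 * (2 / k) by rewrite ler_wpM2l ?sqr_ge0.
rewrite (_ : (k / 2 * J) ^+ 2 * (2 / k) = k / 2 * J ^+ 2); last by field; rewrite gt_eqF.
rewrite (_ : 2 * (k / 2 * J) * J = k * J ^+ 2); last by field.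
move=> h1 h2; rewrite mulrAC ler_pdivlMr//; lra.
Qed.

(** Tonelli applied to the weighted bound: integrating the weight in the other variable costs a
    second factor [2 / k]. *)
Lemma exp_conv_L2 A : measurable A -> measurable_fun A exp_conv ->
  (\int[mu]_(x in A) (exp_conv x ^+ 2)%:E < +oo)%E.
Proof.
move=> mA mc.
pose h (p : R * R) := (expR (- k * `|p.1 - p.2|) * f p.2 ^+ 2)%:E.
have h0 p : (0 <= h p)%E by rewrite lee_fin mulr_ge0 ?expR_ge0 ?sqr_ge0.
have mh : measurable_fun setT h.
  apply/measurable_EFinP/measurable_funM.
    apply: (measurableT_comp (f := @expR R)) => //.
    apply: measurable_funM => //; apply: (measurableT_comp (f := @Num.norm R R)) => //.
    by apply: measurable_funB; [exact: measurable_fst|exact: measurable_snd].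
  by apply: measurable_funX; apply: measurableT_comp => //; exact: measurable_snd.
have mF : measurable_fun setT (fun x : R => (\int[mu]_y h (x, y))%E).
  have := @measurable_fun_fubini_tonelli_F _ _ _ _ _ mu h mh h0; exact.
have mG : measurable_fun setT (fun y : R => (\int[mu]_x h (x, y))%E).
  have := @measurable_fun_fubini_tonelli_G _ _ _ _ _ mu h mh h0; exact.
apply: le_lt_trans (_ : (_ <= \int[mu]_(x in A) ((2 / k)%:E * \int[mu]_y h (x, y)))%E) _.
  apply: ge0_le_integral => //.
  - by move=> x _; rewrite lee_fin sqr_ge0.
  - by apply/measurable_EFinP; exact: measurable_funX.
  - apply: measurable_funeM; apply: measurable_funTS.
    exact: mF.
  - move=> x _; apply: le_trans (_ : ((2 / k * \int[mu]_y (expR (- k * `|x - y|) * f y ^+ 2))%:E <= _)%E).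
      by rewrite lee_fin exp_conv_sqr_le.
    rewrite EFinM lee_pmul2l ?lte_fin ?divr_gt0// fineK//.
    by apply: integrable_fin_num => //; exact: integrable_exp_sqr.
rewrite ge0_integralZl//; last 3 first.
- by apply: measurable_funTS; exact: mF.
- by move=> x _; apply: integral_ge0.
- by rewrite lee_fin divr_ge0// ltW.
apply: lte_mul_pinfty => //; first by rewrite lee_fin divr_ge0// ltW.
apply: le_lt_trans (_ : (_ <= \int[mu]_x \int[mu]_y h (x, y))%E) _.
  by apply: ge0_subset_integral => // x _; apply: integral_ge0.
have := @fubini_tonelli _ _ _ _ R mu mu h mh h0 => ->.
apply: le_lt_trans (_ : (_ <= \int[mu]_y ((2 / k)%:E * (f y ^+ 2)%:E))%E) _.
  apply: ge0_le_integral => //.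
  - by move=> x _; apply: integral_ge0.
  - by apply: measurable_funeM; apply/measurable_EFinP; exact: measurable_funX.
  - move=> y _; rewrite /h/=; under eq_integral do rewrite EFinM distrC.
    rewrite ge0_integralZr//; last 2 first.
    + by apply/measurable_EFinP; exact: measurable_exp_abs.
    + by rewrite lee_fin sqr_ge0.
    by rewrite lee_wpmul2r ?lee_fin ?sqr_ge0//; exact: integral_exp_abs.
rewrite ge0_integralZl//.
- by apply: lte_mul_pinfty => //; rewrite lee_fin divr_ge0// ltW.
- by apply/measurable_EFinP; exact: measurable_funX.
- by move=> x _; rewrite lee_fin sqr_ge0.
- by rewrite lee_fin divr_ge0// ltW.
Qed.

End ExpKernel.

(** * Regularity and endpoint values of the resolvent on the line *)

Section LineODE.
Variable R : realType.
Notation mu := (@lebesgue_measure R).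

Lemma is_derive_of_growth (f : R -> R) (x d : R) :
  (forall e, 0 < e -> exists2 h : R, 0 < h &
     forall y, `|y - x| < h -> `|f y - f x - d * (y - x)| <= e * `|y - x|) ->
  is_derive x 1 f d.
Proof.
move=> H.
suff cv : h^-1 *: (f (h *: (1 : R) + x) - f x) @[h --> 0^'] --> d.
  split; first by apply/cvg_ex; exists d; exact: cv.
  by apply/cvg_lim; [exact: Rhausdorff|exact: cv].
apply/cvgrPdist_le => e e0; have [h h0 Hh] := H _ e0.
exists h => //= t /=; rewrite sub0r normrN => th t0; rewrite [_%:A]mulr1.
have := Hh (t + x); rewrite addrK => /(_ th).
rewrite -ler_pdivrMr ?normr_gt0// -normfV -normrM; apply: le_trans.
rewrite distrC mulrBl (mulrC (d * t)) (mulrC d) mulrA mulVf// mul1r.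
by rewrite (_ : t^-1 *: (f (t + x) - f x) = (f (t + x) - f x) * t^-1)// mulrC.
Qed.

(** By continuity of [u1], the function [u t - u1 x * t] has a derivative of size at most [e] almost
    everywhere near [x], and the mean value bound for absolutely continuous functions applies. The
    lemma is needed because [in_D] asks for the first derivative at every interior point, while
    primitives provide it almost everywhere. *)
Lemma abs_cont_derive_everywhere (u u1 : R -> R) (a b : R) :
  abs_cont_on a b u -> abs_cont_on a b u1 ->
  {ae mu, forall x, a < x < b -> is_derive x 1 u (u1 x)} ->
  forall x, a < x < b -> is_derive x 1 u (u1 x).
Proof.
move=> acu acu1 du x /andP[ax xb]; apply: is_derive_of_growth => e e0.
have [d d0 Hd] := acu1 _ e0.
exists (Order.min d (Order.min (x - a) (b - x))).
  by rewrite !lt_min d0 !subr_gt0 ax.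
have main y z : a < y -> y < z -> z < b -> z - y < d -> y <= x -> x <= z ->
    `|u z - u y - u1 x * (z - y)| <= e * (z - y).
  move=> ay yz zb zyd yx xz.
  have acv : abs_cont_on y z (fun t => u t - u1 x * t).
    apply: abs_contB; first exact: abs_cont_sub (ltW ay) (ltW zb) acu.
    apply: (abs_cont_lipschitz (C := `|u1 x|)) => s t _ st _.
    by rewrite -mulrBr normrM (ger0_norm (_ : 0 <= t - s)) ?subr_ge0.
  have := abs_cont_derive_bound yz (ltW e0) acv.
  rewrite (_ : u z - u1 x * z - _ = u z - u y - u1 x * (z - y)); last by ring.
  apply; apply: ae_mono du => t Ht /andP[yt tz].
  have {}Ht := Ht ltac:(by rewrite (lt_trans ay yt) (lt_trans tz zb)).
  exists (u1 t - u1 x).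
    have := is_deriveB Ht (is_deriveZ (u1 x) (is_derive_id t (1 : R))).
    by congr is_derive; rewrite [_ *: 1]mulr1.
  have [xt|/ltW tx] := leP x t.
    have := Hd 1%N (fun=> x) (fun=> t); rewrite !big_ord1 => H; apply/ltW/H => //.
      by move=> _ _; rewrite (ltW ax) xt (ltW (lt_trans tz zb)).
    by apply: le_lt_trans zyd; lra.
  have := Hd 1%N (fun=> t) (fun=> x); rewrite !big_ord1 distrC => H; apply/ltW/H => //.
    by move=> _ _; rewrite (ltW (lt_trans ay yt)) tx (ltW xb).
  by apply: le_lt_trans zyd; lra.
move=> y; rewrite !lt_min => /andP[yd /andP[yxa ybx]].
have [->|/eqP yx] := eqVneq y x.
  by rewrite !subrr mulr0 subrr normr0 mulr0.
have [xy|yx'] := leP x y.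
  have xy' : x < y by rewrite lt_neqAle xy andbT; apply/eqP => h; apply: yx.
  rewrite (ger0_norm (_ : 0 <= y - x)) ?subr_ge0//.
  rewrite ger0_norm ?subr_ge0// in yd yxa ybx.
  by apply: main => //; lra.
rewrite distrC in yd yxa ybx; rewrite (distrC y).
rewrite ger0_norm ?subr_ge0 ?(ltW yx')// in yd yxa ybx.
rewrite (ger0_norm (_ : 0 <= x - y)) ?subr_ge0 ?(ltW yx')//.
rewrite (_ : u y - u x - u1 x * (y - x) = - (u x - u y - u1 x * (x - y))); last by ring.
by rewrite normrN; apply: main => //; lra.
Qed.

Lemma abs_cont_measurable (f : R -> R) (b : R) :
  abs_cont_on 0 b f -> measurable_fun (`[0, b]%classic : set R) f.
Proof.
move=> /abs_cont_continuous cf.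
exact: measurable_realfun.subspace_continuous_measurable_fun.
Qed.

Lemma abs_cont_measurable_ray (f : R -> R) :
  (forall b, 0 <= b -> abs_cont_on 0 b f) -> measurable_fun (`[0, +oo[%classic : set R) f.
Proof.
move=> acf.
have -> : `[0, +oo[%classic = \bigcup_n (`[0, n%:R]%classic : set R).
  apply/seteqP; split => x /=; last by move=> [n _] /=; rewrite !in_itv/= andbT => /andP[].
  rewrite in_itv/= andbT => x0; exists (Num.truncn x).+1 => //=.
  by rewrite in_itv/= x0/= ltW// truncnS_gt.
apply/measurable_fun_bigcup => // n; apply: abs_cont_measurable; exact: acf.
Qed.

Lemma lebesgue_measure_oc (s t : R) : s <= t -> mu `]s, t]%classic = (t - s)%:E.
Proof.
move=> st; rewrite lebesgue_measure_itv/= lte_fin; case: ltP => // ts.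
by apply/esym/eqP; rewrite eqe subr_eq0 eq_le ts st.
Qed.

Section Primitive.
Variable g : R -> R.
Hypothesis mg : measurable_fun setT g.
Hypothesis ig : forall b : R, mu.-integrable `]-oo, b] (EFin \o g).
Let Pg (x : R) : R := \int[mu]_(y in `]-oo, x]) g y.

Lemma ae_derive_primitive : {ae mu, forall x : R, is_derive x (1 : R) Pg (g x)}.
Proof.
have lg : locally_integrable setT g.
  split=> //; first exact: openT.
  move=> K _ cK; have [M [_ /(_ (M + 1)) HM]] := compact_bounded cK.
  have KM : K `<=` `]-oo, M + 1].
    move=> y Ky; rewrite /= in_itv/=; apply: le_trans (ler_norm _) _; apply: HM => //.
    by rewrite ltrDl.
  have /integrableP[_] := ig (M + 1); apply: le_lt_trans.
  apply: ge0_subset_integral => //; first exact: measurable_realfun.compact_measurable.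
  by apply/measurable_EFinP; apply: measurableT_comp => //; exact: measurable_funTS.
apply: ae_mono (FTC1Ny ig lg) => x [dx <-]; rewrite derive1E.
exact: DeriveDef.
Qed.

Lemma abs_cont_primitive (f : R -> R) (b M : R) : 0 < M ->
  mu.-integrable setT (EFin \o (fun y => f y ^+ 2)) ->
  (forall y, 0 <= y -> y <= b -> `|g y| <= M * `|f y|) ->
  abs_cont_on 0 b Pg.
Proof.
move=> M0 if2 gf.
pose Gm x : R := \int[mu]_(y in `]-oo, x]) (f y ^+ 2).
have inc (h : R -> R) s t : mu.-integrable `]-oo, t] (EFin \o h) -> s <= t ->
    \int[mu]_(y in `]-oo, t]) h y - \int[mu]_(y in `]-oo, s]) h y = \int[mu]_(y in `]s, t]) h y.
  by move=> ih st; rewrite Rintegral_itvB.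
have if2' A : measurable A -> mu.-integrable A (EFin \o (fun y => f y ^+ 2)).
  by move=> mA; apply: integrableS if2.
apply: (abs_cont_monotone_crit (Gm := Gm)).
  move=> s t _ st _; rewrite -subr_ge0 inc//; last exact: if2'.
  by apply: Rintegral_ge0 => y _; exact: sqr_ge0.
move=> e e0; exists (M ^+ 2 / e); first by rewrite divr_gt0// exprn_gt0.
move=> s t s0 st tb; rewrite /Pg /Gm !inc//; last exact: if2'.
have ist : mu.-integrable `]s, t] (EFin \o g).
  by apply: integrableS (ig t) => // y /=; rewrite !in_itv/= => /andP[].
have icst : mu.-integrable `]s, t] (EFin \o (fun=> M ^+ 2 / e)).
  apply: measurable_bounded_integrable => //.
    by rewrite [X in (X < _)%E]lebesgue_measure_oc// ltry.
  by exists (M ^+ 2 / e); split => [|r rr y _ /=]; rewrite ?num_real// ger0_norm ?(ltW rr)// divr_ge0// ?sqr_ge0// ltW.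
apply: le_trans (le_normr_Rintegral _ ist) _ => //.
apply: le_trans (_ : \int[mu]_(y in `]s, t]) (e * f y ^+ 2 + M ^+ 2 / e) <= _).
  apply: le_Rintegral => //.
  - exact: integrable_norm ist.
  - exact: (integrableD _ (integrableZl _ e (if2' _ _)) icst).
  - move=> y /=; rewrite in_itv/= => /andP[sy yt].
    apply: le_trans (gf _ _ _) _; [lra|lra|].
    rewrite -(real_normK (num_real (f y))); set v := `|f y|.
    have : 0 <= (e * v - M) ^+ 2 / e by rewrite divr_ge0 ?sqr_ge0// ltW.
    rewrite (_ : (e * v - M) ^+ 2 / e = e * v ^+ 2 - 2 * (M * v) + M ^+ 2 / e); last first.
      by field; rewrite gt_eqF.
    have : 0 <= M * v by apply: mulr_ge0; [exact: ltW|exact: normr_ge0].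
    by lra.
rewrite RintegralD//; last exact: (integrableZl _ e (if2' _ _)).
rewrite [X in X + _ <= _]RintegralZl//; try exact: if2'.
by rewrite lerD2l Rintegral_cst// [X in fine X]lebesgue_measure_oc.
Qed.

End Primitive.

Lemma Rintegral_zero (D : set R) (g : R -> R) : (forall y, D y -> g y = 0) ->
  \int[mu]_(y in D) g y = 0.
Proof. by move=> g0; rewrite /Rintegral integral0_eq// => y Dy; rewrite g0. Qed.

Section Resolvent.
Variables (k : R) (f : R -> R).
Hypothesis k0 : 0 < k.
Hypothesis mf : measurable_fun setT f.
Hypothesis f2 : (\int[mu]_y ((f y) ^+ 2)%:E < +oo)%E.
(** The data of an edge are extended by zero. Vanishing on the negative half line makes [gm]
    integrable although [expR (- k * y)] is unbounded there. *)
Hypothesis f_neg : forall y, y < 0 -> f y = 0.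

Let gp (y : R) : R := expR (k * y) * f y.
Let gm (y : R) : R := expR (- k * y) * f y.
Let F (x : R) : R := \int[mu]_(y in `]-oo, x]) gp y.
Let G (x : R) : R := \int[mu]_(y in `]-oo, x]) gm y.
Let Ginf : R := \int[mu]_y gm y.

Let mexp c : measurable_fun setT (fun y : R => expR (c * y)).
Proof.
apply: measurable_realfun.continuous_measurable_fun => y.
apply: continuous_comp; last exact: continuous_expR.
by apply: cvgM; [exact: cvg_cst|exact: cvg_id].
Qed.

Let mgp : measurable_fun setT gp.
Proof. by apply: measurable_funM => //; exact: mexp. Qed.

Let mgm : measurable_fun setT gm.
Proof. by apply: measurable_funM => //; exact: mexp. Qed.

Let igm : mu.-integrable setT (EFin \o gm).
Proof.
apply: eq_integrable (integrable_expM k0 mf f2 0) => // y _ /=; rewrite /gm sub0r normrN.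
have [y0|y0] := ltP y 0; first by rewrite f_neg// !mulr0.
by rewrite ger0_norm.
Qed.

Let igp b : mu.-integrable `]-oo, b] (EFin \o gp).
Proof.
have h : mu.-integrable `]-oo, b] (EFin \o (fun y : R => expR (- k * `|b - y|) * f y)).
  by apply: integrableS (integrable_expM k0 mf f2 b).
have {h} : mu.-integrable `]-oo, b]
    (fun y : R => (expR (k * b))%:E * (expR (- k * `|b - y|) * f y)%:E)%E.
  exact: integrableZl.
apply: eq_integrable => // y.
rewrite inE/= in_itv/= => yb; rewrite /gp -EFinM mulrA -expRD; congr (expR _ * _)%:E.
by rewrite ger0_norm ?subr_ge0//; ring.
Qed.

Let igmS A : measurable A -> mu.-integrable A (EFin \o gm).
Proof. by move=> mA; apply: integrableS igm. Qed.

Let igm' b : mu.-integrable `]-oo, b] (EFin \o gm).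
Proof. by apply: integrableS igm. Qed.

Let Gtail x : \int[mu]_(y in `]x, +oo[) gm y = Ginf - G x.
Proof.
rewrite /Ginf -(itv_setU_setT false x) Rintegral_setU//.
- by rewrite addrC addKr.
- by apply: igmS; exact: measurableU.
- by apply/disj_setPRL => y /=; rewrite !in_itv/= andbT leNgt => ->.
Qed.

(** Splitting the integral at [x] separates the variables of the kernel and reduces the regularity
    of the convolution to that of two primitives. *)
Lemma exp_convE x : exp_conv k f x = expR (- k * x) * F x + expR (k * x) * (Ginf - G x).
Proof.
rewrite /exp_conv -(itv_setU_setT false x) Rintegral_setU//; last 2 first.
- by apply: integrableS (integrable_expM k0 mf f2 x) => //; exact: measurableU.
- by apply/disj_setPRL => y /=; rewrite !in_itv/= andbT leNgt => ->.
rewrite -Gtail /F -!RintegralZl//; try exact: igmS.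
congr (_ + _); apply: eq_Rintegral => y; rewrite inE/= in_itv/= ?andbT => xy.
  rewrite /gp mulrA -expRD; congr (expR _ * _).
  by rewrite ger0_norm ?subr_ge0//; ring.
rewrite /gm mulrA -expRD; congr (expR _ * _).
by rewrite distrC ger0_norm ?subr_ge0 ?(ltW xy)//; ring.
Qed.

Definition line_res (x : R) : R := (2 * k)^-1 * exp_conv k f x.
(** In the derivative of [line_res] the contributions of [F'] and [G'] are opposite and cancel, so
    that only absolutely continuous functions remain. *)
Definition line_res1 (x : R) : R := (expR (k * x) * (Ginf - G x) - expR (- k * x) * F x) / 2.

Let abs_contF b : abs_cont_on 0 b F.
Proof.
apply: (abs_cont_primitive igp (expR_gt0 (k * b)) (integrable_sqr mf f2)) => y y0 yb.
rewrite normrM (ger0_norm (expR_ge0 _)) ler_wpM2r// ler_expR ler_wpM2l//; exact: ltW.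
Qed.

Let abs_contG b : abs_cont_on 0 b G.
Proof.
apply: (abs_cont_primitive igm' ltr01 (integrable_sqr mf f2)) => y y0 yb.
rewrite normrM (ger0_norm (expR_ge0 _)) ler_wpM2r// expR_le1.
by rewrite mulNr oppr_le0 mulr_ge0// ltW.
Qed.

Let abs_contGc b : 0 <= b -> abs_cont_on 0 b (fun x => Ginf - G x).
Proof.
move=> b0; apply: abs_contB => //.
by apply: (abs_cont_lipschitz (C := 0)) => s t _ _ _; rewrite subrr normr0 mul0r.
Qed.

Let abs_cont_parts b : 0 <= b -> abs_cont_on 0 b (fun x => expR (- k * x) * F x) /\
  abs_cont_on 0 b (fun x => expR (k * x) * (Ginf - G x)).
Proof.
move=> b0; split; apply: abs_contM => //; try exact: abs_cont_expR.
exact: abs_contGc.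
Qed.

Lemma abs_cont_line_res b : 0 <= b -> abs_cont_on 0 b line_res.
Proof.
move=> b0; have [h1 h2] := abs_cont_parts b0; apply: abs_contZ => //.
rewrite (_ : exp_conv k f = fun x => expR (- k * x) * F x + expR (k * x) * (Ginf - G x)).
  exact: abs_contD.
by apply/funext => x; exact: exp_convE.
Qed.

Lemma abs_cont_line_res1 b : 0 <= b -> abs_cont_on 0 b line_res1.
Proof.
move=> b0; have [h1 h2] := abs_cont_parts b0.
rewrite (_ : line_res1 = fun x => 2^-1 * (expR (k * x) * (Ginf - G x) - expR (- k * x) * F x)).
  by apply: abs_contZ => //; exact: abs_contB.
by apply/funext => x; rewrite mulrC.
Qed.

Let ae_dFG : {ae mu, forall x : R, is_derive x (1 : R) F (gp x) /\ is_derive x (1 : R) G (gm x)}.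
Proof.
apply: ae_mono2 (ae_derive_primitive mgp igp) (ae_derive_primitive mgm igm') => x ? ?.
by split.
Qed.

Let ae_dparts : {ae mu, forall x : R,
  is_derive x (1 : R) (fun x => expR (- k * x) * F x) (- k * (expR (- k * x) * F x) + f x) /\
  is_derive x (1 : R) (fun x => expR (k * x) * (Ginf - G x)) (k * (expR (k * x) * (Ginf - G x)) - f x)}.
Proof.
apply: ae_mono ae_dFG => x [dF dG].
have ee : expR (- k * x) * expR (k * x) = 1 by rewrite -expRD mulNr addNr expR0.
split.
  have := is_deriveM (is_derive_expRM (- k) x) dF.
  congr is_derive; rewrite /GRing.scale/= /gp mulrA ee; ring.
have := is_deriveM (is_derive_expRM k x) (is_deriveB (is_derive_cst Ginf x (1 : R)) dG).
congr is_derive; have -> : (cst Ginf - G) x = Ginf - G x by [].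
rewrite /GRing.scale/= sub0r /gm mulrN [X in - X + _]mulrA (mulrC (expR (k * x)) (expR (- k * x))) ee; ring.
Qed.

Lemma ae_derive_line_res1 :
  {ae mu, forall x : R, is_derive x (1 : R) line_res1 (k ^+ 2 * line_res x - f x)}.
Proof.
apply: ae_mono ae_dparts => x [d1 d2].
have := is_deriveZ (2^-1 : R) (is_deriveB d2 d1).
rewrite (_ : _ \*: _ = line_res1); last first.
  by apply/funext => y; rewrite /line_res1 /GRing.scale/= mulrC.
congr is_derive; rewrite /line_res exp_convE /GRing.scale/=.
by field; rewrite gt_eqF.
Qed.

Lemma derive_line_res (x : R) : 0 < x -> is_derive x (1 : R) line_res (line_res1 x).
Proof.
move=> x0; have x1 : 0 <= x + 1 by lra.
apply: (abs_cont_derive_everywhere (abs_cont_line_res x1) (abs_cont_line_res1 x1)); last first.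
  by rewrite x0 ltrDl ltr01.
apply: ae_mono ae_dparts => y [d1 d2] _.
have := is_deriveZ ((2 * k)^-1 : R) (is_deriveD d1 d2).
rewrite (_ : _ \*: _ = line_res); last first.
  by apply/funext => z; rewrite /line_res exp_convE.
congr is_derive; rewrite /line_res1 /GRing.scale/=.
by field; rewrite gt_eqF.
Qed.

(** To the left of all sources [line_res] is a multiple of [expR (k * x)], to the right of them a
    multiple of [expR (- k * x)]. At either end of an edge the derivative pointing into the edge is
    thus [k] times the value. *)
Lemma line_res1_0 : line_res1 0 = k * line_res 0.
Proof.
have z (g : R -> R) : (forall y, y < 0 -> g y = 0) -> (forall b : R, mu.-integrable `]-oo, b] (EFin \o g)) ->
    \int[mu]_(y in `]-oo, 0]) g y = 0.
  move=> g0 ig; rewrite -Rintegral_itv_bndo_bndc; last first.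
    by apply: integrableS (ig 0) => // y /=; rewrite !in_itv/= => /ltW.
  by apply: Rintegral_zero => y; rewrite /= in_itv/=; exact: g0.
rewrite /line_res1 /line_res exp_convE /F /G !z//.
- by rewrite !mulr0 expR0; field; rewrite gt_eqF.
- by move=> y y0; rewrite /gp f_neg// mulr0.
- by move=> y y0; rewrite /gm f_neg// mulr0.
Qed.

Lemma line_res1_end a : (forall y, a < y -> f y = 0) -> line_res1 a = - k * line_res a.
Proof.
move=> fa; rewrite /line_res1 /line_res exp_convE -Gtail.
rewrite Rintegral_zero => [|y]; last by rewrite /= in_itv/= andbT /gm => /fa ->; rewrite mulr0.
by rewrite mulr0; field; rewrite gt_eqF.
Qed.

End Resolvent.
End LineODE.

(** * Asymptotics of the scattering matrix *)

Section ComplexPoly.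
Variable R : realType.
Implicit Types (z w : R[i]) (q : {poly R[i]}).

(** The norm of [R[i]] takes its values in [R[i]]; this is the same number seen in [R]. *)
Definition nrm z : R := complex.Re `|z|.

Lemma nrmE z : `|z| = (nrm z)%:C%C.
Proof. by rewrite /nrm RRe_real// normr_real. Qed.

Lemma nrm_ge0 z : 0 <= nrm z.
Proof. by have := normr_ge0 z; rewrite nrmE -[0]/(0%:C%C) lecR. Qed.

Lemma nrmM z w : nrm (z * w) = nrm z * nrm w.
Proof. by apply: (@complexI R); rewrite rmorphM/= -!nrmE normrM. Qed.

Lemma nrmD z w : nrm (z + w) <= nrm z + nrm w.
Proof. by rewrite -lecR rmorphD/= -!nrmE ler_normD. Qed.

Lemma nrmB z w : nrm z - nrm w <= nrm (z + w).
Proof. by rewrite -lecR rmorphB/= -!nrmE lerB_normD. Qed.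

Lemma nrm_real (x : R) : nrm (x%:C)%C = `|x|.
Proof. by apply: (@complexI R); rewrite -nrmE normc_def /= expr0n /= addr0 sqrtr_sqr. Qed.

Lemma nrm_gt0 z : (0 < nrm z) = (z != 0).
Proof. by rewrite -ltcR -nrmE normr_gt0. Qed.

Lemma poly_nrm_lower q : q != 0 ->
  exists2 c : R, 0 < c & exists K, forall x : R, K <= x -> c <= nrm q.[(x%:C)%C].
Proof.
elim/poly_ind: q => [|p c IH]; first by rewrite eqxx.
have [->|p0 _] := eqVneq p 0.
  rewrite mul0r add0r polyC_eq0 => c0; exists (nrm c); first by rewrite nrm_gt0.
  by exists 0 => x _; rewrite hornerC.
have [c1 c10 [K HK]] := IH p0.
(* Horner step: the value of [p] stays above [c1], so after multiplication by a large [x] it exceeds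
   [1 + nrm c]. *)
exists 1 => //; exists (Num.max (Num.max K 0) ((1 + nrm c) / c1)) => x.
rewrite !ge_max => /andP[/andP[Kx x0] cx].
rewrite !hornerE; apply: le_trans (nrmB _ _).
rewrite nrmM nrm_real ger0_norm// lerBrDr.
rewrite ler_pdivrMr// mulrC in cx; apply: le_trans cx _.
by rewrite ler_wpM2r// HK.
Qed.

Lemma poly_nrm_upper q : exists C N, 0 < C /\ forall x : R, 1 <= x -> nrm q.[(x%:C)%C] <= C * x ^+ N.
Proof.
elim/poly_ind: q => [|p c [C [N [C0 H]]]].
  by exists 1, 0%N; split => // x x1; rewrite horner0 -[0]/(0%:C%C) nrm_real normr0 expr0 mulr1.
exists (C + nrm c), N.+1; split; first by rewrite ltr_pwDl ?nrm_ge0.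
move=> x x1; have x0 : 0 <= x by lra.
rewrite !hornerE; apply: le_trans (nrmD _ _) _.
rewrite nrmM nrm_real ger0_norm// mulrDl lerD//.
  by rewrite exprSr mulrA ler_wpM2r// H.
by rewrite ler_peMr ?nrm_ge0// exprn_ege1.
Qed.

(** One power more than needed is taken from the exponential series; the spare factor [x] absorbs
    the constants. *)
Lemma expR_dominates (C : R) N (a : R) : 0 < C -> 0 < a ->
  exists K, forall x, K <= x -> C * x ^+ N <= expR (a * x).
Proof.
move=> C0 a0; exists (Num.max 0 (C * (N.+1)`!%:R / a ^+ N.+1)) => x.
rewrite ge_max => /andP[x0 Hx].
have ax : 0 <= a * x by rewrite mulr_ge0// ltW.
apply: le_trans (_ : (a * x) ^+ N.+1 / (N.+1)`!%:R <= _); last first.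
  by apply: le_trans (expR_ge1Dxn N ax); rewrite lerDr.
have f0 : 0 < (N.+1)`!%:R :> R by rewrite ltr0n fact_gt0.
rewrite ler_pdivlMr// exprMn (exprSr x) mulrAC mulrA [leRHS]mulrAC.
rewrite ler_wpM2r ?exprn_ge0//.
by rewrite -ler_pdivrMl ?exprn_gt0// mulrC.
Qed.

Lemma poly_nrm_subexponential q (a : R) : q != 0 -> 0 < a ->
  exists K, forall x : R, K <= x -> expR (- (a * x)) <= nrm q.[(x%:C)%C] <= expR (a * x).
Proof.
move=> q0 a0; have [c c0 [K1 H1]] := poly_nrm_lower q0.
have [C [N [C0 H2]]] := poly_nrm_upper q.
have [K2 H3] := expR_dominates N C0 a0.
have ci : 0 < c^-1 by rewrite invr_gt0.
have [K3 H4] := expR_dominates 0 ci a0.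
exists (Num.max (Num.max K1 K2) (Num.max K3 1)) => x.
rewrite !ge_max => /andP[/andP[x1 x2] /andP[x3 x4]]; apply/andP; split.
  apply: le_trans (H1 _ x1); rewrite expRN -[leRHS]invrK lef_pV2 ?posrE ?expR_gt0//.
  by have := H4 _ x3; rewrite expr0 mulr1.
by apply: le_trans (H2 _ x4) _; exact: H3.
Qed.

Variables (n : nat) (A B : 'M[R[i]]_n).

Lemma one_plus_SmxE (x : R) : A - (x%:C)%C *: B \in unitmx ->
  1%:M + Smx_ikappa A B x = invmx (A - (x%:C)%C *: B) *m ((- 2 * x)%:C%C *: B).
Proof.
move=> u; rewrite /Smx_ikappa -[X in X + _](mulVmx u) -mulmxBr; congr (_ *m _).
have -> : (- 2 * x)%:C%C = - (2 * x%:C%C) :> R[i] by rewrite rmorphM rmorphN rmorph_nat mulNr.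
by apply/matrixP => i j; rewrite !mxE; ring.
Qed.

(** The condition is rewritten as [(A - x B) c1 = - B (x c1 + c2)]. Neither [A] nor [B] is inverted,
    and the only matrix that appears is the one assumed positive. *)
Lemma in_M_SmxE (x : R) (c1 c2 : 'cV[R[i]]_n) : 0 < x -> A - (x%:C)%C *: B \in unitmx ->
  in_M A B c1 c2 <->
  (2 * x)%:C%C *: c1 = (1%:M + Smx_ikappa A B x) *m ((x%:C)%C *: c1 + c2).
Proof.
move=> x0 u; rewrite /in_M one_plus_SmxE// -mulmxA -scalemxAl.
have x2 : (2 * x)%:C%C != 0 :> R[i] by rewrite fmorph_eq0 gt_eqF// mulr_gt0.
rewrite (_ : (- 2 * x)%:C%C = - (2 * x)%:C%C); last by rewrite mulNr rmorphN.
rewrite scaleNr mulmxN -scalemxAr -scalerN; split.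
  move=> h; congr (_ *: _); rewrite -mulmxN; apply: (canRL (mulKmx u)).
  rewrite mulmxDr mulmxBl opprD -scalemxAl -scalemxAr addrC; congr (_ + _).
  by apply/eqP; rewrite -addr_eq0 h.
move=> /(scalerI x2) /(congr1 (mulmx (A - (x%:C)%C *: B))).
rewrite mulmxN mulmxA mulmxV// mul1mx mulmxDr mulmxBl opprD -scalemxAl -scalemxAr addrC.
by move=> /addrI ->; rewrite addNr.
Qed.

(** By Cramer's rule the entry is a quotient of two polynomials in [x]. Positivity of the entry
    shows that the numerator is not the zero polynomial, without which there would be no lower
    bound. Each polynomial receives half of the rate [a]. *)
Lemma Smx_subexponential (x0 : R) (l l' : 'I_n) :
  (forall x, x0 <= x -> A - (x%:C)%C *: B \in unitmx /\ 0 < (1%:M + Smx_ikappa A B x) l l') ->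
  forall a : R, 0 < a -> exists K, forall x : R, K <= x ->
    expR (- (a * x)) <= complex.Re ((1%:M + Smx_ikappa A B x) l l') <= expR (a * x).
Proof.
move=> H a a0.
pose MX : 'M[{poly R[i]}]_n := map_mx polyC A - 'X *: map_mx polyC B.
have MXE z : map_mx (horner_eval z) MX = A - z *: B.
  by apply/matrixP => i j; rewrite !mxE /horner_eval !hornerE.
pose num : {poly R[i]} := (- 2)%:P * 'X * \sum_m (\adj MX) l m * (B m l')%:P.
pose den : {poly R[i]} := \det MX.
have denE z : den.[z] = \det (A - z *: B).
  by rewrite -MXE det_map_mx.
have E x : x0 <= x -> (1%:M + Smx_ikappa A B x) l l' * den.[(x%:C)%C] = num.[(x%:C)%C].
  move=> /H[u _]; rewrite one_plus_SmxE//.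
  have du : \det (A - (x%:C)%C *: B) \is a GRing.unit by rewrite -unitmxE.
  rewrite denE /invmx u -scalemxAl mxE mulrC mulrA mulrV// mul1r -scalemxAr mxE.
  rewrite /num !hornerM hornerX hornerC horner_sum mxE.
  rewrite (_ : (- 2 * x)%:C%C = - 2 * x%:C%C); last by rewrite rmorphM rmorphN rmorph_nat.
  congr (_ * _).
  apply: eq_bigr => m _; rewrite !hornerE; congr (_ * _).
  by rewrite -MXE -map_mx_adj mxE.
have den0 : den != 0.
  apply/eqP => h; have [u _] := H _ (lexx x0).
  by move: u; rewrite unitmxE -denE h horner0 unitr0.
have num0 : num != 0.
  apply/eqP => h; have [u p] := H _ (lexx x0).
  have := E _ (lexx x0); rewrite h horner0 => /eqP; rewrite mulf_eq0 gt_eqF//= denE.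
  by move: u; rewrite unitmxE unitfE => /negPf->.
have a2 : 0 < a / 2 by rewrite divr_gt0.
have [K1 H1] := poly_nrm_subexponential num0 a2.
have [K2 H2] := poly_nrm_subexponential den0 a2.
exists (Num.max x0 (Num.max K1 K2)) => x.
rewrite !ge_max => /andP[xx0 /andP[/H1/andP[h1 h2] /H2/andP[h3 h4]]].
have [_ p] := H _ xx0; have := congr1 nrm (E _ xx0); rewrite nrmM.
move: h1 h2 h3 h4.
set N := nrm num.[_]; set D := nrm den.[_].
have -> : nrm ((1%:M + Smx_ikappa A B x) l l') = complex.Re ((1%:M + Smx_ikappa A B x) l l').
  by rewrite /nrm ger0_norm// ltW.
set P := complex.Re _ => h1 h2 h3 h4 PD.
have e0 := expR_gt0 (a / 2 * x); have D0 : 0 < D by apply: lt_le_trans h3; exact: expR_gt0.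
have -> : P = N / D by rewrite -PD mulfK// gt_eqF.
have aE : a * x = a / 2 * x + a / 2 * x by field.
rewrite aE; move: (a / 2 * x) h1 h2 h3 h4 e0 => y h1 h2 h3 h4 e0.
rewrite opprD !expRD; apply/andP; split.
  rewrite ler_pdivlMr// -mulrA; apply: le_trans h1.
  by rewrite ler_piMr ?expR_ge0// expRN mulrC ler_pdivrMr// mul1r.
rewrite ler_pdivrMr//; apply: le_trans h2 _; rewrite -mulrA ler_peMr ?expR_ge0//.
by rewrite -ler_pdivrMl// mulr1 -expRN.
Qed.

End ComplexPoly.

(** * From the vertex blocks to the whole boundary space *)

Section LocalToGlobal.
Variables (R : realType) (V : finType) (nE nI : nat).
Variables (dE : 'I_nE -> V) (dm dp : 'I_nI -> V).
Notation kv := (kvert dE dm dp).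
Notation K := (Kdim nE nI).
Notation Ld := (Ldim dE dm dp).

Lemma kvertP k : k \in Lpred dE dm dp (kv k).
Proof. by rewrite inE. Qed.

(** Taking real parts loses nothing where it is applied: a positive element of [R[i]] is real.
    [enum_rank_in] gives the position of an endpoint within its vertex. *)
Definition glue (Q : forall v, 'M[R[i]]_(Ld v)) : 'M[R]_K :=
  \matrix_(k, l) if kv l == kv k then
    complex.Re (Q (kv k) (enum_rank_in (kvertP k) k) (enum_rank_in (kvertP k) l)) else 0.

Lemma glueE Q v (l j : 'I_(Ld v)) : glue Q (Lidx l) (Lidx j) = complex.Re (Q v l j).
Proof.
(* The vertex of [Lidx l] is only provably equal to [v]; the index is generalized so that this
   equality can be eliminated. *)
suff H k u (e : kv k = u) (x y : 'I_(Ld u)) : Lidx x = k ->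
    glue Q k (Lidx y) = complex.Re (Q u x y) by apply: H => //; apply/eqP; exact: (enum_valP l).
case: u / e x y => x y xk; rewrite mxE.
have -> : kv (Lidx y) == kv k by exact: (enum_valP y).
have -> : enum_rank_in (kvertP k) k = x.
  by rewrite -[X in enum_rank_in _ X]xk; exact: enum_valK_in.
by rewrite enum_valK_in.
Qed.

Lemma LidxP k : exists v (l : 'I_(Ld v)), Lidx l = k.
Proof.
exists (kv k), (enum_rank_in (kvertP k) k).
by rewrite /Lidx enum_rankK_in ?kvertP.
Qed.

Lemma kv_Lidx v (l : 'I_(Ld v)) : kv (Lidx l) = v.
Proof. by apply/eqP; exact: (enum_valP l). Qed.

Lemma glue_off Q k l : kv k != kv l -> glue Q k l = 0.
Proof. by rewrite mxE eq_sym => /negPf ->. Qed.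

Lemma glue_on Q k l : kv k = kv l -> exists v (x y : 'I_(Ld v)), glue Q k l = complex.Re (Q v x y).
Proof. move=> kl; rewrite mxE; have -> : kv l == kv k by rewrite kl.
by exists (kv k), (enum_rank_in (kvertP k) k), (enum_rank_in (kvertP k) l). Qed.

Lemma restr_glue (Q : forall v, 'M[R[i]]_(Ld v)) v (w : 'cV[R[i]]_K) :
  (forall l j, (complex.Re (Q v l j))%:C%C = Q v l j) ->
  restrL dE dm dp v (map_mx (real_complex R) (glue Q) *m w) =
  Q v *m restrL dE dm dp v w.
Proof.
move=> Qr; apply/matrixP => l j; rewrite !mxE ord1 (bigID (mem (Lpred dE dm dp v)))/=.
rewrite [X in _ + X]big1 ?addr0 => [|k]; last first.
  move=> kl; rewrite mxE glue_off ?rmorph0 ?mul0r// kv_Lidx eq_sym.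
  exact: kl.
rewrite big_enum_val/=; apply: eq_bigr => x _.
by rewrite mxE -Qr -glueE; congr (_ * _); rewrite mxE.
Qed.

Lemma restrLP (x y : 'cV[R[i]]_K) :
  (forall v, restrL dE dm dp v x = restrL dE dm dp v y) -> x = y.
Proof.
move=> H; apply/matrixP => k j; rewrite ord1; have [v [l <-]] := LidxP k.
by have /matrixP/(_ l 0) := H v; rewrite !mxE.
Qed.

Lemma restrL_lin v (c : R[i]) (x y : 'cV[R[i]]_K) :
  restrL dE dm dp v (c *: x + y) = c *: restrL dE dm dp v x + restrL dE dm dp v y.
Proof. by apply/matrixP => l j; rewrite !mxE. Qed.

Lemma restrLZ v (c : R[i]) (x : 'cV[R[i]]_K) :
  restrL dE dm dp v (c *: x) = c *: restrL dE dm dp v x.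
Proof. by apply/matrixP => l j; rewrite !mxE. Qed.

(* [P x] is [I + S(i x; M)] written in the coordinates of the whole space [K]. *)
Lemma local_scattering (A B : 'M[R[i]]_K) : locally_strictly_positive dE dm dp A B ->
  exists (P : R -> 'M[R]_K) (x0 : R), [/\ 0 < x0,
    forall x k l, x0 <= x -> kv k = kv l -> 0 < P x k l,
    forall x k l, kv k != kv l -> P x k l = 0,
    (forall a k l, 0 < a -> kv k = kv l -> exists X, forall x, X <= x ->
      expR (- (a * x)) <= P x k l <= expR (a * x)) &
    forall x c1 c2, x0 <= x -> in_M A B c1 c2 <->
      (2 * x)%:C%C *: c1 = map_mx (real_complex R) (P x) *m ((x%:C)%C *: c1 + c2)].
Proof.
move=> [Av [Bv [[_ dec] [q [q0 H]]]]].
pose Q (x : R) v := 1%:M + Smx_ikappa (Av v) (Bv v) x.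
(* [q] may be 0, whereas the reformulated boundary conditions need a positive [x]. *)
exists (fun x => glue (Q x)), (Num.max q 1).
have Qpos x v l j : q <= x -> 0 < Q x v l j by move=> qx; have [_] := H x qx v; apply.
have Qre x v l j : q <= x -> (complex.Re (Q x v l j))%:C%C = Q x v l j.
  by move=> qx; rewrite RRe_real// gtr0_real// Qpos.
split.
- by rewrite lt_max ltr01 orbT.
- move=> x k l; rewrite ge_max => /andP[qx _] /(glue_on (Q x))[v [i [j ->]]].
  by rewrite -ltcR Qre// Qpos.
- by move=> x k l; exact: glue_off.
- move=> a k l a0 kl.
  have [v [i [j [ik jl]]]] : exists v (i j : 'I_(Ld v)), Lidx i = k /\ Lidx j = l.
    have [v [i ik]] := LidxP k; exists v, i.
    move: kl; rewrite -{1}ik kv_Lidx => vl.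
    subst v.
    by exists (enum_rank_in (kvertP l) l); rewrite /Lidx enum_rankK_in ?kvertP.
  have [X HX] := Smx_subexponential (fun x qx => conj (H x qx v).1 ((H x qx v).2 i j)) a0.
  by exists X => x /HX; rewrite -ik -jl glueE.
- move=> x c1 c2; rewrite ge_max => /andP[qx x1].
  have x0 : 0 < x by lra.
  rewrite dec; split.
    move=> h; apply: restrLP => v; rewrite restr_glue; last by move=> l j; exact: Qre.
    rewrite restrLZ restrL_lin; apply/(in_M_SmxE _ _ x0 (H x qx v).1); exact: h.
  move=> h v; apply/(in_M_SmxE _ _ x0 (H x qx v).1).
  by rewrite -restrLZ -restrL_lin h restr_glue// => l j; exact: Qre.
Qed.

End LocalToGlobal.

(** * Positivity of the kernel *)

Section Endpoints.
Variables (R : realType) (nE nI : nat) (a : 'I_nI -> R).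
Hypothesis a_gt0 : forall i, 0 < a i.
Notation K := (Kdim nE nI).
Notation edge := (edge nE nI).

Definition kE (e : 'I_nE) : 'I_K := lshift nI (lshift nI e).
Definition kM (i : 'I_nI) : 'I_K := lshift nI (rshift nE i).
Definition kP (i : 'I_nI) : 'I_K := rshift (nE + nI) i.

Lemma split_kE e : fintype.split (kE e) = inl (lshift nI e).
Proof. exact: (unsplitK (inl _)). Qed.
Lemma split_kM i : fintype.split (kM i) = inl (rshift nE i).
Proof. exact: (unsplitK (inl _)). Qed.
Lemma split_kP i : fintype.split (kP i) = inr i.
Proof. exact: (unsplitK (inr _)). Qed.
Lemma split_lE (e : 'I_nE) : fintype.split (lshift nI e) = inl e.
Proof. exact: (unsplitK (inl _)). Qed.
Lemma split_rM (i : 'I_nI) : fintype.split (rshift nE i) = inr i.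
Proof. exact: (unsplitK (inr _)). Qed.
Definition splitE := (split_kE, split_kM, split_kP, split_lE, split_rM).

Lemma endpoint_ind (Q : 'I_K -> Prop) : (forall e, Q (kE e)) -> (forall i, Q (kM i)) ->
  (forall i, Q (kP i)) -> forall k, Q k.
Proof.
move=> hE hM hP k; rewrite -(splitK k); case: (fintype.split k) => [l|i]; last exact: hP.
rewrite -(splitK l); case: (fintype.split l) => [e|i]; [exact: hE|exact: hM].
Qed.

Definition kedge (k : 'I_K) : edge :=
  match fintype.split k with
  | inl l => match fintype.split l with inl e => inl e | inr i => inr i end
  | inr i => inr i
  end.

Definition kright (k : 'I_K) : bool := if fintype.split k is inr _ then true else false.

Definition kpt (k : 'I_K) : R := if fintype.split k is inr i then a i else 0.

(** Turns the derivative along the edge into the one pointing into the edge. *)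
Definition ksg (k : 'I_K) : R := if kright k then -1 else 1.

(* The other endpoint of the same internal edge; external endpoints are fixed. *)
Definition star (k : 'I_K) : 'I_K :=
  match fintype.split k with
  | inl l => match fintype.split l with inl e => kE e | inr i => kP i end
  | inr i => kM i
  end.

Lemma kedgeE e : kedge (kE e) = inl e. Proof. by rewrite /kedge !splitE. Qed.
Lemma kedgeM i : kedge (kM i) = inr i. Proof. by rewrite /kedge !splitE. Qed.
Lemma kedgeP i : kedge (kP i) = inr i. Proof. by rewrite /kedge !splitE. Qed.
Lemma krightE e : kright (kE e) = false. Proof. by rewrite /kright !splitE. Qed.
Lemma krightM i : kright (kM i) = false. Proof. by rewrite /kright !splitE. Qed.
Lemma krightP i : kright (kP i) = true. Proof. by rewrite /kright !splitE. Qed.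
Lemma kptE e : kpt (kE e) = 0. Proof. by rewrite /kpt !splitE. Qed.
Lemma kptM i : kpt (kM i) = 0. Proof. by rewrite /kpt !splitE. Qed.
Lemma kptP i : kpt (kP i) = a i. Proof. by rewrite /kpt !splitE. Qed.
Lemma starE e : star (kE e) = kE e. Proof. by rewrite /star !splitE. Qed.
Lemma starM i : star (kM i) = kP i. Proof. by rewrite /star !splitE. Qed.
Lemma starP i : star (kP i) = kM i. Proof. by rewrite /star !splitE. Qed.
Definition endpE := (kedgeE, kedgeM, kedgeP, krightE, krightM, krightP, kptE, kptM, kptP,
  starE, starM, starP).

Lemma endpoint_inj k l : kedge k = kedge l -> kright k = kright l -> k = l.
Proof.
elim/endpoint_ind: k => i; elim/endpoint_ind: l => j; rewrite !endpE// => -[->] //.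
Qed.

Lemma starK : involutive star.
Proof. by elim/endpoint_ind => i; rewrite !endpE. Qed.

Lemma kedge_star k : kedge (star k) = kedge k.
Proof. by elim/endpoint_ind: k => i; rewrite !endpE. Qed.

Lemma sum_edge (F : 'I_K -> R) k :
  \sum_(l | kedge l == kedge k) F l = F k + (if kedge k is inr _ then F (star k) else 0).
Proof.
elim/endpoint_ind: k => i; rewrite !endpE.
- rewrite addr0 (big_pred1 (kE i))// => l /=.
  apply/eqP/eqP => [|->]; last by rewrite endpE.
  by elim/endpoint_ind: l => j; rewrite !endpE// => -[->].
- have h l : (kedge l == inr i) && (l != kM i) = (l == kP i).
    apply/andP/eqP => [[/eqP e /eqP n]|->].
      have r : kright l = true.
        by apply: contrapT => /negP/negbTE h; apply: n; apply: endpoint_inj; rewrite !endpE.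
      by apply: endpoint_inj; rewrite !endpE.
    by rewrite endpE eqxx; split => //; apply/eqP => /(congr1 kright); rewrite !endpE.
  by rewrite (bigD1 (kM i)) ?endpE//= (big_pred1 (kP i)).
- have h l : (kedge l == inr i) && (l != kP i) = (l == kM i).
    apply/andP/eqP => [[/eqP e /eqP n]|->].
      have r : kright l = false.
        by apply/negbTE/negP => h; apply: n; apply: endpoint_inj; rewrite !endpE.
      by apply: endpoint_inj; rewrite !endpE.
    by rewrite endpE eqxx; split => //; apply/eqP => /(congr1 kright); rewrite !endpE.
  by rewrite (bigD1 (kP i)) ?endpE//= (big_pred1 (kM i)).
Qed.

Variable x : R.
Hypothesis x_gt0 : 0 < x.

(** Zero on external edges, since nothing returns from infinity; the value of [star] there is then
    immaterial. *)
Definition transmission (k : 'I_K) : R := if kedge k is inr i then expR (- x * a i) else 0.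
Definition alpha (k : 'I_K) (y : R) : R := expR (- x * (ksg k * (y - kpt k))).

Lemma transmission_star k : transmission (star k) = transmission k.
Proof. by rewrite /transmission kedge_star. Qed.

Lemma transmission_ge0 k : 0 <= transmission k.
Proof. by rewrite /transmission; case: kedge => // i; exact: expR_ge0. Qed.

Lemma alphaE e y : alpha (kE e) y = expR (- x * y).
Proof. by rewrite /alpha /ksg !endpE mul1r subr0. Qed.
Lemma alphaM e y : alpha (kM e) y = expR (- x * y).
Proof. by rewrite /alpha /ksg !endpE mul1r subr0. Qed.
Lemma alphaP e y : alpha (kP e) y = expR (- x * (a e - y)).
Proof. by rewrite /alpha /ksg !endpE mulN1r opprB. Qed.

Lemma alpha_dist k y : Iset a (kedge k) y -> alpha k y = expR (- x * `|kpt k - y|).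
Proof.
elim/endpoint_ind: k => i; rewrite ?alphaE ?alphaM ?alphaP !endpE /=.
- by move=> y0; rewrite sub0r normrN ger0_norm.
- by move=> [y0 _]; rewrite sub0r normrN ger0_norm.
- by move=> [_ y1]; rewrite ger0_norm// subr_ge0.
Qed.

Lemma alpha_self k : alpha k (kpt k) = 1.
Proof. by rewrite /alpha subrr !mulr0 expR0. Qed.

(** If [c] holds the amplitudes leaving the endpoints, [transmission k * c (star k)] is what reaches
    [k] from the other end. Values add the two, inward derivatives subtract them, as in the next
    lemma. *)
Lemma sum_alpha_kpt k (c : 'I_K -> R) :
  \sum_(l | kedge l == kedge k) alpha l (kpt k) * c l = c k + transmission k * c (star k).
Proof.
rewrite (sum_edge (fun l => alpha l (kpt k) * c l)) alpha_self mul1r; congr (_ + _).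
rewrite /transmission; elim/endpoint_ind: k => i; rewrite !endpE ?alphaE ?alphaM ?alphaP ?mul0r//.
by rewrite subr0.
Qed.

Lemma sum_dalpha_kpt k (c : 'I_K -> R) :
  ksg k * \sum_(l | kedge l == kedge k) - x * ksg l * alpha l (kpt k) * c l =
  x * (transmission k * c (star k) - c k).
Proof.
rewrite (sum_edge (fun l => - x * ksg l * alpha l (kpt k) * c l)) alpha_self /transmission.
elim/endpoint_ind: k => i; rewrite /ksg !endpE ?alphaE ?alphaM ?alphaP ?subr0; ring.
Qed.

Definition Tmx : 'M[R]_K := \matrix_(k, l) (transmission k * (l == star k)%:R).

Lemma sum_delta (F : 'I_K -> R) (c : R) m :
  \sum_l c * (l == m)%:R * F l = c * F m.
Proof.
rewrite (bigD1 m)//= eqxx mulr1 big1 ?addr0// => l /negPf ->.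
by rewrite mulr0 mul0r.
Qed.

Lemma TmxE k (v : 'cV[R]_K) : (Tmx *m v) k 0 = transmission k * v (star k) 0.
Proof.
rewrite mxE -(sum_delta (fun l => v l 0)); apply: eq_bigr => l _.
by rewrite mxE.
Qed.

Lemma Tmx_sym : Tmx^T = Tmx.
Proof.
apply/matrixP => k l; rewrite !mxE.
have -> : (k == star l) = (l == star k) by apply/eqP/eqP => ->; rewrite starK.
by case: eqP => [->|]; rewrite ?transmission_star// !mulr0.
Qed.

Variables (P : 'M[R]_K) (tau pM : R).
Let S := P - 1%:M.
Hypothesis tau_ge0 : 0 <= tau.
Hypothesis transmission_le : forall k, transmission k <= tau.
Hypothesis tau_half : 2 * tau <= 1.
Hypothesis pM_ge0 : 0 <= pM.
Hypothesis P_le : forall k l, `|P k l| <= pM.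
Hypothesis small : K%:R * (tau * (pM + 1)) <= 1 / 2.

Lemma unitmx_TS : 1%:M - Tmx *m S \in unitmx.
Proof.
apply: unitmx_contraction => k; apply: le_trans small; apply: ler_rowsum => l.
rewrite mxE; under eq_bigr do rewrite mxE.
rewrite (sum_delta (fun m => S m l)) normrM ger0_norm ?transmission_ge0//.
apply: ler_pM => //; first exact: transmission_ge0.
rewrite !mxE; apply: le_trans (ler_normB _ _) _; apply: lerD => //.
by rewrite normr_nat; case: eqP.
Qed.

Lemma unitmx_1T : 1%:M + Tmx \in unitmx.
Proof.
rewrite -[Tmx]opprK; apply: unitmx_contraction => k.
have -> : \sum_l `|(- Tmx) k l| = transmission k.
  rewrite -[RHS]mulr1 -(sum_delta (fun=> 1) (transmission k) (star k)); apply: eq_bigr => l _.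
  by rewrite !mxE normrN ger0_norm ?mulr1// mulr_ge0 ?transmission_ge0.
by apply: le_trans (transmission_le k) _; move: tau_half; lra.
Qed.

(* Solves the matching conditions at the vertices for the incoming data [U]. *)
Definition Wmx : 'M[R]_K := invmx (1%:M - Tmx *m S).

Lemma WmxE (U : 'cV[R]_K) : Wmx *m U = U + Tmx *m (S *m (Wmx *m U)).
Proof.
have : (1%:M - Tmx *m S) *m (Wmx *m U) = U.
  by rewrite mulmxA mulmxV ?mul1mx// unitmx_TS.
rewrite mulmxBl mul1mx => /eqP; rewrite subr_eq => /eqP {1}->.
by rewrite !mulmxA.
Qed.

Lemma matching_unique (w : 'cV[R]_K) : w = Tmx *m (S *m w) -> w = 0.
Proof.
move=> h; have : (1%:M - Tmx *m S) *m w = 0 by rewrite mulmxBl mul1mx -mulmxA -h subrr.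
by move/(congr1 (mulmx Wmx)); rewrite mulKmx ?unitmx_TS// mulmx0.
Qed.

Lemma transmission_lt1 k : transmission k ^+ 2 < 1.
Proof.
by rewrite expr_lt1 ?transmission_ge0//; move: tau_half (transmission_le k); lra.
Qed.

(* The solution of [h'' = x^2 h] on the edge of [k] which is 1 at the endpoint
   [k] and 0 at (respectively, decays towards) the other end. *)
Definition harm (k : 'I_K) (y : R) : R :=
  (alpha k y - transmission k * alpha (star k) y) / (1 - transmission k ^+ 2).

(** Encodes a point of the graph as a vector over the endpoints, which makes the scattered part of
    the kernel a bilinear form. *)
Definition edgev (F : 'I_K -> R -> R) (j : edge) (y : R) : 'cV[R]_K :=
  \col_k (if kedge k == j then F k y else 0).

Lemma harm_alpha j y : (1%:M + Tmx) *m edgev harm j y = edgev alpha j y.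
Proof.
apply/matrixP => k c; rewrite ord1 mulmxDl mul1mx mxE TmxE !mxE kedge_star.
case: eqP => _; last by rewrite mulr0 addr0.
rewrite /harm transmission_star starK; have := transmission_lt1 k => t1.
by field; rewrite gt_eqF// subr_gt0.
Qed.

(* [2 x] times the Green function at [kappa = x]. *)
Definition greenK (j j' : edge) (y z : R) : R :=
  (if j == j' then expR (- x * `|y - z|) else 0) +
  \sum_k \sum_l (edgev alpha j y) k 0 * (S *m Wmx) k l * (edgev alpha j' z) l 0.

(* Since [alpha = (1 + T) harm], the factor [1 + T] turns [S W] into [P W - 1]. *)
Lemma greenK_decomp j j' y z :
  greenK j j' y z =
    ((if j == j' then expR (- x * `|y - z|) else 0) -
      \sum_k (edgev harm j y) k 0 * (edgev alpha j' z) k 0) +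
    \sum_k (edgev harm j y) k 0 * (P *m (Wmx *m edgev alpha j' z)) k 0.
Proof.
rewrite /greenK -addrA; congr (_ + _).
set E' := edgev alpha j' z; set H := edgev harm j y.
set W := Wmx *m E'.
have -> : \sum_k \sum_l (edgev alpha j y) k 0 * (S *m Wmx) k l * E' l 0 =
    ((edgev alpha j y)^T *m (S *m W)) 0 0.
  transitivity (\sum_k (edgev alpha j y) k 0 * (S *m W) k 0).
    apply: eq_bigr => k _; rewrite /W mulmxA [X in _ = _ * X]mxE mulr_sumr.
    by apply: eq_bigr => l _; rewrite mulrA.
  by rewrite [RHS]mxE; apply: eq_bigr => k _; rewrite [X in _ = X * _]mxE.
have -> : \sum_k H k 0 * E' k 0 = (H^T *m E') 0 0.
  by rewrite [RHS]mxE; apply: eq_bigr => k _; rewrite [X in _ = X * _]mxE.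
have -> : \sum_k H k 0 * (P *m W) k 0 = (H^T *m (P *m W)) 0 0.
  by rewrite [RHS]mxE; apply: eq_bigr => k _; rewrite [X in _ = X * _]mxE.
rewrite -harm_alpha trmx_mul linearD/= trmx1 Tmx_sym -mulmxA mulmxDl mul1mx.
have -> : Tmx *m (S *m W) = W - E' by rewrite {2}/W WmxE addrC addKr.
have -> : S *m W = P *m W - W by rewrite mulmxBl mul1mx.
by rewrite addrA subrK mulmxBr !mxE addrC.
Qed.

(** This is [2 x] times the Dirichlet Green function: on an external edge the direct exponential
    minus its mirror image at 0, on an internal edge of length [a], for [v <= u], the product [2
    sinh (x v) sinh (x (a - u)) / sinh (x a)]. *)
Lemma dirichlet_ge0 j j' y z : Iset a j y -> Iset a j' z ->
  0 <= (if j == j' then expR (- x * `|y - z|) else 0) -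
      \sum_k (edgev harm j y) k 0 * (edgev alpha j' z) k 0.
Proof.
have x0 := x_gt0.
case: eqVneq => [<-{j'}|jj'] hy hz; last first.
  rewrite big1 ?subrr// => k _; rewrite !mxE; case: eqP => [->|]; last by rewrite mul0r.
  by rewrite (negPf jj') mulr0.
have -> : \sum_k (edgev harm j y) k 0 * (edgev alpha j z) k 0 =
    \sum_(k | kedge k == j) harm k y * alpha k z.
  rewrite [RHS]big_mkcond; apply: eq_bigr => k _; rewrite !mxE.
  by case: eqP => // _; rewrite mul0r.
case: j hy hz => i /= hy hz.
  rewrite -(kedgeE i) (sum_edge (fun k => harm k y * alpha k z)) /harm /transmission !endpE !alphaE.
  rewrite mul0r expr0n/= !subr0 divr1 addr0 -expRD subr_ge0 ler_expR.
  have : `|y - z| <= y + z by rewrite ler_norml; apply/andP; split; lra.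
  by move: x0; nra.
rewrite -(kedgeM i) (sum_edge (fun k => harm k y * alpha k z)) /harm /transmission !endpE !alphaM !alphaP.
have t1 : 0 < 1 - expR (- x * a i) ^+ 2.
  by have := transmission_lt1 (kM i); rewrite /transmission !endpE; lra.
have ai := a_gt0 i; set t := expR (- x * a i) in t1 *.
have key (u v : R) : 0 <= v -> v <= u -> u <= a i ->
    0 <= expR (- x * (u - v)) -
      ((expR (- x * u) - t * expR (- x * (a i - u))) / (1 - t ^+ 2) * expR (- x * v) +
       (expR (- x * (a i - u)) - t * expR (- x * u)) / (1 - t ^+ 2) * expR (- x * (a i - v))).
  move=> v0 vu ua; rewrite !mulrBr !expRB -/t.
  have U0 := expR_gt0 (- x * u); have V0 := expR_gt0 (- x * v); have T0 := expR_gt0 (- x * a i).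
  have tU : t <= expR (- x * u) by rewrite ler_expR; nra.
  have V1 : expR (- x * v) <= 1 by rewrite expR_le1; nra.
  set U := expR (- x * u) in U0 tU *; set V := expR (- x * v) in V0 V1 *.
  rewrite -/t in T0.
  (* The product of hyperbolic sines, written in the exponentials [U], [V] and [t]. *)
  rewrite (_ : _ - _ = (1 - V ^+ 2) * (U ^+ 2 - t ^+ 2) / (U * V * (1 - t ^+ 2))); last first.
    by field; rewrite !gt_eqF.
  have h1 : 0 <= 1 - V ^+ 2 by nra.
  have h2 : 0 <= U ^+ 2 - t ^+ 2 by nra.
  exact: divr_ge0 (mulr_ge0 h1 h2) (mulr_ge0 (mulr_ge0 (ltW U0) (ltW V0)) (ltW t1)).
have [zy|/ltW yz] := leP z y.
  by rewrite (ger0_norm (_ : 0 <= y - z)) ?[0 <= y - z]subr_ge0//; apply: key => //; lra.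
rewrite distrC (ger0_norm (_ : 0 <= z - y)) ?[0 <= z - y]subr_ge0//.
apply: le_trans (key z y hy.1 yz hz.2) _; rewrite le_eqVlt; apply/orP; left; apply/eqP.
by congr (_ - _); ring.
Qed.

Lemma harm_ge0 k y : Iset a (kedge k) y -> 0 <= harm k y.
Proof.
have x0 := x_gt0; move=> hy; rewrite /harm divr_ge0//; last by rewrite subr_ge0 ltW// transmission_lt1.
rewrite subr_ge0 /transmission; elim/endpoint_ind: k hy => i; rewrite !endpE ?alphaE ?alphaM ?alphaP /=.
- by rewrite mul0r expR_ge0.
- by move=> [y0 ya]; rewrite -expRD ler_expR; nra.
- by move=> [y0 ya]; rewrite -expRD ler_expR; nra.
Qed.

Lemma harm_gt0 j y : Iset a j y -> exists2 k, kedge k = j & 0 < harm k y.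
Proof.
have x0 := x_gt0; case: j => i /= hy.
  exists (kE i); first by rewrite endpE.
  by rewrite /harm /transmission !endpE alphaE mul0r expr0n /= !subr0 divr1 expR_gt0.
have ai := a_gt0 i.
(* The function attached to the left endpoint vanishes only at the right end, where the other one is
   used. *)
have [ya|ay] := ltP y (a i).
  exists (kM i); first by rewrite endpE.
  rewrite /harm divr_gt0// ?subr_gt0 ?transmission_lt1// /transmission !endpE alphaM alphaP -expRD ltr_expR.
  by nra.
exists (kP i); first by rewrite endpE.
rewrite /harm divr_gt0// ?subr_gt0 ?transmission_lt1// /transmission !endpE alphaM alphaP -expRD ltr_expR.
by nra.
Qed.

(** [b] collects the boundary values of [greenK] in its first variable. The coefficients come from
    inverting [1 + T] in [(1 + T) W = alpha + T b]: as [star] is an involution, [T^2] is diagonal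
    with entries [t^2], and [(1 + T)^-1 T = (T - T^2) / (1 - T^2)]. *)
Lemma W_boundary j z :
  let b := P *m (Wmx *m edgev alpha j z) in
  Wmx *m edgev alpha j z = edgev harm j z +
   \col_k (transmission k / (1 - transmission k ^+ 2) * b (star k) 0 - transmission k ^+ 2 / (1 - transmission k ^+ 2) * b k 0).
Proof.
move=> b; set W := Wmx *m _ in b *.
have h : (1%:M + Tmx) *m W = edgev alpha j z + Tmx *m b.
  rewrite mulmxDl mul1mx {1}/W WmxE -/W -addrA; congr (_ + _).
  by rewrite -mulmxDr; congr (_ *m _); rewrite /b mulmxBl mul1mx subrK.
apply: (can_inj (mulKmx unitmx_1T)); rewrite h mulmxDr harm_alpha; congr (_ + _).
clearbody b; apply/matrixP => k c; rewrite ord1 mulmxDl mul1mx [RHS]mxE !TmxE !mxE transmission_star starK.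
by have := transmission_lt1 k => t1; field; rewrite gt_eqF// subr_gt0.
Qed.

Variables (V : finType) (dE : 'I_nE -> V) (dm dp : 'I_nI -> V).
Notation kv := (kvert dE dm dp).
Variable pm : R.
Hypothesis P_off : forall k l, kv k != kv l -> P k l = 0.
Hypothesis P_on : forall k l, kv k = kv l -> pm <= P k l.
Hypothesis pm_gt0 : 0 < pm.
Hypothesis small1 : K%:R * (pM * (2 * tau)) <= 1 / 2.
Hypothesis small2 : K%:R * (pM * (2 * tau) * (2 * pM)) < pm.
Hypothesis small3 : K%:R * (K%:R * (2 * pM * (2 * tau))) <= 1 / 2.
Hypothesis connG : connected_graph dm dp.

Lemma kvM i : kv (kM i) = dm i. Proof. by rewrite /kvert !splitE. Qed.
Lemma kvP i : kv (kP i) = dp i. Proof. by rewrite /kvert !splitE. Qed.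

(** Transmission factors are at most 1/2, so the denominators exceed 1/2; hence [2 * tau] in the
    smallness conditions. *)
Lemma transmission_frac k : 0 <= transmission k / (1 - transmission k ^+ 2) <= 2 * tau /\
  0 <= transmission k ^+ 2 / (1 - transmission k ^+ 2) <= 2 * tau.
Proof.
have t0 := transmission_ge0 k; have t1 := transmission_le k; have t2 := transmission_lt1 k; have th := tau_half.
have d : 0 < 1 - transmission k ^+ 2 by lra.
by rewrite !divr_ge0 ?sqr_ge0 ?(ltW d)// !ler_pdivrMr//; split; nra.
Qed.

(** In the minimum principle the source is the vector of harmonic functions at [z], and [N] couples
    the two ends of each internal edge. *)
Lemma greenK_gt0 j j' y z : Iset a j y -> Iset a j' z -> 0 < greenK j j' y z.
Proof.
move=> hy hz; rewrite greenK_decomp ltr_wpDl ?dirichlet_ge0//.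
have [k0 k0j' k0pos] := harm_gt0 hz.
pose N : 'M[R]_K := \matrix_(k, l) (transmission k / (1 - transmission k ^+ 2) * (l == star k)%:R).
have bpos k : 0 < (P *m (Wmx *m edgev alpha j' z)) k 0.
  apply: (@potential_gt0 R V K kv P N (fun k => transmission k ^+ 2 / (1 - transmission k ^+ 2)) pm pM (2 * tau)
     _ _ _ _ _ _ _ _ _ (fun k => edgev harm j' z k 0)
     (fun k => (P *m (Wmx *m edgev alpha j' z)) k 0) k0 (gadj dm dp)) => //.
  - by move=> k1 l /P_on h; split => //; apply: le_trans (ler_norm _) _.
  - by move=> k1; have [_ /andP] := transmission_frac k1.
  - move=> k1 l; rewrite mxE; have [/andP[h1 h2] _] := transmission_frac k1.
    case: eqP => _; first by rewrite mulr1.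
    by rewrite mulr0; split => //; rewrite mulr_ge0.
  - move=> k1; rewrite mxE; case: eqP => // e; apply: harm_ge0; rewrite e; exact: hz.
  - by rewrite mxE k0j' eqxx.
  - move=> k1; rewrite mxE; apply: eq_bigr => l _; congr (_ * _).
    rewrite {1}W_boundary mxE [X in _ + X]mxE addrA; congr (_ + _ - _).
    rewrite -(sum_delta (fun m => (P *m (Wmx *m edgev alpha j' z)) m 0)).
    by apply: eq_bigr => m _; rewrite [N _ _]mxE.
  - have nM i : 0 < transmission (kM i) / (1 - transmission (kM i) ^+ 2) /\ 0 < transmission (kP i) / (1 - transmission (kP i) ^+ 2).
      by rewrite !divr_gt0 ?subr_gt0 ?transmission_lt1// /transmission !endpE expR_gt0.
    move=> v w /existsP[i /orP[]/andP[/eqP <- /eqP <-]].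
      exists (kM i), (kP i); rewrite kvM kvP; split => //.
      by rewrite mxE endpE eqxx mulr1; have [] := nM i.
    exists (kP i), (kM i); rewrite kvM kvP; split => //.
    by rewrite mxE endpE eqxx mulr1; have [] := nM i.
have [k kj kpos] := harm_gt0 hy.
rewrite (bigD1 k)//= ltr_pwDl//; first by rewrite mxE kj eqxx mulr_gt0.
apply: sumr_ge0 => l _; rewrite mulr_ge0 ?(ltW (bpos l))// mxE.
by case: eqP => // e; apply: harm_ge0; rewrite e.
Qed.

End Endpoints.

(** * The boundary value problem on the graph *)

Section GraphODE.
Variables (R : realType) (nE nI : nat) (a : 'I_nI -> R).
Hypothesis a_gt0 : forall i, 0 < a i.
Notation K := (Kdim nE nI).
Notation edge := (edge nE nI).
Notation mu := (@lebesgue_measure R).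

Definition L2r (D : set R) (f : R -> R) : Prop :=
  measurable_fun D f /\ (\int[mu]_(y in D) (f y ^+ 2)%:E < +oo)%E.

Lemma IsetE (j : edge) : Iset a j = if j is inr i then `[0, a i]%classic else `[0, +oo[%classic.
Proof.
case: j => i; apply/seteqP; split => y /=; rewrite in_itv/= ?andbT//.
  by move=> [-> ->].
by move=> /andP[-> ->].
Qed.

Lemma measurable_Iset (j : edge) : measurable (Iset a j).
Proof. by rewrite IsetE; case: j => i. Qed.

Lemma Iset_ge0 (j : edge) y : Iset a j y -> 0 <= y.
Proof. by case: j => i //= []. Qed.

Lemma Iint_lt (j : edge) b y : Iset a j b -> 0 < y -> y < b -> Iint a j y.
Proof. by case: j => i //= [_ ba] y0 yb; split => //; exact: lt_le_trans ba. Qed.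

Lemma L2rD D f g : measurable D -> L2r D f -> L2r D g -> L2r D (fun y => f y + g y).
Proof.
move=> mD [mf f2] [mg g2]; split; first exact: measurable_funD.
apply: le_lt_trans (_ : (_ <= \int[mu]_(y in D) ((2 * f y ^+ 2)%:E + (2 * g y ^+ 2)%:E))%E) _.
  apply: ge0_le_integral => //.
  - by move=> y _; rewrite lee_fin sqr_ge0.
  - by apply/measurable_EFinP/measurable_funX/measurable_funD.
  - apply: emeasurable_funD; apply/measurable_EFinP/measurable_funM => //; exact: measurable_funX.
  - move=> y _; rewrite -EFinD lee_fin; have := sqr_ge0 (f y - g y); rewrite sqrrB sqrrD; lra.
rewrite ge0_integralD//.
- apply: lte_add_pinfty.
    under eq_integral do rewrite EFinM.
    rewrite ge0_integralZl ?lte_mul_pinfty//.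
    + by apply/measurable_EFinP/measurable_funX.
    + by move=> y _; rewrite lee_fin sqr_ge0.
  under eq_integral do rewrite EFinM.
  rewrite ge0_integralZl ?lte_mul_pinfty//.
  + by apply/measurable_EFinP/measurable_funX.
  + by move=> y _; rewrite lee_fin sqr_ge0.
- by move=> y _; rewrite lee_fin mulr_ge0 ?sqr_ge0.
- by apply/measurable_EFinP/measurable_funM => //; exact: measurable_funX.
- by move=> y _; rewrite lee_fin mulr_ge0 ?sqr_ge0.
- by apply/measurable_EFinP/measurable_funM => //; exact: measurable_funX.
Qed.

Lemma L2rZ D f c : measurable D -> L2r D f -> L2r D (fun y => c * f y).
Proof.
move=> mD [mf f2]; split; first exact: measurable_funM.
under eq_integral do rewrite exprMn EFinM.
rewrite ge0_integralZl// ?lee_fin ?sqr_ge0//.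
- by apply: lte_mul_pinfty; rewrite ?lee_fin ?sqr_ge0.
- by apply/measurable_EFinP/measurable_funX.
- by move=> y _; rewrite lee_fin sqr_ge0.
Qed.

Lemma L2rB D f g : measurable D -> L2r D f -> L2r D g -> L2r D (fun y => f y - g y).
Proof.
move=> mD hf hg; have := L2rD mD hf (L2rZ (-1) mD hg).
by rewrite (_ : (fun y => f y + -1 * g y) = fun y => f y - g y)//; apply/funext => y; rewrite mulN1r.
Qed.

Lemma L2r_le (D : set R) (f g : R -> R) : measurable D -> measurable_fun D f -> L2r D g ->
  (forall y, D y -> f y ^+ 2 <= g y ^+ 2) -> L2r D f.
Proof.
move=> mD mf [mg g2] fg; split => //; apply: le_lt_trans g2; apply: ge0_le_integral => //.
- by move=> y _; rewrite lee_fin sqr_ge0.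
- by apply/measurable_EFinP/measurable_funX.
- by apply/measurable_EFinP/measurable_funX.
Qed.

Lemma L2r_sum D (I : Type) (r : seq I) (Q : pred I) (F : I -> R -> R) : measurable D ->
  (forall k, Q k -> L2r D (F k)) -> L2r D (fun y => \sum_(k <- r | Q k) F k y).
Proof.
move=> mD h; elim: r => [|k r IH].
  rewrite (_ : (fun y => _) = cst 0); last by apply/funext => y; rewrite big_nil.
  split; first exact: measurable_cst.
  by rewrite integral0_eq ?ltry// => y _; rewrite expr0n.
rewrite (_ : (fun y => _) = if Q k then (fun y => F k y + \sum_(k <- r | Q k) F k y) else
   (fun y => \sum_(k <- r | Q k) F k y)).
  by case: ifP => // /h hk; exact: L2rD.
by apply/funext => y; rewrite big_cons; case: ifP.
Qed.

Lemma abs_cont_sum (I : Type) (r : seq I) (Q : pred I) (F : I -> R -> R) s t :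
  (forall k, Q k -> abs_cont_on s t (F k)) -> abs_cont_on s t (fun y => \sum_(k <- r | Q k) F k y).
Proof.
move=> h; elim: r => [|k r IH].
  rewrite (_ : (fun y => _) = cst 0); last by apply/funext => y; rewrite big_nil.
  by apply: (abs_cont_lipschitz (C := 0)) => ? ? _ _ _; rewrite subrr normr0 mul0r.
rewrite (_ : (fun y => _) = if Q k then (fun y => F k y + \sum_(k <- r | Q k) F k y) else
   (fun y => \sum_(k <- r | Q k) F k y)).
  by case: ifP => // /h hk; exact: abs_contD.
by apply/funext => y; rewrite big_cons; case: ifP.
Qed.

Lemma is_derive_sumr (I : Type) (r : seq I) (Q : pred I) (F : I -> R -> R) (dF : I -> R) (y : R) :
  (forall k, Q k -> is_derive y (1 : R) (F k) (dF k)) ->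
  is_derive y (1 : R) (fun y => \sum_(k <- r | Q k) F k y) (\sum_(k <- r | Q k) dF k).
Proof.
move=> h; elim: r => [|k r IH].
  rewrite (_ : (fun y => _) = cst 0); last by apply/funext => z; rewrite big_nil.
  by rewrite big_nil; exact: is_derive_cst.
rewrite (_ : (fun y => _) = if Q k then (fun y => F k y + \sum_(k <- r | Q k) F k y) else
   (fun y => \sum_(k <- r | Q k) F k y)).
  by rewrite big_cons; case: ifP => // /h hk; exact: is_deriveD.
by apply/funext => z; rewrite big_cons; case: ifP.
Qed.

Lemma integrable_scale (D : set R) (c : R) (f : R -> R) : measurable D ->
  mu.-integrable D (EFin \o f) -> mu.-integrable D (EFin \o (fun y => c * f y)).
Proof.
move=> mD h; have : mu.-integrable D (fun y => c%:E * (f y)%:E)%E by apply: integrableZl.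
exact.
Qed.

Lemma integrable_add (D : set R) (f g : R -> R) : measurable D ->
  mu.-integrable D (EFin \o f) -> mu.-integrable D (EFin \o g) ->
  mu.-integrable D (EFin \o (fun y => f y + g y)).
Proof.
move=> mD h1 h2; have : mu.-integrable D (fun y => (f y)%:E + (g y)%:E)%E by apply: integrableD.
exact.
Qed.

Lemma eq_integrable_in (D : set R) (f g : R -> R) : measurable D -> (forall y, D y -> f y = g y) ->
  mu.-integrable D (EFin \o f) -> mu.-integrable D (EFin \o g).
Proof.
by move=> mD fg; apply: eq_integrable => // y; rewrite inE => /fg /= ->.
Qed.

Lemma eq_Rintegral_in (D : set R) (f g : R -> R) : (forall y, D y -> f y = g y) ->
  \int[mu]_(y in D) f y = \int[mu]_(y in D) g y.
Proof. by move=> fg; apply: eq_Rintegral => y; rewrite inE => /fg. Qed.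

Lemma Rintegral_sumr D (I : Type) (r : seq I) (Q : pred I) (F : I -> R -> R) : measurable D ->
  (forall k, Q k -> mu.-integrable D (EFin \o F k)) ->
  mu.-integrable D (EFin \o (fun y => \sum_(k <- r | Q k) F k y)) /\
  \int[mu]_(y in D) (\sum_(k <- r | Q k) F k y) = \sum_(k <- r | Q k) \int[mu]_(y in D) F k y.
Proof.
move=> mD h; elim: r => [|k r [IH1 IH2]].
  rewrite (_ : (fun y => _) = cst 0); last by apply/funext => y; rewrite big_nil.
  by split; [exact: integrable0|rewrite big_nil; exact: Rintegral_zero].
rewrite (_ : (fun y => _) = if Q k then (fun y => F k y + \sum_(k <- r | Q k) F k y) else
   (fun y => \sum_(k <- r | Q k) F k y)).
  rewrite big_cons; case: ifP => [/h hk|_]; last by split.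
  by split; [exact: (integrableD mD hk IH1)|rewrite RintegralD// IH2].
by apply/funext => y; rewrite big_cons; case: ifP.
Qed.

Lemma L2r_integrableM D f g : measurable D -> L2r D f -> L2r D g ->
  mu.-integrable D (EFin \o (fun y => f y * g y)).
Proof.
move=> mD [mf f2] [mg g2].
have i2 h : L2r D h -> mu.-integrable D (EFin \o (fun y => h y ^+ 2)).
  move=> [mh h2]; apply/integrableP; split; first by apply/measurable_EFinP/measurable_funX.
  apply: le_lt_trans h2; rewrite le_eqVlt; apply/orP; left; apply/eqP; apply: eq_integral => y _.
  by rewrite /= ger0_norm// sqr_ge0.
have h : mu.-integrable D (fun y => (f y ^+ 2)%:E + (g y ^+ 2)%:E)%E.
  by apply: integrableD => //; apply: i2; split.
apply: le_integrable h => //=.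
  by apply/measurable_EFinP/measurable_funM.
move=> y _; rewrite lee_fin normrM [leRHS]ger0_norm ?addr_ge0 ?sqr_ge0//.
rewrite -(real_normK (num_real (f y))) -(real_normK (num_real (g y))).
by have := sqr_ge0 (`|f y| - `|g y|); have := normr_ge0 (f y); have := normr_ge0 (g y); nra.
Qed.

Variable x : R.
Hypothesis x_gt0 : 0 < x.
Notation al := (@alpha R nE nI a x).

Lemma alpha_expR k y : al k y = expR (x * ksg R k * kpt a k) * expR (- x * ksg R k * y).
Proof. by rewrite /alpha -expRD; congr expR; ring. Qed.

Lemma abs_cont_alpha k s t : s <= t -> abs_cont_on s t (al k).
Proof.
move=> st; rewrite (_ : al k = fun y => expR (x * ksg R k * kpt a k) * expR (- x * ksg R k * y)).
  by apply: abs_contZ => //; exact: abs_cont_expR.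
by apply/funext => y; exact: alpha_expR.
Qed.

Lemma is_derive_alpha k y : is_derive y (1 : R) (al k) (- x * ksg R k * al k y).
Proof.
have := is_deriveZ (expR (x * ksg R k * kpt a k)) (is_derive_expRM (- x * ksg R k) y).
rewrite (_ : _ \*: _ = al k); last by apply/funext => z; rewrite alpha_expR.
by congr is_derive; rewrite alpha_expR /GRing.scale/=; ring.
Qed.

Lemma measurable_alpha k D : measurable_fun D (al k).
Proof.
apply: measurable_funTS; apply: measurable_realfun.continuous_measurable_fun => y.
by apply: differentiable_continuous; apply/derivable1_diffP; have [] := is_derive_alpha k y.
Qed.

Lemma L2r_alpha k : L2r (Iset a (kedge k)) (al k).
Proof.
have mI := measurable_Iset (kedge k).
split; first exact: measurable_alpha.
apply: le_lt_trans (_ : (_ <= \int[mu]_y (expR (- (2 * x) * `|kpt a k - y|))%:E)%E) _; last first.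
  by apply: le_lt_trans (integral_exp_abs _ _) _; rewrite ?ltry// mulr_gt0.
apply: le_trans (_ : (_ <= \int[mu]_(y in Iset a (kedge k)) (expR (- (2 * x) * `|kpt a k - y|))%:E)%E) _.
  rewrite le_eqVlt; apply/orP; left; apply/eqP; apply: eq_integral => y; rewrite inE => hy.
  by rewrite alpha_dist// expr2 -expRD; congr (expR _)%:E; ring.
apply: ge0_subset_integral => //.
by apply/measurable_EFinP; exact: measurable_exp_abs.
Qed.

Variable P : 'M[R]_K.
Let S := P - 1%:M.
Let T := @Tmx R nE nI a x.
Let W := Wmx a x P.
(** The matching matrix enters only through these two properties: the first gives the boundary
    conditions of the solution, the second its uniqueness. *)
Hypothesis WE : forall U : 'cV[R]_K, W *m U = U + T *m (S *m (W *m U)).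
Hypothesis matchU : forall w : 'cV[R]_K, w = T *m (S *m w) -> w = 0.

Section Solution.
Variable phi : edge -> R -> R.
Hypothesis phi_L2 : forall j, L2r (Iset a j) (phi j).

Let f j := (phi j) \_ (Iset a j).

Let mf j : measurable_fun setT (f j).
Proof. have [h _] := phi_L2 j; apply/(measurable_restrictT _ _).1 => //; exact: measurable_Iset. Qed.

Let f2 j : (\int[mu]_y ((f j y) ^+ 2)%:E < +oo)%E.
Proof.
have [_] := phi_L2 j; rewrite integral_mkcond; apply: le_lt_trans.
rewrite le_eqVlt; apply/orP; left; apply/eqP; apply: eq_integral => y _.
by rewrite /f !patchE; case: ifP => // _; rewrite expr0n.
Qed.

Let f_neg j y : y < 0 -> f j y = 0.
Proof.
move=> y0; rewrite /f patchE memNset// => /Iset_ge0.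
by rewrite leNgt y0.
Qed.

Let u j := line_res x (f j).
Let u1 j := line_res1 x (f j).
(** [U] holds the amplitudes reaching the endpoints directly from the sources, [c] those sent back
    into the edges after all scatterings. *)
Let U : 'cV[R]_K := \col_k u (kedge k) (kpt a k).
Let c : 'cV[R]_K := S *m (W *m U).

Definition sol j y := u j y + \sum_(k | kedge k == j) al k y * c k 0.
Definition sol1 j y := u1 j y + \sum_(k | kedge k == j) - x * ksg R k * al k y * c k 0.

Lemma abs_cont_sol j b : 0 <= b -> abs_cont_on 0 b (sol j).
Proof.
move=> b0; apply: abs_contD; first exact: (abs_cont_line_res x_gt0 (mf j) (f2 j) (@f_neg j)).
apply: abs_cont_sum => k _.
rewrite (_ : (fun y => _) = fun y => c k 0 * al k y); last by apply/funext => y; rewrite mulrC.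
by apply: abs_contZ => //; exact: abs_cont_alpha.
Qed.

Lemma abs_cont_sol1 j b : 0 <= b -> abs_cont_on 0 b (sol1 j).
Proof.
move=> b0; apply: abs_contD; first exact: (abs_cont_line_res1 x_gt0 (mf j) (f2 j) (@f_neg j)).
apply: abs_cont_sum => k _.
rewrite (_ : (fun y => _) = fun y => (- x * ksg R k * c k 0) * al k y); last first.
  by apply/funext => y; ring.
by apply: abs_contZ => //; exact: abs_cont_alpha.
Qed.

Lemma is_derive_sol j (y : R) : 0 < y -> is_derive y (1 : R) (sol j) (sol1 j y).
Proof.
move=> y0; apply: is_deriveD; first exact: (derive_line_res x_gt0 (mf j) (f2 j) (@f_neg j)).
apply: is_derive_sumr => k _.
have := is_deriveZ (c k 0) (is_derive_alpha k y).
rewrite (_ : _ \*: _ = fun y => al k y * c k 0); last by apply/funext => z; rewrite mulrC.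
by congr is_derive; rewrite /GRing.scale/=; ring.
Qed.

Lemma ae_is_derive_sol1 j :
  {ae mu, forall y : R, is_derive y (1 : R) (sol1 j) (x ^+ 2 * sol j y - f j y)}.
Proof.
apply: ae_mono (ae_derive_line_res1 x_gt0 (mf j) (f2 j) (@f_neg j)) => y d1.
have d2 : is_derive y (1 : R) (fun y => \sum_(k | kedge k == j) - x * ksg R k * al k y * c k 0)
    (\sum_(k | kedge k == j) x ^+ 2 * (al k y * c k 0)).
  apply: is_derive_sumr => k _.
  have := is_deriveZ (- x * ksg R k * c k 0) (is_derive_alpha k y).
  rewrite (_ : _ \*: _ = fun y => - x * ksg R k * al k y * c k 0); last first.
    by apply/funext => z; rewrite -[LHS]/(- x * ksg R k * c k 0 * al k z); ring.
  congr is_derive; rewrite /GRing.scale/=.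
  rewrite (_ : - x * ksg R k * c k 0 * (- x * ksg R k * al k y) = (ksg R k ^+ 2) * (x ^+ 2 * (al k y * c k 0))); last by ring.
  by rewrite /ksg; case: ifP; rewrite ?sqrrN expr1n mul1r.
have := is_deriveD d1 d2; congr is_derive.
by rewrite -mulr_sumr /sol -/(u j) mulrDr addrAC.
Qed.

Lemma measurable_abs_cont_Iset (j : edge) g : (forall b, 0 <= b -> abs_cont_on 0 b g) ->
  measurable_fun (Iset a j) g.
Proof.
move=> acg; rewrite IsetE; case: j => i; first exact: abs_cont_measurable_ray.
by apply: abs_cont_measurable; apply: acg; exact: ltW.
Qed.

Lemma L2r_sol j : L2r (Iset a j) (sol j).
Proof.
have mI := measurable_Iset j.
apply: L2rD => //.
  apply: L2rZ => //.
  have me : measurable_fun (Iset a j) (exp_conv x (f j)).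
    rewrite (_ : exp_conv x (f j) = fun y => 2 * x * u j y); last first.
      by apply/funext => y; rewrite /u /line_res; field; rewrite gt_eqF.
    apply: measurable_funM => //; apply: measurable_abs_cont_Iset => b b0.
    exact: (abs_cont_line_res x_gt0 (mf j) (f2 j) (@f_neg j)).
  by split => //; exact: exp_conv_L2.
apply: L2r_sum => // k /eqP <-.
rewrite (_ : (fun y => _) = fun y => c k 0 * al k y); last by apply/funext => y; rewrite mulrC.
by apply: L2rZ; [exact: measurable_Iset|exact: L2r_alpha].
Qed.

(** With [w = W U] the total incoming amplitude, the value at an endpoint is [b = w + c] and the
    inward derivative is [b' = x (w - c)]. Hence [x b + b' = 2 x w], and [c = S w] amounts to
    [b = P w]. *)
Lemma sol_bc k :
  2 * x * sol (kedge k) (kpt a k) =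
  \sum_l P k l * (x * sol (kedge l) (kpt a l) + ksg R l * sol1 (kedge l) (kpt a l)).
Proof.
pose w := W *m U.
have UE l : U l 0 = u (kedge l) (kpt a l) by rewrite mxE.
have wE l : w l 0 = U l 0 + transmission a x l * c (star l) 0.
  by have := WE U; rewrite -/w -/c => /matrixP/(_ l 0) ->; rewrite mxE TmxE.
have bE l : sol (kedge l) (kpt a l) = w l 0 + c l 0.
  by rewrite /sol sum_alpha_kpt wE UE; ring.
have b1E l : ksg R l * sol1 (kedge l) (kpt a l) = x * (w l 0 - c l 0).
  rewrite /sol1 mulrDr sum_dalpha_kpt.
  have -> : ksg R l * u1 (kedge l) (kpt a l) = x * U l 0.
    rewrite UE /u /u1; elim/endpoint_ind: l => i; rewrite /ksg !endpE.
    - by rewrite mul1r (line_res1_0 x_gt0 (mf _) (f2 _) (@f_neg _)).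
    - by rewrite mul1r (line_res1_0 x_gt0 (mf _) (f2 _) (@f_neg _)).
    - rewrite (line_res1_end x_gt0 (mf _) (f2 _) (@f_neg _)); first by ring.
      move=> y ay; rewrite /f patchE memNset// => /= -[_].
      by rewrite leNgt ay.
  by rewrite wE; ring.
under eq_bigr do rewrite b1E bE.
have -> : \sum_l P k l * (x * (w l 0 + c l 0) + x * (w l 0 - c l 0)) = 2 * x * (P *m w) k 0.
  by rewrite mxE mulr_sumr; apply: eq_bigr => l _; ring.
have cE : c k 0 = (P *m w) k 0 - w k 0.
  by rewrite /c -/w /S mulmxBl mul1mx [LHS]mxE [X in _ + X]mxE.
by rewrite bE cE; ring.
Qed.

Definition green j j' y z := (2 * x)^-1 * greenK a x P j j' y z.

Let d j y l := \sum_k (edgev al j y) k 0 * (S *m W) k l.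

Let greenE j j' y z : Iset a j' z -> green j j' y z * phi j' z =
   (if j == j' then (2 * x)^-1 * (expR (- x * `|y - z|) * phi j' z) else 0) +
   \sum_(l | kedge l == j') (2 * x)^-1 * d j y l * (al l z * phi j' z).
Proof.
move=> hz; rewrite /green /greenK mulrDr mulrDl; congr (_ + _).
  by case: ifP => _; rewrite ?mulr0 ?mul0r// mulrA.
rewrite exchange_big/= mulr_sumr mulr_suml [RHS]big_mkcond; apply: eq_bigr => l _.
rewrite /d -mulr_suml [X in _ * (_ * X)]mxE; case: ifP => _; rewrite ?mulr0 ?mul0r//.
by ring.
Qed.

Let intM l : mu.-integrable (Iset a (kedge l)) (EFin \o (fun z => al l z * phi (kedge l) z)).
Proof. by apply: L2r_integrableM; [exact: measurable_Iset|exact: L2r_alpha|exact: phi_L2]. Qed.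

Let conv_restr j y : (fun z => expR (- x * `|y - z|) * f j z) =
  (fun z => expR (- x * `|y - z|) * phi j z) \_ (Iset a j).
Proof. by apply/funext => z; rewrite /f !patchE; case: ifP => // _; rewrite mulr0. Qed.

Let intE j y : mu.-integrable (Iset a j) (EFin \o (fun z => expR (- x * `|y - z|) * phi j z)).
Proof.
apply/integrable_mkcond; first exact: measurable_Iset.
rewrite restrict_EFin -conv_restr; exact: (integrable_expM x_gt0 (mf j) (f2 j) y).
Qed.

Lemma green_integral j j' y :
  mu.-integrable (Iset a j') (EFin \o (fun z => green j j' y z * phi j' z)) /\
  \int[mu]_(z in Iset a j') (green j j' y z * phi j' z) =
    (if j == j' then u j' y else 0) + \sum_(l | kedge l == j') d j y l * U l 0.
Proof.
have mI := measurable_Iset j'.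
pose g1 z := if j == j' then (2 * x)^-1 * (expR (- x * `|y - z|) * phi j' z) else 0.
have i1 : mu.-integrable (Iset a j') (EFin \o g1).
  rewrite /g1; case: (j == j'); last exact: integrable0.
  by apply: integrable_scale => //; exact: intE.
have i2 l : kedge l == j' ->
    mu.-integrable (Iset a j') (EFin \o (fun z => (2 * x)^-1 * d j y l * (al l z * phi j' z))).
  by move=> /eqP <-; apply: integrable_scale; [exact: measurable_Iset|exact: intM].
have [i3 e3] := Rintegral_sumr (index_enum _) mI i2.
split.
  by apply: eq_integrable_in (integrable_add mI i1 i3) => // z hz; rewrite greenE.
rewrite (eq_Rintegral_in (g := fun z => g1 z +
    \sum_(l | kedge l == j') (2 * x)^-1 * d j y l * (al l z * phi j' z))); last exact: greenE.
rewrite RintegralD// e3; congr (_ + _).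
  rewrite /g1; case: (j == j'); last exact: Rintegral_zero.
  rewrite RintegralZl//; congr (_ * _); rewrite /exp_conv conv_restr.
  by rewrite Rintegral_mkcond.
apply: eq_bigr => l /eqP lj; rewrite -lj RintegralZl//; last exact: measurable_Iset.
(* On its edge [alpha l] is the exponential of the distance to the endpoint, so this integral is the
   line resolvent there. *)
have -> : U l 0 = (2 * x)^-1 * \int[mu]_(z in Iset a (kedge l)) (al l z * phi (kedge l) z).
  rewrite mxE; congr (_ * _).
  rewrite (eq_Rintegral_in (g := fun z => expR (- x * `|kpt a l - z|) * phi (kedge l) z)).
    by rewrite /exp_conv conv_restr [RHS]Rintegral_mkcond.
  by move=> z hz; rewrite alpha_dist.
by rewrite mulrCA mulrA.
Qed.

Lemma green_sol j y :
  \sum_j' \int[mu]_(z in Iset a j') (green j j' y z * phi j' z) = sol j y.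
Proof.
under eq_bigr do rewrite (green_integral _ _ _).2.
rewrite big_split/= -big_mkcond/= (big_pred1 j) => [|i]; last by rewrite /= eq_sym.
rewrite /sol; congr (_ + _).
under eq_bigr do rewrite big_mkcond.
rewrite exchange_big/=.
have H l : \sum_i (if kedge l == i then d j y l * U l 0 else 0) = d j y l * U l 0.
  by rewrite -big_mkcond/= (big_pred1 (kedge l)) => [|i]; rewrite //= eq_sym.
under eq_bigr do rewrite H.
rewrite /c mulmxA [RHS]big_mkcond /d.
under eq_bigr do rewrite mulr_suml.
rewrite exchange_big/=; apply: eq_bigr => k _.
under eq_bigr do rewrite mxE -mulrA.
case: eqP => _; last by rewrite big1// => l _; rewrite mul0r.
by rewrite -mulr_sumr [in RHS]mxE.
Qed.

End Solution.

Lemma cvg_sumr (B : topologicalType) (I : Type) (r : seq I) (F : I -> B -> R) (p : B) :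
  (forall k, F k q @[q --> p] --> F k p) ->
  \sum_(k <- r) F k q @[q --> p] --> \sum_(k <- r) F k p.
Proof.
move=> h; elim: r => [|k r IH].
  by under eq_fun do rewrite big_nil; rewrite big_nil; exact: cvg_cst.
by under eq_fun do rewrite big_cons; rewrite big_cons; exact: cvgD.
Qed.

Lemma continuous_green j j' : continuous (fun p : R * R => green j j' p.1 p.2).
Proof.
move=> p; apply: cvgM; first exact: cvg_cst.
have cfst : (fun p : R * R => p.1) @ p --> p.1 by exact: cvg_fst.
have csnd : (fun p : R * R => p.2) @ p --> p.2 by exact: cvg_snd.
have cal (i : edge) k (g : R * R -> R) : g q @[q --> p] --> g p ->
    (edgev al i (g q)) k 0 @[q --> p] --> (edgev al i (g p)) k 0.
  move=> cg; under eq_fun do rewrite mxE; rewrite mxE.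
  case: ifP => _; last exact: cvg_cst.
  apply: (cvg_comp _ _ cg); apply: differentiable_continuous.
  by apply/derivable1_diffP; have [] := is_derive_alpha k (g p).
apply: cvgD.
  case: ifP => _; last exact: cvg_cst.
  apply: continuous_cvg; first exact: continuous_expR.
  apply: cvgM; first exact: cvg_cst.
  by apply: cvg_norm; exact: cvgB.
apply: cvg_sumr => k; apply: cvg_sumr => l.
apply: cvgM; last exact: cal.
by apply: cvgM; [exact: cal|exact: cvg_cst].
Qed.

Lemma homogeneous_unique (v v1 : edge -> R -> R) :
  (forall j b, Iset a j b -> abs_cont_on 0 b (v j) /\ abs_cont_on 0 b (v1 j)) ->
  (forall j (y : R), Iint a j y -> is_derive y (1 : R) (v j) (v1 j y)) ->
  (forall j, {ae mu, forall y : R, Iint a j y -> is_derive y (1 : R) (v1 j) (x ^+ 2 * v j y)}) ->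
  (forall j, L2r (Iset a j) (v j)) ->
  (forall k, 2 * x * v (kedge k) (kpt a k) =
     \sum_l P k l * (x * v (kedge l) (kpt a l) + ksg R l * v1 (kedge l) (kpt a l))) ->
  forall j y, Iset a j y -> v j y = 0.
Proof.
move=> ac dv dv1 v2 bc.
pose p j y := v1 j y + x * v j y; pose q j y := v1 j y - x * v j y.
have pE j y : Iset a j y -> p j y = p j 0 * expR (x * y).
  move=> hy; have [ac1 ac2] := ac j y hy; have y0 := Iset_ge0 hy.
  rewrite -{2}(subr0 y); apply: (@abs_cont_exp_ode _ (p j) 0 y) => //.
    by apply: abs_contD => //; exact: abs_contZ.
  apply: ae_mono (dv1 j) => z hz /andP[z0 zy]; have hi := Iint_lt hy z0 zy.
  have := is_deriveD (hz hi) (is_deriveZ x (dv j z hi)).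
  by congr is_derive; rewrite /p /GRing.scale/=; ring.
have qE j y : Iset a j y -> q j y = q j 0 * expR (- x * y).
  move=> hy; have [ac1 ac2] := ac j y hy; have y0 := Iset_ge0 hy.
  rewrite -{2}(subr0 y); apply: (@abs_cont_exp_ode _ (q j) 0 y) => //.
    by apply: abs_contB => //; exact: abs_contZ.
  apply: ae_mono (dv1 j) => z hz /andP[z0 zy]; have hi := Iint_lt hy z0 zy.
  have := is_deriveB (hz hi) (is_deriveZ x (dv j z hi)).
  by congr is_derive; rewrite /q /GRing.scale/=; ring.
(* On an external edge [p] grows exponentially unless it vanishes, but [v] is
   square integrable and [q] decays. *)
have p0 e : p (inl e) 0 = 0.
  have mI := measurable_Iset (inl e).
  have L1 : L2r (Iset a (inl e : edge)) (fun y => 2 * x * v (inl e) y + q (inl e) 0 * al (kE nI e) y).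
    apply: L2rD => //; first exact: L2rZ.
    by apply: L2rZ => //; have := L2r_alpha (kE nI e); rewrite endpE.
  have [_] : L2r (Iset a (inl e : edge)) (cst (p (inl e) 0)).
    apply: (L2r_le mI _ L1); first exact: measurable_cst.
    move=> y hy /=; have -> : 2 * x * v (inl e) y + q (inl e) 0 * al (kE nI e) y = p (inl e) 0 * expR (x * y).
      by rewrite alphaE -(qE (inl e) y hy) -(pE (inl e) y hy) /p /q; ring.
    rewrite exprMn ler_peMr ?sqr_ge0// expr_ge1 ?expR_ge0//.
    by rewrite -[leLHS]expR0 ler_expR mulr_ge0// ltW.
  have -> : (\int[mu]_(y in Iset a (inl e : edge)) (cst (p (inl e) 0) y ^+ 2)%:E =
      (p (inl e) 0 ^+ 2)%:E * mu (Iset a (inl e : edge)))%E by rewrite -[RHS]integral_cst.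
  rewrite IsetE lebesgue_measure_itv/=.
  have [->//|h] := eqVneq (p (inl e) 0) 0.
  by rewrite ltry/= ?addye// gt0_muley ?ltxx// lte_fin exprn_even_gt0.
pose b : 'cV[R]_K := \col_k v (kedge k) (kpt a k).
(* [w] is the incoming and [b - w] the outgoing amplitude. At a left end they are [p / (2 x)] and
   [- q / (2 x)], at a right end the other way round. *)
pose w : 'cV[R]_K := \col_k ((x * v (kedge k) (kpt a k) + ksg R k * v1 (kedge k) (kpt a k)) / (2 * x)).
have x2 : 2 * x != 0 by rewrite gt_eqF// mulr_gt0.
have bw : b = P *m w.
  apply/matrixP => k c; rewrite ord1 !mxE; apply: (mulfI x2); rewrite bc mulr_sumr.
  by apply: eq_bigr => l _; rewrite mxE; field; exact: lt0r_neq0.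
(* Each of the two exponentials loses the factor [expR (- x * a i)] in crossing its edge; on
   external edges [w] vanishes by [p0]. *)
have wc : w = T *m (b - w).
  apply/matrixP => k c; rewrite ord1 TmxE !mxE /transmission kedge_star.
  have Iz (j : edge) : Iset a j 0 by case: j => i //=; split => //; exact: ltW.
  elim/endpoint_ind: k => i; rewrite /ksg !endpE.
  - rewrite mul0r mul1r addrC; have := p0 i; rewrite /p => ->; exact: mul0r.
  - have := pE (inr i) (a i); have := qE (inr i) (a i).
    rewrite /p /q => _ /(_ (conj (ltW (a_gt0 i)) (lexx _))) h.
    have e : expR (- x * a i) * expR (x * a i) = 1 by rewrite -expRD mulNr addNr expR0.
    have h2 : expR (- x * a i) * (v1 (inr i) (a i) + x * v (inr i) (a i)) = v1 (inr i) 0 + x * v (inr i) 0.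
      by rewrite h mulrCA e mulr1.
    rewrite mul1r [X in X / _]addrC -h2; field; exact: lt0r_neq0.
  - have := qE (inr i) (a i); rewrite /q => /(_ (conj (ltW (a_gt0 i)) (lexx _))) h.
    have h2 : x * v (inr i) (a i) - v1 (inr i) (a i) = expR (- x * a i) * (x * v (inr i) 0 - v1 (inr i) 0).
      by rewrite -[LHS]opprB h; ring.
    rewrite mulN1r h2; field; exact: lt0r_neq0.
have w0 : w = 0.
  by apply: matchU; rewrite {1}wc bw mulmxBl mul1mx.
have b0 : b = 0 by rewrite bw w0 mulmx0.
move=> j y hy.
have [k kj k0] : exists2 k, kedge k = j & kpt a k = 0.
  by case: j {hy} => i; [exists (kE nI i)|exists (kM nE i)]; rewrite !endpE.
have bk : v j 0 = 0 by move/matrixP: b0 => /(_ k 0); rewrite !mxE kj k0.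
have wk : ksg R k * v1 j 0 = 0.
  move/matrixP: w0 => /(_ k 0); rewrite !mxE kj k0 bk mulr0 add0r => /eqP.
  by rewrite mulf_eq0 invr_eq0 (negPf x2) orbF => /eqP.
have {}wk : v1 j 0 = 0.
  by move: wk; rewrite /ksg; case: ifP => _; rewrite ?mulN1r ?mul1r// => /eqP; rewrite oppr_eq0 => /eqP.
have := pE j y hy; have := qE j y hy; rewrite /p /q bk wk !mulr0 subrr addr0 !mul0r => h1 h2.
by apply: (mulfI x2); rewrite mulr0; lra.
Qed.

End GraphODE.

(** * Reduction to real-valued functions *)

Section Parts.
Variable R : realType.

(* [part true] is the real part and [part false] the imaginary part. *)
Definition part (b : bool) (z : R[i]) : R := if b then complex.Re z else complex.Im z.

Lemma part_ext (z w : R[i]) : (forall b, part b z = part b w) -> z = w.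
Proof. by case: z w => [z1 z2] [w1 w2] h; have /= -> := h true; have /= -> := h false. Qed.

Lemma partD b (z w : R[i]) : part b (z + w) = part b z + part b w.
Proof. by case: b z w => -[? ?] [? ?]. Qed.

Lemma partB b (z w : R[i]) : part b (z - w) = part b z - part b w.
Proof. by case: b z w => -[? ?] [? ?]. Qed.

Lemma part_scale b (c : R) (z : R[i]) : part b (c%:C%C * z) = c * part b z.
Proof. by case: b z => -[u v] /=; rewrite mul0r ?subr0 ?addr0. Qed.

Lemma part_sum b (I : Type) (r : seq I) (Q : pred I) (F : I -> R[i]) :
  part b (\sum_(k <- r | Q k) F k) = \sum_(k <- r | Q k) part b (F k).
Proof. by apply: (big_morph (part b) (partD b)); case: b. Qed.

Lemma part_cintegral b (D : set R) (h : R -> R[i]) :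
  part b (cintegral D h) = \int[@lebesgue_measure R]_(y in D) part b (h y).
Proof. by case: b. Qed.

Lemma L2_on_part (D : set R) (h : R -> R[i]) : measurable D ->
  L2_on D h <-> forall b, L2r D (fun y => part b (h y)).
Proof.
move=> mD; split.
  move=> [m1 [m2 h2]] b; split; first by case: b.
  apply: le_lt_trans h2; apply: ge0_le_integral => //.
  - by move=> y _; rewrite lee_fin sqr_ge0.
  - by apply/measurable_EFinP/measurable_funX; case: b.
  - by apply/measurable_EFinP/measurable_funD; exact: measurable_funX.
  - by move=> y _; rewrite lee_fin; case: b; rewrite /= ?lerDl ?lerDr sqr_ge0.
move=> H; have [m1 h1] := H true; have [m2 h2] := H false; split => //; split => //.
under eq_integral do rewrite EFinD.
rewrite ge0_integralD//.
- exact: lte_add_pinfty.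
- by move=> y _; rewrite lee_fin sqr_ge0.
- by apply/measurable_EFinP; exact: measurable_funX.
- by move=> y _; rewrite lee_fin sqr_ge0.
- by apply/measurable_EFinP; exact: measurable_funX.
Qed.

End Parts.

(** * Existence and uniqueness of the Green function *)

Section GreenKernel.
Variables (R : realType) (nE nI : nat) (a : 'I_nI -> R).
Hypothesis a_gt0 : forall i, 0 < a i.
Notation K := (Kdim nE nI).
Notation edge := (edge nE nI).
Notation mu := (@lebesgue_measure R).
Variables (A B : 'M[R[i]]_K) (x : R) (P : 'M[R]_K).
Hypothesis x_gt0 : 0 < x.
Let S := P - 1%:M.
Let T := @Tmx R nE nI a x.
Let W := Wmx a x P.
Hypothesis WE : forall U : 'cV[R]_K, W *m U = U + T *m (S *m (W *m U)).
Hypothesis matchU : forall w : 'cV[R]_K, w = T *m (S *m w) -> w = 0.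
Hypothesis bcE : forall c1 c2, in_M A B c1 c2 <->
  (2 * x)%:C%C *: c1 = map_mx (real_complex R) P *m ((x%:C)%C *: c1 + c2).

Lemma bvalE (psi : edge -> R -> R[i]) k : bval a psi k 0 = psi (kedge k) (kpt a k).
Proof. by rewrite mxE; elim/endpoint_ind: k => i; rewrite !splitE !endpE. Qed.

Lemma bderE (psi1 : edge -> R -> R[i]) k :
  bder a psi1 k 0 = (ksg R k)%:C%C * psi1 (kedge k) (kpt a k).
Proof.
by rewrite mxE /ksg; elim/endpoint_ind: k => i; rewrite !splitE !endpE ?rmorphN rmorph1 ?mulN1r ?mul1r.
Qed.

Definition bc_real (v v1 : edge -> R -> R) : Prop := forall k,
  2 * x * v (kedge k) (kpt a k) =
  \sum_l P k l * (x * v (kedge l) (kpt a l) + ksg R l * v1 (kedge l) (kpt a l)).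

(** Since [P] is real, both parts satisfy the same boundary condition separately. *)
Lemma in_M_part (psi psi1 : edge -> R -> R[i]) :
  in_M A B (bval a psi) (bder a psi1) <->
  forall b, bc_real (fun j y => part b (psi j y)) (fun j y => part b (psi1 j y)).
Proof.
have E b k : part b ((map_mx (real_complex R) P *m ((x%:C)%C *: bval a psi + bder a psi1)) k 0) =
    \sum_l P k l * (x * part b (psi (kedge l) (kpt a l)) + ksg R l * part b (psi1 (kedge l) (kpt a l))).
  rewrite mxE part_sum; apply: eq_bigr => l _.
  rewrite [map_mx _ _ _ _]mxE part_scale [X in part b X]mxE partD [X in part b X + _]mxE.
  by rewrite bvalE bderE !part_scale.
have E2 b k : part b (((2 * x)%:C%C *: bval a psi) k 0) = 2 * x * part b (psi (kedge k) (kpt a k)).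
  by rewrite mxE part_scale bvalE.
rewrite bcE; split; first by move=> h b k; rewrite -E -h E2.
by move=> h; apply/matrixP => k c; rewrite ord1; apply: part_ext => b; rewrite E2 E h.
Qed.

(** What the explicit solution shares with the image of any Green kernel, for one part at a time;
    uniqueness is proved at this level. *)
Definition weak_sol (f v v1 : edge -> R -> R) : Prop :=
  [/\ forall j b, Iset a j b -> abs_cont_on 0 b (v j) /\ abs_cont_on 0 b (v1 j),
      forall j (y : R), Iint a j y -> is_derive y (1 : R) (v j) (v1 j y),
      forall j, {ae mu, forall y : R, Iint a j y -> is_derive y (1 : R) (v1 j) (x ^+ 2 * v j y - f j y)},
      forall j, L2r (Iset a j) (v j) &
      bc_real v v1].

Lemma weak_sol_unique f v v1 w w1 : weak_sol f v v1 -> weak_sol f w w1 ->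
  forall j y, Iset a j y -> v j y = w j y.
Proof.
move=> [v_1 v_2 v_3 v_4 v_5] [w_1 w_2 w_3 w_4 w_5] j y hy.
apply/eqP; rewrite -subr_eq0; apply/eqP.
apply: (@homogeneous_unique R nE nI a a_gt0 x x_gt0 P matchU
  (fun j y => v j y - w j y) (fun j y => v1 j y - w1 j y)) => //.
- move=> j0 b hb; have [? ?] := v_1 _ _ hb; have [? ?] := w_1 _ _ hb.
  by split; exact: abs_contB.
- by move=> j0 z hz; apply: is_deriveB; [exact: v_2|exact: w_2].
- move=> j0; apply: ae_mono2 (v_3 j0) (w_3 j0) => z h1 h2 hz.
  by have := is_deriveB (h1 hz) (h2 hz); congr is_derive; ring.
- by move=> j0; apply: L2rB => //; exact: measurable_Iset.
- move=> k; rewrite mulrBr v_5 w_5 -sumrB; apply: eq_bigr => l _; ring.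
Qed.

Lemma Iint_Iset (j : edge) y : Iint a j y -> Iset a j y.
Proof. by case: j => i /= => [/ltW//|[/ltW ? /ltW ?]]. Qed.

Lemma sol_weak_sol (phi : edge -> R -> R) : (forall j, L2r (Iset a j) (phi j)) ->
  weak_sol phi (sol a x P phi) (sol1 a x P phi).
Proof.
move=> hphi; split.
- by move=> j b /Iset_ge0 b0; split; [exact: abs_cont_sol|exact: abs_cont_sol1].
- by move=> j y hy; apply: is_derive_sol => //; case: j hy => i //= [].
- move=> j; apply: ae_mono (ae_is_derive_sol1 x_gt0 P hphi j) => y h hy.
  by move: h; rewrite patchE mem_set//; exact: Iint_Iset.
- by move=> j; exact: L2r_sol.
- by move=> k; apply: sol_bc.
Qed.

Lemma green_kernel_weak_sol r phi : green_kernel a A B x r -> in_H a phi ->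
  exists psi1, forall b, weak_sol (fun j y => part b (phi j y))
    (fun j y => part b (kernel_apply a r phi j y)) (fun j y => part b (psi1 j y)).
Proof.
move=> [_ /(_ phi)] h /h [_ [psi1 [psi2 [[dH dD] [bc ode]]]]].
exists psi1 => b; split.
- move=> j c hc; have [ac1 [ac2 _]] := dD j; have c0 := Iset_ge0 hc.
  case: j hc ac1 ac2 => i /=.
    by move=> _ /(_ _ c0)[? ?] /(_ _ c0)[? ?]; case: b.
  by move=> [_ ca] [? ?] [? ?]; case: b; split; apply: abs_cont_sub (lexx 0) ca _.
- by move=> j y hy; have [_ [_ [/(_ _ hy)[? ?] _]]] := dD j; case: b.
- move=> j; have [_ [_ [_ [ae2 _]]]] := dD j; apply: ae_mono2 ae2 (ode j) => y h1 h2 hy.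
  have <- : part b (psi2 j y) = x ^+ 2 * part b (kernel_apply a r phi j y) - part b (phi j y).
    by rewrite -part_scale -partB -(h2 (Iint_Iset hy)); congr part; ring.
  by have [? ?] := h1 hy; case: b.
- by move=> j; have := dH j => /(L2_on_part _ (measurable_Iset a j)); exact.
- by have /in_M_part := bc; exact.
Qed.

Definition rgreen : Defs.kernel nE nI R := fun j j' y z => (green a x P j j' y z)%:C%C.

Lemma in_H_part (phi : edge -> R -> R[i]) : in_H a phi -> forall b j, L2r (Iset a j) (fun y => part b (phi j y)).
Proof. by move=> h b j; have /(L2_on_part _ (measurable_Iset a j)) := h j; exact. Qed.

Lemma part_rgreen_apply phi b j y : in_H a phi ->
  part b (kernel_apply a rgreen phi j y) = sol a x P (fun j y => part b (phi j y)) j y.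
Proof.
move=> h; rewrite part_sum -(green_sol x_gt0 P (in_H_part h b)).
apply: eq_bigr => j' _; rewrite part_cintegral; apply: eq_Rintegral_in => z _.
by rewrite part_scale.
Qed.

Lemma rgreen_green_kernel : green_kernel a A B x rgreen.
Proof.
split.
  move=> j j'; split; apply: continuous_subspaceT.
    exact: continuous_green.
  by move=> p; exact: cvg_cst.
move=> phi hphi; split.
  move=> j j' y hy.
  have i b : mu.-integrable (Iset a j') (EFin \o (fun z => part b (rgreen j j' y z * phi j' z))).
    apply: eq_integrable_in (green_integral x_gt0 P (in_H_part hphi b) j j' y).1.
      exact: measurable_Iset.
    by move=> z _; rewrite part_scale.
  by split; [exact: (i true)|exact: (i false)].
pose ph b j y := part b (phi j y).
have ws b := sol_weak_sol (in_H_part hphi b).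
have pE b j : (fun y => part b (kernel_apply a rgreen phi j y)) = sol a x P (ph b) j.
  by apply/funext => y; rewrite part_rgreen_apply.
exists (fun j y => Complex (sol1 a x P (ph true) j y) (sol1 a x P (ph false) j y)).
(* The second derivative is defined by the equation, which then holds by construction; what has to
   be checked is that it is the derivative almost everywhere. *)
exists (fun j y => (x ^+ 2)%:C%C * kernel_apply a rgreen phi j y - phi j y).
have pE2 b j y : part b ((x ^+ 2)%:C%C * kernel_apply a rgreen phi j y - phi j y) =
   x ^+ 2 * sol a x P (ph b) j y - ph b j y.
  by rewrite partB part_scale part_rgreen_apply.
split.
  split.
    by move=> j; apply/(L2_on_part _ (measurable_Iset a j)) => b; rewrite pE; have [_ _ _ + _] := ws b; exact.
  move=> j.
  have acs b c : 0 <= c -> abs_cont_on 0 c (fun y => part b (kernel_apply a rgreen phi j y)).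
    by move=> c0; rewrite pE; apply: abs_cont_sol => //; exact: in_H_part.
  have acs1 b c : 0 <= c -> abs_cont_on 0 c (sol1 a x P (ph b) j).
    by move=> c0; apply: abs_cont_sol1 => //; exact: in_H_part.
  split.
    case: j acs {acs1} => i acs /=.
      by move=> c c0; split; [exact: (acs true)|exact: (acs false)].
    by split; [apply: (acs true)|apply: (acs false)]; exact: ltW.
  split.
    case: j acs1 {acs} => i acs1 /=.
      by move=> c c0; split; [exact: (acs1 true)|exact: (acs1 false)].
    by split; [apply: (acs1 true)|apply: (acs1 false)]; exact: ltW.
  split.
    move=> y hy; split => /=.
      by rewrite -/(part true _) (pE true); have [_ + _ _ _] := ws true; exact.
    by rewrite -/(part false _) (pE false); have [_ + _ _ _] := ws false; exact.
  split.
    have [_ _ /(_ j) w1 _ _] := ws true; have [_ _ /(_ j) w2 _ _] := ws false.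
    apply: ae_mono2 w1 w2 => y h1 h2 hy; split.
      by rewrite -[complex.Re (_ - _)]/(part true _) pE2; exact: h1.
    by rewrite -[complex.Im (_ - _)]/(part false _) pE2; exact: h2.
  apply/(L2_on_part _ (measurable_Iset a j)) => b.
  rewrite (_ : (fun y => _) = fun y => x ^+ 2 * sol a x P (ph b) j y - ph b j y); last first.
    by apply/funext => y; exact: pE2.
  have mI := measurable_Iset a j.
  by apply: L2rB => //; [apply: L2rZ => //; have [_ _ _ + _] := ws b; exact|exact: in_H_part].
split.
  apply/in_M_part => b.
  rewrite (_ : (fun j y => part b (kernel_apply a rgreen phi j y)) = sol a x P (ph b)); last first.
    by apply/funext => j; exact: pE.
  rewrite (_ : (fun j y => part b _) = sol1 a x P (ph b)); last by case: b.
  by have [_ _ _ _ +] := ws b; exact.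
by move=> j; apply: aeW => y _; ring.
Qed.

(** A test function needs an interval of positive length inside the edge even when [y] is an
    endpoint; it extends to the right of [y] unless [y] is the right end. *)
Lemma Iset_interval (j : edge) y d : Iset a j y -> 0 < d ->
  exists s t, s < t /\ forall z, s <= z -> z <= t -> Iset a j z /\ `|z - y| < d.
Proof.
case: j => i /= hy d0.
  exists y, (y + d / 2); split; first by lra.
  move=> z yz zy; split; first by lra.
  by rewrite ger0_norm; lra.
have ai := a_gt0 i; case: hy => y0 ya.
have [ya'|ay] := ltP y (a i).
  exists y, (Order.min (a i) (y + d / 2)); rewrite lt_min ya'/=; split; first by lra.
  move=> z yz; rewrite le_min => /andP[za zy]; split; first by split => //; lra.
  by rewrite ger0_norm; lra.
exists (Order.max 0 (a i - d / 2)), (a i); rewrite gt_max ai/=; split; first by lra.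
move=> z; rewrite ge_max => /andP[z0 zd] za; split => //.
by rewrite ltr_norml; apply/andP; split; lra.
Qed.

Lemma green_kernel_cvg r j j' y z b e : green_kernel a A B x r -> Iset a j y -> Iset a j' z ->
  0 < e -> exists2 d, 0 < d & forall z', Iset a j' z' -> `|z' - z| < d ->
    `|part b (r j j' y z') - part b (r j j' y z)| < e.
Proof.
move=> [cr _] hy hz e0.
have : {within [set p : R * R | Iset a j p.1 /\ Iset a j' p.2],
    continuous (fun p : R * R => part b (r j j' p.1 p.2))}.
  by have [c1 c2] := cr j j'; case: b.
move=> /subspace_continuousP/(_ (y, z) (conj hy hz))/cvgrPdist_lt/(_ _ e0).
rewrite /= /within/= => -[[N1 N2] [/= [d1 d10 h1] [d2 d20 h2]] H].
exists d2 => // z' hz' dz; rewrite distrC.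
apply: (H (y, z')) => //=; split => /=; first by apply: h1; exact: ballxx.
by apply: h2; rewrite /ball/= distrC.
Qed.

Lemma green_kernel_apply_unique r r' phi : green_kernel a A B x r -> green_kernel a A B x r' ->
  in_H a phi -> forall j y, Iset a j y -> kernel_apply a r phi j y = kernel_apply a r' phi j y.
Proof.
move=> hr hr' hphi j y hy; apply: part_ext => b.
have [p1 w1] := green_kernel_weak_sol hr hphi.
have [p2 w2] := green_kernel_weak_sol hr' hphi.
exact: (weak_sol_unique (w1 b) (w2 b)).
Qed.

Lemma indic_itv_L2 (D : set R) (s t : R) : measurable D -> s <= t ->
  L2r D (\1_(`[s, t]%classic : set R)).
Proof.
move=> mD st; split; first exact: measurable_indic.
apply: le_lt_trans (_ : (_ <= \int[mu]_y (\1_(`[s, t]%classic : set R) y)%:E)%E) _.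
  apply: le_trans (_ : (_ <= \int[mu]_(y in D) (\1_(`[s, t]%classic : set R) y)%:E)%E) _.
    rewrite le_eqVlt; apply/orP; left; apply/eqP; apply: eq_integral => y _.
    by rewrite indicE; case: (_ \in _); rewrite ?expr1n ?expr0n.
  apply: ge0_subset_integral => //.
  by apply/measurable_EFinP; exact: measurable_indic.
rewrite integral_indic// setIT [X in (X < _)%E]lebesgue_measure_itv/=.
by case: ifP => _; rewrite ?ltry// -EFinB ltry.
Qed.

(* Otherwise, by continuity, the two kernels differ when applied to the indicator
   function of a short interval near [z]. *)
Lemma green_kernel_part_le r r' j j' y z b : green_kernel a A B x r -> green_kernel a A B x r' ->
  Iset a j y -> Iset a j' z -> part b (r j j' y z) <= part b (r' j j' y z).
Proof.
move=> hr hr' hy hz; rewrite leNgt; apply/negP => lt.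
pose D := part b (r j j' y z) - part b (r' j j' y z).
have D0 : 0 < D by rewrite subr_gt0.
(* An oscillation below [D / 4] for each kernel leaves a gap of at least [D / 2] on the interval. *)
have e0 : 0 < D / 4 by rewrite divr_gt0.
have [d1 d10 H1] := green_kernel_cvg b hr hy hz e0.
have [d2 d20 H2] := green_kernel_cvg b hr' hy hz e0.
have d0 : 0 < Order.min d1 d2 by rewrite lt_min d10.
have [s [t [st Hst]]] := Iset_interval hz d0.
pose chi : R -> R := \1_(`[s, t]%classic : set R).
pose phi (j0 : edge) (y0 : R) : R[i] := if j0 == j' then (chi y0)%:C%C else 0.
have mI (j0 : edge) := measurable_Iset a j0; have mIj := mI j'.
have hphi : in_H a phi.
  move=> j0; apply/(L2_on_part _ (mI j0)) => c; rewrite /phi.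
  have z0 : L2r (Iset a j0) (fun=> 0).
    by split; [exact: measurable_cst|rewrite integral0_eq ?ltry// => ? _; rewrite expr0n].
  case: (j0 == j'); last by case: c.
  by case: c => //=; apply: indic_itv_L2 => //; exact: ltW.
have apE r0 : part b (kernel_apply a r0 phi j y) = \int[mu]_(w in Iset a j') (part b (r0 j j' y w) * chi w).
  rewrite part_sum (bigD1 j')//= [X in _ + X]big1 ?addr0 => [|i ij].
    rewrite part_cintegral; apply: eq_Rintegral_in => w _.
    by rewrite /phi eqxx mulrC part_scale mulrC.
  rewrite part_cintegral Rintegral_zero// => w _.
  by rewrite /phi (negPf ij) mulr0; case: (b).
have int r0 : green_kernel a A B x r0 ->
    mu.-integrable (Iset a j') (EFin \o (fun w => part b (r0 j j' y w) * chi w)).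
  move=> [_ /(_ _ hphi)[/(_ j j' y hy) [i1 i2] _]].
  apply: (eq_integrable_in (f := fun w => part b (r0 j j' y w * phi j' w))) => //.
    by move=> w _; rewrite /phi eqxx mulrC part_scale mulrC.
  by case: (b).
have := green_kernel_apply_unique hr hr' hphi hy.
move=> /(congr1 (part b)); rewrite !apE => E.
have mst : measurable (`[s, t]%classic : set R) by exact: measurable_itv.
have chi_int : mu.-integrable (Iset a j') (EFin \o chi).
  by apply: integrableS (integrable_indic_itv s t true false) => //; exact: mI.
have : \int[mu]_(w in Iset a j') (part b (r' j j' y w) * chi w + D / 2 * chi w) <=
    \int[mu]_(w in Iset a j') (part b (r j j' y w) * chi w).
  apply: le_Rintegral => //.
  - by apply: integrable_add => //; [exact: int|exact: integrable_scale].
  - exact: int.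
  - move=> w hw; rewrite -mulrDl /chi indicE.
    case: (boolP (w \in _)) => [|_]; last by rewrite !mulr0.
    rewrite inE/= in_itv/= !mulr1 => /andP[sw wt].
    have [_] := Hst w sw wt; rewrite lt_min => /andP[w1 w2].
    have := H1 w hw w1; have := H2 w hw w2; rewrite !ltr_norml => /andP[_ h2] /andP[h1 _].
    by move: h1 h2; rewrite /D; lra.
rewrite RintegralD//; [|exact: int|exact: integrable_scale].
rewrite E gerDl RintegralZl// leNgt => /negP; apply.
rewrite mulr_gt0 ?divr_gt0//.
have -> : \int[mu]_(w in Iset a j') chi w = t - s.
  rewrite /Rintegral /chi integral_indic// (_ : _ `&` _ = `[s, t]%classic); last first.
    apply/seteqP; split => w /=; first by case.
    move=> sw; split => //; move: sw; rewrite in_itv/= => /andP[sw wt].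
    by have [] := Hst w sw wt.
  by rewrite [X in fine X]lebesgue_measure_itv/= lte_fin st -EFinB.
by rewrite subr_gt0.
Qed.

Lemma green_kernel_unique r j j' y z : green_kernel a A B x r ->
  Iset a j y -> Iset a j' z -> r j j' y z = (green a x P j j' y z)%:C%C.
Proof.
move=> hr hy hz; apply: (part_ext (w := rgreen j j' y z)) => b; apply/eqP.
have hg := rgreen_green_kernel.
by rewrite eq_le !green_kernel_part_le.
Qed.

End GreenKernel.

(** * Choice of the threshold for [kappa] *)

Lemma finite_eventually (R : realType) (I : finType) (Q : I -> R -> Prop) :
  (forall i, exists X, forall x, X <= x -> Q i x) -> exists X, forall x, X <= x -> forall i, Q i x.
Proof.
move=> /choice[f Hf]; exists (\sum_i `|f i|) => x hx i; apply: Hf; apply: le_trans hx.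
apply: le_trans (ler_norm _) _; rewrite (bigD1 i)//= lerDl; exact: sumr_ge0.
Qed.

(* With [s = exp (- a x / 8)] for the shortest length [a], the entries of [P]
   lie in [[s, 1/s]] while the transmission factors are at most [s^8]. *)
Lemma small_constants (R : realFieldType) (n : nat) (s : R) : 0 < s -> 8 * (n%:R + 1) ^+ 2 * s <= 1 ->
  [/\ 2 * s ^+ 8 <= 1, n%:R * (s ^+ 8 * (s^-1 + 1)) <= 1 / 2,
      n%:R * (s^-1 * (2 * s ^+ 8)) <= 1 / 2,
      n%:R * (s^-1 * (2 * s ^+ 8) * (2 * s^-1)) < s &
      n%:R * (n%:R * (2 * s^-1 * (2 * s ^+ 8))) <= 1 / 2].
Proof.
move=> s0 hs; have n0 : 0 <= n%:R :> R by [].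
move: (n%:R) n0 hs => N N0 hs.
have sX m : s * s ^+ m <= s.
  rewrite ler_piMr ?(ltW s0)// exprn_ile1 ?(ltW s0)//.
  have : 1 <= 8 * (N + 1) ^+ 2 by nra.
  by move=> h; nra.
have s8 : s ^+ 8 = s * s ^+ 7 by rewrite -exprS.
have s7 : s ^+ 7 = s * s ^+ 6 by rewrite -exprS.
have s6 : s ^+ 6 = s * s ^+ 5 by rewrite -exprS.
have p5 : 0 < s ^+ 5 by rewrite exprn_gt0.
have h5 : s * s ^+ 5 <= s by exact: sX.
have h6 : s * s ^+ 6 <= s by exact: sX.
have h7 : s * s ^+ 7 <= s by exact: sX.
have i8 : s^-1 * s ^+ 8 = s * s ^+ 6 by rewrite s8 mulrA mulVf ?gt_eqF// mul1r s7.
have Ns : 8 * (N * s) <= 1 by nra.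
have NNs : 8 * (N * (N * s)) <= 1 by nra.
have s1 : 8 * s <= 1 by nra.
split.
- by rewrite s8; lra.
- rewrite mulrDr mulr1 mulrC [s ^+ 8 * s^-1]mulrC i8 s8.
  have : N * (s * s ^+ 6 + s * s ^+ 7) <= N * (s + s) by rewrite ler_wpM2l// lerD.
  by lra.
- rewrite (_ : N * (s^-1 * (2 * s ^+ 8)) = 2 * (N * (s^-1 * s ^+ 8))); last by ring.
  rewrite i8.
  have : N * (s * s ^+ 6) <= N * s by rewrite ler_wpM2l.
  by lra.
(* The tightest of the five conditions, [4 N s ^+ 6 < s]: the bound [s ^+ 6 <= s ^+ 2] is enough, as
   [8 N s <= 1] gives [4 N s ^+ 2 <= s / 2]. *)
- rewrite (_ : N * (s^-1 * (2 * s ^+ 8) * (2 * s^-1)) = N * (4 * (s ^+ 5 * s))); last first.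
    by rewrite s8 s7 s6; field; rewrite gt_eqF.
  have : N * (s ^+ 5 * s * s) <= N * (s * s).
    by rewrite ler_wpM2l// ler_wpM2r ?(ltW s0)// mulrC.
  have : s ^+ 5 * s <= s * s.
    by rewrite ler_wpM2r ?(ltW s0)// (exprS _ 4) sX.
  move=> h _; have : N * (4 * (s ^+ 5 * s)) <= N * (4 * (s * s)) by rewrite ler_wpM2l// ler_wpM2l.
  by have := mulr_gt0 s0 s0; nra.
- rewrite (_ : N * (N * (2 * s^-1 * (2 * s ^+ 8))) = N * (N * (4 * (s^-1 * s ^+ 8)))); last by ring.
  rewrite i8.
  have : N * (N * (4 * (s * s ^+ 6))) <= N * (N * (4 * s)) by rewrite !ler_wpM2l.
  by lra.
Qed.

Unset Implicit Arguments.

Theorem theorem5p1 (R : realType) (V : finType) (nE nI : nat)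
    (dE : 'I_nE -> V) (dm dp : 'I_nI -> V) (a : 'I_nI -> R)
    (A B : 'M[R[i]]_(Kdim nE nI)) :
  connected_graph dm dp ->
  (forall i, 0 < a i) ->
  (0 < nI)%N ->
  no_tadpoles dm dp ->
  max_isotropic A B ->
  locally_strictly_positive dE dm dp A B ->
  exists kappa0 : R, 0 <= kappa0 /\
    forall kappa : R, kappa0 <= kappa ->
      (exists r, green_kernel a A B kappa r) /\
      forall r, green_kernel a A B kappa r ->
        forall (j j' : edge nE nI) (x y : R),
          Iset a j x -> Iset a j' y -> 0 < r j j' x y.
Proof.
move=> conn a_gt0 nI0 _ _ lsp.
have [P [x0 [x0_gt0 Ppos Poff Psub bc]]] := local_scattering lsp.
have [am am0 amle] : exists2 am : R, 0 < am & forall i, am <= a i.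
  have [i0 _ hi0] := @arg_minP _ _ 'I_nI (Ordinal nI0) xpredT a isT.
  by exists (a i0) => // i; exact: hi0.
(* With this rate [s ^+ 8] below equals [expR (- (am * x))], which dominates every transmission
   factor. *)
pose al := am / 8; have al0 : 0 < al by rewrite divr_gt0.
have [X1 H1] : exists X, forall x, X <= x -> forall kl : 'I_(Kdim nE nI) * 'I_(Kdim nE nI),
    kvert dE dm dp kl.1 = kvert dE dm dp kl.2 ->
    expR (- (al * x)) <= P x kl.1 kl.2 <= expR (al * x).
  apply: finite_eventually => -[k l] /=.
  have [kl|kl] := eqVneq (kvert dE dm dp k) (kvert dE dm dp l); last first.
    by exists 0 => x _ /eqP; rewrite (negPf kl).
  by have [X HX] := Psub al k l al0 kl; exists X => x /HX.
pose C : R := 8 * ((Kdim nE nI)%:R + 1) ^+ 2.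
have C0 : 0 < C by rewrite mulr_gt0// exprn_gt0// ltr_wpDl.
(* In degree 0 this reads [C <= expR (al * x)], that is [C * s <= 1]. *)
have [X2 H2] := expR_dominates 0 C0 al0.
exists (Num.max x0 (Num.max X1 X2)); split; first by rewrite le_max (ltW x0_gt0).
move=> x; rewrite !ge_max => /andP[x0x /andP[/H1{}H1 /H2{}H2]].
have x_gt0 : 0 < x by exact: lt_le_trans x0x.
pose s := expR (- (al * x)); have s0 : 0 < s by exact: expR_gt0.
have sV : s^-1 = expR (al * x) by rewrite /s expRN invrK.
have Cs : C * s <= 1.
  by rewrite -ler_pdivlMr// mul1r sV; move: H2; rewrite expr0 mulr1.
have [c1 c2 c3 c4 c5] := small_constants s0 Cs.
have ttle k : transmission (nE := nE) a x k <= s ^+ 8.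
  rewrite /transmission; case: kedge => i; first by rewrite exprn_ge0// ltW.
  rewrite -expRM_natl ler_expR mulrN mulrA /al mulrCA divff ?mulr1// mulNr lerN2 mulrC.
  by rewrite ler_wpM2l ?(ltW x_gt0).
have sV0 : 0 <= s^-1 by rewrite invr_ge0 ltW.
have Ple k l : `|P x k l| <= s^-1.
  have [kl|kl] := eqVneq (kvert dE dm dp k) (kvert dE dm dp l); last by rewrite Poff// normr0.
  by rewrite ger0_norm ?(ltW (Ppos _ _ _ x0x kl))// sV; have /andP[] := H1 (k, l) kl.
have s8 : 0 <= s ^+ 8 by rewrite exprn_ge0// ltW.
have WE := WmxE ttle Ple c2.
have mU := matching_unique ttle Ple c2.
have bcx c c' := bc x c c' x0x.
split; first by exists (rgreen a x (P x)); exact: rgreen_green_kernel.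
move=> r hr j j' y z hy hz.
rewrite (green_kernel_unique a_gt0 x_gt0 WE mU bcx hr hy hz) -[0]/(0%:C%C) ltcR.
rewrite /green mulr_gt0 ?invr_gt0 ?mulr_gt0//.
apply: (@greenK_gt0 R nE nI a a_gt0 x x_gt0 (P x) (s ^+ 8) s^-1 s8 ttle c1 sV0 Ple c2
  V dE dm dp s _ _ s0 c3 c4 c5 conn j j' y z hy hz) => k l kl; first exact: Poff.
by have /andP[] := H1 (k, l) kl.
Qed.
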